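(* Let $n\ge 1$, $\hbar>0$, and let $X\in\mathfrak{sp}(2n,\mathbb{R})$. Let $H(z)=-\frac12\langle JXz,z\rangle$, $z=(x,p)\in\mathbb{R}^n\times\mathbb{R}^n$, be the associated quadratic Hamiltonian, and let $u$, with $u(\cdot,t)\in\mathcal{S}(\mathbb{R}^n)$, be the solution of the Schrödinger equation $$i\hbar\frac{\partial u}{\partial t}(x,t)=\widehat{H}u(x,t).$$ Suppose that at time $t=0$ and at time $t=T$ the solution satisfies, for all $x\in\mathbb{R}^n$, $$|u(x,0)|\le Ke^{-\alpha|x|^2}\quad\text{and}\quad |u(x,T)|\le Ke^{-\beta|x|^2}$$ for some constants $\alpha,\beta,K>0$. Let $\mathcal{B}(T)$ denote the upper right $n\times n$ block of the matrix $\exp(TX)$, i.e. $\exp(TX)=\begin{pmatrix}\cdot & \mathcal{B}(T)\\ \cdot&\cdot\end{pmatrix}$. If $\exp(TX)$ is free symplectic (that is, $\det\mathcal{B}(T)\ne0$) and $$(2\hbar)^2\,\|\mathcal{B}(T)\|_{\mathrm{op}}^2\,\alpha\beta>1,$$ then $u\equiv0$.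
   Context: $J=\begin{pmatrix}0&I\\-I&0\end{pmatrix}$ is the standard $2n\times2n$ symplectic matrix. The symplectic group $\mathrm{Sp}(2n,\mathbb{R})$ consists of the real $2n\times 2n$ matrices $S$ with $S^TJS=J$; its Lie algebra $\mathfrak{sp}(2n,\mathbb{R})$ consists of the real $2n\times2n$ matrices $X$ with $XJ+JX^T=0$ (equivalently, $M:=-JX$ is symmetric, so $X=JM$ and $H(z)=\frac12\langle Mz,z\rangle$). A symplectic matrix $\begin{pmatrix}A&B\\C&D\end{pmatrix}$ (with $n\times n$ blocks) is called free if $\det B\neq0$. $\widehat{H}$ is the Weyl quantization of $H$: $\widehat{x}_j$ is multiplication by $x_j$, $\widehat{p}_j=-i\hbar\,\partial/\partial x_j$, and $x_jp_k$ is quantized as $\frac12(\widehat{x}_j\widehat{p}_k+\widehat{p}_k\widehat{x}_j)$; explicitly, $\widehat H=\frac12\sum_{j,k=1}^{2n}M_{jk}\widehat z_j\widehat z_k$ with $(\widehat z_1,\dots,\widehat z_{2n})=(\widehat x_1,\dots,\widehat x_n,\widehat p_1,\dots,\widehat p_n)$. $\mathcal{S}(\mathbb{R}^n)$ is the Schwartz space and $\|\cdot\|_{\mathrm{op}}$ is the operator norm with respect to the Euclidean norm. *)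

(* Defs.v *)
From HB Require Import structures.
From mathcomp Require Import all_boot all_order all_algebra.
From mathcomp Require Import complex.
From mathcomp Require Import all_classical all_reals all_analysis.

Set Implicit Arguments.
Unset Strict Implicit.
Unset Printing Implicit Defensive.

Import Order.TTheory GRing.Theory Num.Theory.
Import numFieldNormedType.Exports.

Local Open Scope classical_set_scope.
Local Open Scope ring_scope.
Local Open Scope complex_scope.

Section Euclidean.
Variable R : realType.

Definition dot n (x y : 'cV[R]_n) : R := \sum_(i < n) x i 0 * y i 0.

(* The library norm on matrices is the max norm, hence the explicit Euclidean
   norm. *)
Definition enorm n (x : 'cV[R]_n) : R := Num.sqrt (dot x x).

Definition opnorm m n (A : 'M[R]_(m, n)) : R :=
  sup [set enorm (A *m x) | x in [set x : 'cV[R]_n | enorm x <= 1]].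

End Euclidean.

Section Symplectic.
Variables (R : realType) (n : nat).

Definition Jmx : 'M[R]_(n + n) := block_mx 0 1%:M (- 1%:M) 0.

Definition in_sp (X : 'M[R]_(n + n)) : Prop := X *m Jmx + Jmx *m X^T = 0.

Definition hamiltonian (X : 'M[R]_(n + n)) (z : 'cV[R]_(n + n)) : R :=
  - (2^-1 * dot (Jmx *m X *m z) z).

End Symplectic.

Definition expmx (R : realType) n (A : 'M[R]_n) : 'M[R]_n :=
  limn (series (fun k => k`!%:R^-1 *: A ^+ k)).

Section ComplexCalculus.
Variable R : realType.

(* R[i] is not a normed module over R in the libraries: derivatives of
   complex-valued functions of real variables are taken componentwise. *)

Definition cderivable (f : R -> R[i]) (t : R) : Prop :=
  derivable (fun s => complex.Re (f s)) t 1 /\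
  derivable (fun s => complex.Im (f s)) t 1.

Definition cderive (f : R -> R[i]) (t : R) : R[i] :=
  Complex (derive1 (fun s => complex.Re (f s)) t)
          (derive1 (fun s => complex.Im (f s)) t).

Variable n : nat.

Definition cdifferentiable (f : 'cV[R]_n -> R[i]) (x : 'cV[R]_n) : Prop :=
  differentiable (fun y => complex.Re (f y)) x /\
  differentiable (fun y => complex.Im (f y)) x.

Definition cpartial (j : 'I_n) (f : 'cV[R]_n -> R[i]) : 'cV[R]_n -> R[i] :=
  fun x => Complex ('D_(delta_mx j 0) (fun y => complex.Re (f y)) x)
                   ('D_(delta_mx j 0) (fun y => complex.Im (f y)) x).

Definition cpartials (s : seq 'I_n) (f : 'cV[R]_n -> R[i]) :
    'cV[R]_n -> R[i] :=
  foldr cpartial f s.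

(* The first clause says that f is of class C^oo. *)
Definition schwartz (f : 'cV[R]_n -> R[i]) : Prop :=
  (forall (s : seq 'I_n) (x : 'cV[R]_n), cdifferentiable (cpartials s f) x) /\
  (forall (a : 'I_n -> nat) (s : seq 'I_n), exists C : R,
     forall x : 'cV[R]_n,
       `|(\prod_(i < n) x i 0 ^+ a i)%:C * cpartials s f x| <= C%:C).

End ComplexCalculus.

Section Weyl.
Variables (R : realType) (n : nat) (hbar : R).

Definition zhat (j : 'I_(n + n)) (f : 'cV[R]_n -> R[i]) : 'cV[R]_n -> R[i] :=
  match fintype.split j with
  | inl k => fun x => (x k 0)%:C * f x
  | inr k => fun x => - ('i%C * hbar%:C) * cpartial k f x
  end.

(* For a quadratic form H the symmetric matrix M below is unique. *)
Definition weyl_quantization (H : 'cV[R]_(n + n) -> R)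
    (Hhat : ('cV[R]_n -> R[i]) -> 'cV[R]_n -> R[i]) : Prop :=
  exists M : 'M[R]_(n + n),
    [/\ M^T = M,
        forall z, H z = 2^-1 * dot (M *m z) z
      & forall f x, Hhat f x =
          (2^-1)%:C * \sum_j \sum_k (M j k)%:C * zhat j (zhat k f) x].

Definition schrodinger_solution
    (Hhat : ('cV[R]_n -> R[i]) -> 'cV[R]_n -> R[i])
    (u : 'cV[R]_n -> R -> R[i]) : Prop :=
  (forall t, schwartz (u ^~ t)) /\
  (forall x t, cderivable (u x) t /\
     'i%C * hbar%:C * cderive (u x) t = Hhat (u ^~ t) x).

End Weyl.

(* Main.v *)
(** Let [rho z], for [z = (y, eta)] in phase space, be the Weyl operator
    [exp (i (eta . x - y . p) / hbar)].  For a quadratic Hamiltonian the classical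
    flow is exact: if [z' = X z] then [rho (z t) (u t)] solves the same equation
    as [u t], so the L2 norms of linear combinations of such translates of [u]
    are conserved.  Starting from [z 0 = (0, s v)], polarization turns this into
    [int |u_0|^2 cos (s v.x / hbar) = Re <rho (z T) u_T, u_T>], where the position
    part of [z T] is [s B v].  Call this function [f s].  The Gaussian bound at
    time [T] gives [|f s| <= C exp (- b s^2)]; the one at time [0] gives
    [f s = sum (-1)^k m_k s^(2k)] with [m_k >= 0] and
    [sum m_k s^(2k) <= C exp (a s^2)]; the hypothesis on the norm of [B] allows
    [a < b].  The transform [int f s exp (- l s^2) ds] is then a power series in
    [l] for [l < b] and a series in the powers [l^(- k - 1/2)] for [l > a].
    Continuing the identity of the two series around the annulus [a < |l| < b]
    gives a linear relation between the values [sin (z theta)] at the exponents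
    [z] of both, for every angle [theta].  At [theta = pi] the integer exponents
    drop out, and the relation reads [sum m_k g_k = 0] with positive Gaussian
    moments [g_k]; hence [m_0], the squared norm of [u_0], vanishes.

    The solution is only assumed to be Schwartz at each single time, whereas
    differentiating an L2 norm in time needs bounds that are locally uniform in
    time.  On an interval where such bounds hold, the conserved norms of iterated
    Weyl difference quotients [(rho (h z) u - u) / h] bound all moments and
    derivatives at one time by those at another one; a Baire category argument
    then makes the bounds uniform on every compact interval. *)

Require Import Defs.
From HB Require Import structures.
From mathcomp Require Import all_boot all_order all_algebra.
From mathcomp Require Import complex.
From mathcomp Require Import all_classical all_reals all_analysis.
From mathcomp Require Import measurable_realfun ring lra.

Set Implicit Arguments.
Unset Strict Implicit.
Unset Printing Implicit Defensive.

Import Order.TTheory GRing.Theory Num.Theory.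
Import numFieldNormedType.Exports.

Local Open Scope classical_set_scope.
Local Open Scope ring_scope.
Local Open Scope complex_scope.

(** * Integrals of functions dominated by a Cauchy weight *)

(** [f] is the characteristic function of [v.x / hbar] under the density [|u_0|^2], and [m_0] is the
    total mass. The mass does not depend on [v], so one direction that [B] stretches enough settles
    the matter; this is why the operator norm of [B] enters.

    The density decays like [exp (- 2 alpha |x|^2)], so for [|v| <= 1] Young's inequality allows
    every [a > 1 / (8 hbar^2 alpha)]. The Gaussian of rate [beta] overlaps with its translate by
    [s B v] at most like [exp (- beta s^2 |B v|^2 / 2)], and any smaller [b] leaves a part over for
    integrability. Hence [a < b] can be arranged as soon as [4 hbar^2 alpha beta |B v|^2 > 1].

    The continuation runs in [y = ln l], towards [y + i theta]. At [theta = pi] the variable [l] is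
    negative: the power series is still real, while every [l^(- k - 1/2)] has become imaginary, with
    signs alternating like those of its coefficients. The imaginary part therefore has terms of one
    sign only. *)

Section LineIntegral.
Variable R : realType.
Notation mu := (@lebesgue_measure R).
Implicit Types (f g h : R -> R) (C x s : R).

(** One fixed integrable weight: domination by a multiple of it serves as integrability criterion,
    as dominating function for limits and as decay at infinity; products of it serve in several
    variables. *)
Definition cauchy_weight s : R := (1 + s ^+ 2)^-1.

Definition int1 f : R := \int[mu]_x f x.

Local Notation w := cauchy_weight.

Lemma cauchy_weight_gt0 s : 0 < w s.
Proof. by rewrite invr_gt0 ltr_wpDr ?sqr_ge0. Qed.

Lemma cauchy_weight_ge0 s : 0 <= w s.
Proof. exact/ltW/cauchy_weight_gt0. Qed.

Lemma cauchy_weight_le1 s : w s <= 1.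
Proof. by rewrite invf_le1 ?ltr_wpDr ?sqr_ge0// lerDl sqr_ge0. Qed.

Lemma continuous_cauchy_weight : continuous w.
Proof. exact: continuous_oneDsqrV. Qed.

Lemma integrable_cauchy_weight : mu.-integrable setT (EFin \o w).
Proof.
apply/integrableP; split.
  by apply/measurable_EFinP; apply: continuous_measurable_fun;
     exact: continuous_cauchy_weight.
rewrite /=; under eq_integral do rewrite ger0_norm ?cauchy_weight_ge0//.
rewrite ge0_symfun_integralT//; last 3 first.
- exact: cauchy_weight_ge0.
- exact: continuous_cauchy_weight.
- by move=> x; rewrite /= /w sqrrN.
rewrite -set_itvcy.
have := @integral0y_oneDsqr R; rewrite /oneDsqr/= => ->.
by rewrite -EFinM ltry.
Qed.

(** Continuity is part of domination: it supplies measurability, lets the fundamental theorem of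
    calculus apply, and makes a nonnegative function with zero integral vanish at every point. *)
Definition dom1 C f := continuous f /\ (forall s, `|f s| <= C * w s).

Lemma dom1_ge0 C f : dom1 C f -> 0 <= C.
Proof.
move=> [_ /(_ 0)] h; rewrite -(pmulr_lge0 _ (cauchy_weight_gt0 0)).
exact: le_trans h.
Qed.

Lemma dom1_integrable C f : dom1 C f -> mu.-integrable setT (EFin \o f).
Proof.
move=> [cf fC].
apply: (@le_integrable _ _ _ mu setT measurableT _ (EFin \o (fun x => C * w x))).
- by apply/measurable_EFinP; exact: continuous_measurable_fun.
- move=> x _ /=; rewrite lee_fin; apply: le_trans (fC x) _; exact: ler_norm.
- rewrite (_ : _ \o _ = (fun x => C%:E * (EFin \o w) x)%E)//.
  by apply: integrableZl => //; exact: integrable_cauchy_weight.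
Qed.

Lemma dom1D C D f g : dom1 C f -> dom1 D g -> dom1 (C + D) (fun s => f s + g s).
Proof.
move=> [cf fC] [cg gD]; split; first by move=> x; exact: cvgD (cf x) (cg x).
by move=> s; rewrite mulrDl; exact: le_trans (ler_normD _ _) (lerD (fC s) (gD s)).
Qed.

Lemma dom1Z C a f : dom1 C f -> dom1 (`|a| * C) (fun s => a * f s).
Proof.
move=> [cf fC]; split; first by move=> x; apply: cvgM; [exact: cvg_cst|exact: cf].
by move=> s; rewrite normrM -mulrA ler_wpM2l.
Qed.

Lemma dom1_norm C f : dom1 C f -> dom1 C (fun s => `|f s|).
Proof.
move=> [cf fC]; split; first by move=> x; apply: cvg_norm; exact: cf.
by move=> s; rewrite normr_id.
Qed.

Lemma dom1_cauchy_weight : dom1 1 w.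
Proof.
split; first exact: continuous_cauchy_weight.
by move=> s; rewrite mul1r ger0_norm ?cauchy_weight_ge0.
Qed.

Lemma int1D C D f g : dom1 C f -> dom1 D g ->
  int1 (fun s => f s + g s) = int1 f + int1 g.
Proof. by move=> /dom1_integrable If /dom1_integrable Ig; exact: RintegralD. Qed.

Lemma int1Z C a f : dom1 C f -> int1 (fun s => a * f s) = a * int1 f.
Proof. by move=> /dom1_integrable If; exact: RintegralZl. Qed.

Lemma dom1B C D f g : dom1 C f -> dom1 D g -> dom1 (C + D) (fun s => f s - g s).
Proof.
move=> Cf /(dom1Z (-1)); rewrite normrN1 mul1r => /(dom1D Cf).
by under eq_fun do rewrite mulN1r.
Qed.

Lemma int1B C D f g : dom1 C f -> dom1 D g ->
  int1 (fun s => f s - g s) = int1 f - int1 g.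
Proof. by move=> /dom1_integrable If /dom1_integrable Ig; exact: RintegralB. Qed.

Lemma le_int1 C D f g : dom1 C f -> dom1 D g -> (forall s, f s <= g s) ->
  int1 f <= int1 g.
Proof.
by move=> /dom1_integrable If /dom1_integrable Ig fg; exact: le_Rintegral.
Qed.

Lemma le_norm_int1 C f : dom1 C f -> `|int1 f| <= C * int1 w.
Proof.
move=> Cf; rewrite -(@int1Z 1 C w dom1_cauchy_weight).
apply: le_trans (le_normr_Rintegral _ (dom1_integrable Cf)) _ => //.
apply: (le_int1 (dom1_norm Cf) (dom1Z C dom1_cauchy_weight)).
by case: Cf.
Qed.

Lemma int1_cvg C (F : nat -> R -> R) f :
  (forall k, dom1 C (F k)) -> continuous f ->
  (forall s, F k s @[k --> \oo] --> f s) ->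
  int1 (F k) @[k --> \oo] --> int1 f.
Proof.
move=> CF cf Ff.
have Cf : dom1 C f.
  split=> // s; have Fs : `|F k s| @[k --> \oo] --> `|f s| by apply: cvg_norm; exact: Ff.
  rewrite -(cvg_lim _ Fs)//; apply: limr_le; first by apply/cvg_ex; eexists; exact: Fs.
  by apply: nearW => k; case: (CF k).
have [] := @dominated_convergence _ _ _ mu setT measurableT
  (fun k x => (F k x)%:E) (fun x => (f x)%:E) (fun x => (C * w x)%:E).
- by move=> k; apply/measurable_EFinP; apply: continuous_measurable_fun; case: (CF k).
- by apply/measurable_EFinP; exact: continuous_measurable_fun.
- by apply: aeW => x _; apply: cvg_EFin; [exact: nearW|exact: Ff].
- exact: dom1_integrable (dom1Z C dom1_cauchy_weight).
- by apply: aeW => x k _; rewrite lee_fin; case: (CF k).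
move=> If _ h.
rewrite /int1 /Rintegral; apply: fine_cvg.
rewrite fineK//; exact: integrable_fin_num.
Qed.


Lemma FTC_itv (g h : R -> R) a b : a < b -> continuous h ->
  (forall s : R, is_derive s 1 g (h s)) ->
  \int[mu]_(x in `[a, b]) h x = g b - g a.
Proof.
move=> ab ch gh; have cg : continuous g.
  by move=> x; apply/differentiable_continuous/derivable1_diffP; case: (gh x).
rewrite /Rintegral (@continuous_FTC2 _ h g)//.
- exact: continuous_subspaceT.
- split; first by move=> x _; case: (gh x).
  + by apply: cvg_at_right_filter; exact: cg.
  + by apply: cvg_at_left_filter; exact: cg.
- by move=> x _; rewrite derive1E; apply: derive_val.
Qed.

Lemma cauchy_weight_cvg0 : cauchy_weight (k%:R : R) @[k --> \oo] --> (0:R).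
Proof.
apply: (@squeeze_cvgr _ _ _ _ (fun=> 0) (fun k : nat => k.+1%:R^-1)).
- near=> k; rewrite cauchy_weight_ge0/= /w lef_pV2 ?posrE ?ltr_wpDr ?sqr_ge0//.
  by rewrite -natr1 addrC lerD2l -natrX ler_nat; case: (k) => // m; rewrite leq_pmulr.
- exact: cvg_cst.
- exact: cvg_harmonic.
Unshelve. all: end_near. Qed.

Section Primitive.
Variables (C : R) (g h : R -> R).
Hypotheses (gh : forall s : R, is_derive s 1 g (h s)).
Hypotheses (Ch : dom1 C h) (gC : forall s, `|g s| <= C * w s).

(** The boolean selects the end of the line, so that one statement covers both boundary terms. *)
Let cvg_g (e : bool) : g ((-1) ^+ e * k%:R) @[k --> \oo] --> (0:R).
Proof.
apply/cvgr0Pnorm_le => /= e' e'0.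
have C0 := dom1_ge0 Ch.
have : (C + 1) * w k%:R @[k --> \oo] --> (C+1)* 0.
  by apply: cvgM; [exact: cvg_cst|exact: cauchy_weight_cvg0].
rewrite mulr0 => /cvgr0Pnorm_le /(_ _ e'0) H; near=> k.
have : `|(C + 1) * w k%:R| <= e' by near: k; exact: H.
apply: le_trans; apply: le_trans (gC _) _.
rewrite ger0_norm ?mulr_ge0 ?cauchy_weight_ge0 ?addr_ge0//.
rewrite /w exprMn -exprM mulnC exprM sqrrN expr1n expr1n mul1r ler_wpM2r ?cauchy_weight_ge0//.
by rewrite lerDl.
Unshelve. all: end_near. Qed.

(** The boundary terms on [[- k, k]] vanish because the primitive is dominated too. All integrations
    by parts below come from here. *)
Lemma int1_derive : int1 h = 0.
Proof.
have [ch hC] := Ch.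
pose A k : set R := `[- k%:R, k%:R]%classic.
have [] := @dominated_convergence _ _ _ mu setT measurableT
  (fun k x => ((h \_ (A k)) x)%:E) (fun x => (h x)%:E) (fun x => (C * w x)%:E).
- move=> k; apply/measurable_EFinP; apply/(measurable_restrictT _ _).1; first exact: measurable_itv.
  by apply: measurable_funTS; exact: continuous_measurable_fun.
- by apply/measurable_EFinP; exact: continuous_measurable_fun.
- apply: aeW => x _; apply: cvg_EFin; first exact: nearW.
  apply: cvg_near_cst; near=> k; rewrite /= patchE /A mem_setE in_itv/= -ler_norml.
  rewrite ifT//; near: k; exact: nbhs_infty_ger.
- exact: dom1_integrable (dom1Z C dom1_cauchy_weight).
- apply: aeW => x k _; rewrite lee_fin patchE; case: ifP => // _.
  by rewrite normr0 mulr_ge0 ?cauchy_weight_ge0// (dom1_ge0 Ch).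
move=> Ih _ H.
have {H}: \int[mu]_(x in A k) h x @[k --> \oo] --> int1 h.
  rewrite /int1 /Rintegral; apply: fine_cvg.
  rewrite fineK//; last exact: integrable_fin_num.
  apply: cvg_trans H; apply: near_eq_cvg; near=> k.
  by rewrite [RHS]integral_mkcond restrict_EFin.
have H2 : g k%:R - g (- k%:R) @[k --> \oo] --> (0 - 0 : R).
  apply: cvgB.
  - by have := cvg_g false; under eq_fun do rewrite expr0 mul1r.
  - by have := cvg_g true; under eq_fun do rewrite expr1 mulN1r.
move=> H1; rewrite subr0 in H2.
apply: (cvg_unique _ H1); first exact: Rhausdorff.
apply: cvg_trans H2; apply: near_eq_cvg; near=> k.
rewrite /A (@FTC_itv g)// gtrN// ltr0n; near: k; exact: nbhs_infty_gt.
Unshelve. all: end_near. Qed.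

(** The Sobolev inequality of the line: a function that vanishes at minus infinity is the integral
    of its derivative. It is iterated over the coordinates in [le_iint_pd]. *)
Lemma le_int1_derive s : `|g s| <= int1 (fun x => `|h x|).
Proof.
have [ch hC] := Ch.
have Ih : forall a b, mu.-integrable `[a, b] (EFin \o h).
  by move=> a b; apply: integrableS (dom1_integrable Ch).
suff : `|g s - g (- k%:R)| @[k --> \oo] --> `|g s - 0|.
  rewrite subr0 => H; rewrite -(cvg_lim _ H)//; apply: limr_le.
    by apply/cvg_ex; eexists; exact: H.
  near=> k; have ks : - k%:R < s.
    rewrite ltrNl; near: k; exact: nbhs_infty_gtr.
  rewrite -(FTC_itv ks ch gh); apply: le_trans (le_normr_Rintegral _ (Ih _ _)) _ => //.
  rewrite /int1 fine_le//.
  - by apply: integrable_fin_num => //; exact: (integrable_norm (Ih _ _)).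
  - by apply: integrable_fin_num => //; exact: (dom1_integrable (dom1_norm Ch)).
  - apply: ge0_subset_integral => //.
    apply/measurable_EFinP; apply: continuous_measurable_fun.
    by case: (dom1_norm Ch).
apply: cvg_norm; apply: cvgB; first exact: cvg_cst.
by have := cvg_g true; under eq_fun do rewrite expr1 mulN1r.
Unshelve. all: end_near. Qed.

End Primitive.

Lemma int1_eq0 C f : dom1 C f -> (forall s, 0 <= f s) -> int1 f = 0 ->
  forall s, f s = 0.
Proof.
move=> Cf f0 If0 s; have [cf fC] := Cf.
apply/eqP; rewrite eq_le f0 andbT leNgt; apply/negP => fs.
have fs2 : f s / 2 < f s by lra.
have : \forall t \near s, f s / 2 < f t by exact: (cvgr_gt (f s) (cf s)).
case/nbhs_ballP => e /= e0 He.
have hle x : x \in `[s - e/2, s + e/2] -> f s / 2 <= f x.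
  rewrite in_itv/= => /andP[h1 h2]; apply/ltW/He.
  by rewrite /ball/= ltr_norml; lra.
(* A rectangle of height [f s / 2] and width [e] lies below the graph. *)
have : f s / 2 * e <= int1 f.
  have If := dom1_integrable Cf.
  have IA : mu.-integrable `[s - e/2, s + e/2] (EFin \o f) by exact: integrableS If.
  apply: (@le_trans _ _ (\int[mu]_(x in `[s - e/2, s + e/2]) f x)).
    rewrite (_ : _ * e = \int[mu]_(x in `[s - e/2, s + e/2]) (f s / 2)); last first.
      have D x : is_derive x 1 (fun x => f s / 2 * x) (f s / 2).
        apply: is_derive_eq; exact: mulr1.
      rewrite (FTC_itv _ _ D); [lra|lra|by move=> x; exact: cvg_cst].
    apply: le_Rintegral => //.
    apply: continuous_compact_integrable; first exact: segment_compact.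
    by apply: continuous_subspaceT => x; exact: cvg_cst.
  rewrite /int1 fine_le//.
  - exact: integrable_fin_num.
  - exact: integrable_fin_num.
  - apply: ge0_subset_integral => //.
    + by apply/measurable_EFinP; exact: continuous_measurable_fun.
    + by move=> x _; rewrite lee_fin.
by rewrite If0; apply/negP; rewrite -ltNge; apply: mulr_gt0 => //; lra.
Qed.

End LineIntegral.

(** * Limits and derivatives tested on sequences *)

Section SequentialLimits.
Variable R : realType.

(** Dominated convergence speaks of sequences, so continuity and differentiability of integrals are
    reduced to sequences. If the limit failed, every [B k] would contain a bad point, and choosing
    one in each contradicts the hypothesis. *)
Lemma cvg_countable_base (T : Type) (V : pseudoMetricNormedZmodType R)
    (F : set_system T) (FF : Filter F) (B : nat -> set T) (f : T -> V) (l : V) :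
  (forall A, F A -> exists N, forall k, (N <= k)%N -> B k `<=` A) ->
  (forall v : nat -> T, (forall k, B k (v k)) -> f (v k) @[k --> \oo] --> l) ->
  (forall k, F (B k)) ->
  f x @[x --> F] --> l.
Proof.
move=> BF fv FB; apply/cvgrPdist_lt => e e0; apply: contrapT => H.
have /choice[v vP] : forall k, exists x, B k x /\ e <= `|l - f x|.
  move=> k; apply: contrapT => /forallNP H2; apply: H.
  apply: filterS (FB k) => x Bx; have /not_andP[//|/negP] := H2 x.
  by rewrite -ltNge.
have /cvgrPdist_lt/(_ _ e0)[N _ /(_ N)] := fv v (fun k => (vP k).1).
by rewrite /= leqnn => /(_ isT); apply/negP; rewrite -leNgt; case: (vP N).
Qed.

Lemma ltr_harmonic (d : R) : 0 < d ->
  exists N, forall k, (N <= k)%N -> k.+1%:R^-1 < d.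
Proof.
move=> d0; have /cvgr0Pnorm_lt/(_ _ d0)[N _ HN] := @cvg_harmonic R.
exists N => k Nk; apply: le_lt_trans (HN k Nk); exact: ler_norm.
Qed.

Lemma cvg_nbhs_seq (U V : pseudoMetricNormedZmodType R) (f : U -> V) (x : U) (l : V) :
  (forall v : nat -> U, v k @[k --> \oo] --> x -> f (v k) @[k --> \oo] --> l) ->
  f y @[y --> x] --> l.
Proof.
move=> H; apply: (@cvg_countable_base _ _ _ _ (fun k => ball x k.+1%:R^-1)).
- move=> A /nbhs_ballP[d /= d0 dA]; have [N HN] := ltr_harmonic d0.
  exists N => k Nk; apply: subset_trans dA; apply: le_ball; exact/ltW/HN.
- move=> v vx; apply: H; apply/cvgrPdist_lt => e e0.
  have [N HN] := ltr_harmonic e0; exists N => // k /= /HN; apply: lt_trans.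
  by have := vx k; rewrite -ball_normE.
- by move=> k; apply: nbhsx_ballx; rewrite invr_gt0.
Qed.

(** The condition [|v k| <= 1] keeps the increments inside the window where [int1_derive_under] has
    its domination. *)
Lemma cvg_dnbhs0_seq (V : pseudoMetricNormedZmodType R) (f : R -> V) (l : V) :
  (forall v : nat -> R, (forall k, v k != 0) -> (forall k, `|v k| <= 1) ->
    v k @[k --> \oo] --> 0 ->
    f (v k) @[k --> \oo] --> l) ->
  f y @[y --> 0^'] --> l.
Proof.
move=> H; apply: (@cvg_countable_base _ _ _ _
  (fun k => [set h : R | `|h| < k.+1%:R^-1 /\ h != 0])).
- move=> A [d /= d0 dA]; have [N HN] := ltr_harmonic d0.
  exists N => k Nk h [h1 h2]; apply: dA => //=.
  by rewrite sub0r normrN; exact: lt_trans h1 (HN _ Nk).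
- move=> v vx; apply: H => [k|k|]; first by case: (vx k).
    by case: (vx k) => /ltW h _; apply: le_trans h _; rewrite invf_le1 ?ler1n.
  apply/cvgr0Pnorm_lt => e e0.
  have [N HN] := ltr_harmonic e0; exists N => // k /= /HN; apply: lt_trans.
  by case: (vx k).
- move=> k; exists k.+1%:R^-1 => /=; first by rewrite invr_gt0.
  by move=> h /=; rewrite sub0r normrN.
Qed.

Lemma is_derive_seq (f : R -> R) (x l : R) :
  (forall v : nat -> R, (forall k, v k != 0) -> (forall k, `|v k| <= 1) ->
    v k @[k --> \oo] --> 0 ->
    (v k)^-1 * (f (x + v k) - f x) @[k --> \oo] --> l) ->
  is_derive x 1 f l.
Proof.
move=> H; have L : h^-1 *: (f (h *: (1 : R) + x) - f x) @[h --> 0^'] --> l.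
  apply: cvg_dnbhs0_seq => v v0 v1 vl; apply: cvg_trans (H v v0 v1 vl).
  by apply: near_eq_cvg; near=> k; rewrite [_ *: 1]mulr1 [x + _]addrC.
apply: DeriveDef; first by apply/cvg_ex; exists l.
by apply/cvg_lim.
Unshelve. all: end_near. Qed.

Lemma le_norm_diff (f df : R -> R) (C x y : R) :
  (forall t, Num.min x y <= t <= Num.max x y -> is_derive t 1 f (df t)) ->
  (forall t, Num.min x y <= t <= Num.max x y -> `|df t| <= C) ->
  `|f y - f x| <= C * `|y - x|.
Proof.
wlog xy : x y / x < y => [hw|].
  move=> h1 h2; have [xy|yx|xy] := ltgtP x y; first exact: (hw x y xy h1 h2).
    by rewrite distrC (distrC y); apply: (hw y x) => // t; rewrite minC maxC; [exact: h1|exact: h2].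
  by rewrite xy !subrr normr0 mulr0.
rewrite (min_idPl (ltW xy)) (max_idPr (ltW xy)) => h1 h2.
have [||c cxy ->] := @MVT R f df x y xy.
- move=> t; rewrite in_itv/= => /andP[/ltW ? /ltW ?]; exact/h1/andP.
- apply: derivable_within_continuous => t; rewrite in_itv/= => ht.
  by case: (h1 t ht).
- rewrite normrM ler_wpM2r//; apply: h2; move: cxy; rewrite in_itv/=.
  by case/andP => /ltW -> /ltW ->.
Qed.

(** By the mean value inequality the difference quotients inherit the domination of [dphi] with the
    same constant, so dominated convergence applies to them. *)
Lemma int1_derive_under (phi dphi : R -> R -> R) (C t : R) :
  (forall r, `|r - t| <= 1 -> dom1 C (phi r)) ->
  (forall r, `|r - t| <= 1 -> dom1 C (dphi r)) ->
  (forall r s, `|r - t| <= 1 ->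
     is_derive r (1 : R) (fun r => phi r s) (dphi r s)) ->
  is_derive t 1 (fun t => int1 (phi t)) (int1 (dphi t)).
Proof.
move=> Cp Cd dp; apply: is_derive_seq => v v0 v1 vl.
have tt : `|t - t| <= 1 by rewrite subrr normr0.
have tv k : `|t + v k - t| <= 1 by rewrite addrC addKr.
rewrite (_ : (fun k => _) = (fun k => int1 (fun s => (v k)^-1 * (phi (t + v k) s - phi t s)))).
  2:{ apply/funext => k.
  by rewrite (int1Z _ (dom1B (Cp _ (tv k)) (Cp _ tt))) (int1B (Cp _ (tv k)) (Cp _ tt)). }
have Cq k : dom1 C (fun s => (v k)^-1 * (phi (t + v k) s - phi t s)).
  have [c1 _] := Cp _ tt; have [c2 _] := Cp _ (tv k).
  split=> [s|s].
    by apply: cvgM; [exact: cvg_cst|apply: cvgB; [exact: c2|exact: c1]].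
  rewrite normrM normfV mulrC ler_pdivrMr ?normr_gt0//.
  have := @le_norm_diff (fun r => phi r s) (fun r => dphi r s) (C * cauchy_weight s) t (t + v k).
  rewrite (_ : t + v k - t = v k); last by ring.
  have rt r : Num.min t (t + v k) <= r <= Num.max t (t + v k) -> `|r - t| <= 1.
    have := v1 k; rewrite !ler_norml => /andP[? ?].
    by rewrite ge_min le_max => /andP[/orP[?|?] /orP[?|?]]; lra.
  by apply=> r /rt rt1; [exact: dp|case: (Cd r rt1)].
apply: (int1_cvg Cq); first by case: (Cd t tt).
move=> s; have [d1 d2] := dp t s tt.
have : h^-1 *: (phi (h *: (1:R) + t) s - phi t s) @[h --> 0^'] --> dphi t s.
  by rewrite -d2; exact: d1.
move=> L; have : (v k)^-1 *: (phi (v k *: (1:R) + t) s - phi t s) @[k --> \oo] --> dphi t s.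
  apply: (@cvg_comp _ _ _ v _ _ (0^') _ _ L).
  move=> A [d /= d0 dA]; move/cvgr0Pnorm_lt: vl => /(_ _ d0)[N _ HN].
  by exists N => // k /= /HN hk; apply: dA => //=; rewrite sub0r normrN.
move=> L2; apply: cvg_trans L2; apply: near_eq_cvg; near=> k.
by rewrite [_ *: 1]mulr1 (addrC t).
Unshelve. all: end_near. Qed.

End SequentialLimits.

(* Rewriting with [cvgD] and its kin at a point of a matrix space unfolds
    [nbhs], after which its filter instance is no longer found: hence these
    statements about continuous functions on an abstract space. *)
Section ContinuousOperations.
Variables (R : realType) (T : topologicalType).
Implicit Types f g : T -> R.

Lemma continuous_cst (c : R) : continuous (fun _ : T => c).
Proof. by move=> x; exact: cvg_cst. Qed.

Lemma continuous_add f g : continuous f -> continuous g ->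
  continuous (fun x => f x + g x).
Proof. by move=> cf cg x; exact: cvgD (cf x) (cg x). Qed.

Lemma continuous_sub f g : continuous f -> continuous g ->
  continuous (fun x => f x - g x).
Proof. by move=> cf cg x; exact: cvgB (cf x) (cg x). Qed.

Lemma continuous_mul f g : continuous f -> continuous g ->
  continuous (fun x => f x * g x).
Proof. by move=> cf cg x; exact: cvgM (cf x) (cg x). Qed.

Lemma continuous_norm f : continuous f -> continuous (fun x => `|f x|).
Proof. by move=> cf x; exact: cvg_norm (cf x). Qed.

End ContinuousOperations.

(** * Iterated integrals over coordinate space *)

Section IteratedIntegral.
Variables (R : realType) (n : nat).
Notation V := 'cV[R]_n.
Implicit Types (x y : V) (f g h : V -> R) (l r : seq 'I_n) (C D s : R).
Local Notation w := (@cauchy_weight R).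

(** Written as a translation along an axis, so that derivatives in the new value are directional
    derivatives; [updE] gives back the substitution. *)
Definition upd x (j : 'I_n) s : V := x + (s - x j 0) *: delta_mx j 0.

Lemma updE x j s i : upd x j s i 0 = if i == j then s else x i 0.
Proof.
rewrite !mxE eqxx andbT; case: eqP => [->|_]; first by rewrite mulr1 addrC subrK.
by rewrite mulr0 addr0.
Qed.

Lemma upd_id x j : upd x j (x j 0) = x.
Proof. by rewrite /upd subrr scale0r addr0. Qed.

Lemma updC x j k s t : j != k -> upd (upd x j s) k t = upd (upd x k t) j s.
Proof.
move=> jk; apply/colP => i; rewrite !updE; case: eqP => // ->.
by rewrite eq_sym (negbTE jk).
Qed.

Lemma continuous_upd x j : continuous (upd x j).
Proof.
move=> s; apply: cvgD; first exact: cvg_cst.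
by apply: cvgZr_tmp; apply: cvgB; [exact: cvg_id|exact: cvg_cst].
Qed.

Lemma continuous_upd_l j s : continuous (fun x => upd x j s).
Proof.
move=> x; have c1 : {for x, continuous (fun x : V => x)} by move=> ?.
have c2 : continuous (fun x : V => s - x j 0).
  by apply: continuous_sub; [exact: continuous_cst|exact: coord_continuous].
exact: (@continuousD _ _ V _ _ x c1 (continuousZr_tmp (c2 x))).
Qed.

Definition weight l x : R := \prod_(j <- l) w (x j 0).

Lemma weight_gt0 l x : 0 < weight l x.
Proof. by apply: prodr_gt0 => j _; exact: cauchy_weight_gt0. Qed.

Lemma weight_le1 l x : weight l x <= 1.
Proof.
rewrite /weight; elim: l => [|j l IH]; first by rewrite big_nil.
by rewrite big_cons mulr_ile1 ?cauchy_weight_ge0 ?cauchy_weight_le1//; exact/ltW/weight_gt0.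
Qed.

Lemma weight_upd l x j s : j \notin l -> weight l (upd x j s) = weight l x.
Proof.
move=> jl; apply: eq_big_seq => i il; rewrite updE; case: eqP => // ij.
by rewrite -ij il in jl.
Qed.

Definition dom l C f := continuous f /\ (forall x, `|f x| <= C * weight l x).

Lemma dom_ge0 l C f : dom l C f -> 0 <= C.
Proof.
move=> [_ /(_ 0)] h; rewrite -(pmulr_lge0 _ (weight_gt0 l 0)).
exact: le_trans h.
Qed.

Lemma dom_perm l r C f : perm_eq l r -> dom l C f -> dom r C f.
Proof.
by move=> lr [cf fC]; split=> // x; rewrite /weight -(perm_big _ lr); exact: fC.
Qed.

Lemma dom_catl l r C f : dom (l ++ r) C f -> dom l C f.
Proof.
move=> Cf; have [cf fC] := Cf; split=> // x; apply: le_trans (fC x) _.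
rewrite ler_wpM2l ?(dom_ge0 Cf)// /weight big_cat/= ler_piMr//.
  exact/ltW/weight_gt0.
exact: weight_le1.
Qed.

Lemma dom_catr l r C f : dom (l ++ r) C f -> dom r C f.
Proof.
move=> Cf; apply: (@dom_catl r l); apply: dom_perm Cf.
exact: permEl (perm_catC _ _).
Qed.

Lemma dom_enum l C f : uniq l -> dom (enum 'I_n) C f -> dom l C f.
Proof.
move=> ul Cf; apply: (@dom_catl l [seq i <- enum 'I_n | i \notin l]).
apply: dom_perm Cf; apply: uniq_perm; rewrite ?enum_uniq//.
  rewrite cat_uniq ul filter_uniq ?enum_uniq// andbT; apply/hasPn => i.
  by rewrite mem_filter => /andP[].
by move=> i; rewrite mem_cat mem_filter mem_enum andbT orbN.
Qed.

Lemma domD l C D f g : dom l C f -> dom l D g -> dom l (C + D) (fun x => f x + g x).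
Proof.
move=> [cf fC] [cg gD]; split; first exact: continuous_add.
by move=> s; rewrite mulrDl; exact: le_trans (ler_normD _ _) (lerD (fC s) (gD s)).
Qed.

Lemma domZ l C a f : dom l C f -> dom l (`|a| * C) (fun x => a * f x).
Proof.
move=> [cf fC]; split; first by apply: continuous_mul => //; exact: continuous_cst.
by move=> s; rewrite normrM -mulrA ler_wpM2l.
Qed.

Lemma dom_norm l C f : dom l C f -> dom l C (fun x => `|f x|).
Proof.
move=> [cf fC]; split; first exact: continuous_norm.
by move=> s; rewrite normr_id.
Qed.

(** Induction on the list of coordinates takes the place of a product measure, and the order of
    integration is never exchanged. The result still depends on the coordinates outside the list. *)
Definition iint l f : V -> R :=
  foldr (fun j g x => int1 (fun s => g (upd x j s))) f l.

Lemma dom_line j r C f x : j \notin r -> dom (j :: r) C f ->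
  dom1 (C * weight r x) (fun s => f (upd x j s)).
Proof.
move=> jr [cf fC]; split.
  by move=> s; apply: continuous_comp; [exact: continuous_upd|exact: cf].
move=> s; apply: le_trans (fC _) _.
by rewrite /weight big_cons updE eqxx -/(weight r _) weight_upd// mulrCA mulrC.
Qed.

Definition kappa : R := int1 w.

Lemma kappa_ge0 : 0 <= kappa.
Proof. by apply: Rintegral_ge0 => s _; exact: cauchy_weight_ge0. Qed.

(** Integrating one variable uses up its factor of the weight at the price of a factor [kappa], and
    keeps continuity in the others. The domination therefore survives the whole iteration. *)
Lemma dom_int1 j r C f : j \notin r -> dom (j :: r) C f ->
  dom r (C * kappa) (fun x => int1 (fun s => f (upd x j s))).
Proof.
move=> jr Cf; split; last first.
  by move=> x; apply: le_trans (le_norm_int1 (dom_line x jr Cf)) _; rewrite mulrAC.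
move=> x; apply: cvg_nbhs_seq => v vx.
have C0 := dom_ge0 Cf; have [cf _] := Cf.
apply: (@int1_cvg _ C).
- move=> k; have [c h] := dom_line (v k) jr Cf; split=> // s.
  apply: le_trans (h s) _; rewrite ler_wpM2r ?cauchy_weight_ge0//.
  by rewrite ler_piMr// weight_le1.
- by have [] := dom_line x jr Cf.
- move=> s; have c : {for x, continuous (fun y => f (upd y j s))}.
    exact: (@continuous_comp V V R (fun y => upd y j s) f x
      (@continuous_upd_l j s x) (cf _)).
  exact: (cvg_comp v _ vx c).
Qed.

Lemma dom_iint l r C f : uniq (l ++ r) -> dom (l ++ r) C f ->
  dom r (C * kappa ^+ size l) (iint l f).
Proof.
elim: l r => [r _|j l IH r]; first by rewrite expr0 mulr1.
rewrite cat_cons /= => /andP[jlr ulr] Cf.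
rewrite exprSr mulrA; apply: dom_int1.
  by move: jlr; rewrite mem_cat negb_or => /andP[].
have p : perm_eq (j :: l ++ r) (l ++ j :: r).
  by rewrite -cat1s -[j :: r]cat1s perm_catCA.
apply: IH; last exact: dom_perm Cf.
by rewrite -(perm_uniq p)/= jlr.
Qed.

Lemma dom_iint_line j l C f x : uniq (j :: l) -> dom (j :: l) C f ->
  dom1 (C * kappa ^+ size l) (fun s => iint l f (upd x j s)).
Proof.
move=> ul Cf; have p : perm_eq (j :: l) (l ++ [:: j]) by rewrite -cat1s perm_catC.
have := dom_line x (isT : j \notin [::]) (dom_iint _ (dom_perm p Cf)).
by rewrite /weight big_nil mulr1; apply; rewrite -(perm_uniq p).
Qed.

Lemma iint_cvg l C (F : nat -> V -> R) f x : uniq l ->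
  (forall k, dom l C (F k)) -> dom l C f ->
  (forall y, F k y @[k --> \oo] --> f y) ->
  iint l (F k) x @[k --> \oo] --> iint l f x.
Proof.
elim: l x => [x _ _ _|j l IH x ujl CF Cf Ff]; first exact.
apply: int1_cvg.
- by move=> k; exact: (dom_iint_line x ujl (CF k)).
- by have [] := dom_iint_line x ujl Cf.
- move=> s; apply: IH => //.
  + by case/andP: ujl.
  + by move=> k; apply: (@dom_catr [:: j]).
  + by apply: (@dom_catr [:: j]).
Qed.

Lemma iintD l C D f g x : uniq l -> dom l C f -> dom l D g ->
  iint l (fun y => f y + g y) x = iint l f x + iint l g x.
Proof.
elim: l x => // j l IH x ujl Cf Dg /=.
rewrite -(int1D (dom_iint_line x ujl Cf) (dom_iint_line x ujl Dg)).
congr int1; apply/funext => s; apply: IH; first by case/andP: ujl.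
- exact: (@dom_catr [:: j]).
- exact: (@dom_catr [:: j]).
Qed.

Lemma iintZ l C a f x : uniq l -> dom l C f ->
  iint l (fun y => a * f y) x = a * iint l f x.
Proof.
elim: l x => // j l IH x ujl Cf /=.
rewrite -(int1Z _ (dom_iint_line x ujl Cf)).
congr int1; apply/funext => s; apply: IH; first by case/andP: ujl.
exact: (@dom_catr [:: j]).
Qed.

Lemma le_iint l C D f g x : uniq l -> dom l C f -> dom l D g ->
  (forall y, f y <= g y) -> iint l f x <= iint l g x.
Proof.
elim: l x => // j l IH x ujl Cf Dg fg /=.
apply: (le_int1 (dom_iint_line x ujl Cf) (dom_iint_line x ujl Dg)) => s.
apply: IH => //; first by case/andP: ujl.
- exact: (@dom_catr [:: j]).
- exact: (@dom_catr [:: j]).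
Qed.

(** Phrased on coordinate lines, so that it still makes sense when some of the other variables have
    been integrated out. *)
Definition pd (j : 'I_n) f g := forall x s,
  is_derive s (1 : R) (fun t => f (upd x j t)) (g (upd x j s)).

Lemma pd_iint l C D j f g : j \notin l -> uniq l -> dom l C f -> dom l D g ->
  pd j f g -> pd j (iint l f) (iint l g).
Proof.
elim: l => // k l IH; rewrite inE negb_or => /andP[jk jl] ukl Cf Dg fg x s.
have ul : uniq l by case/andP: ukl.
have {}IH := IH jl ul (@dom_catr [:: k] _ _ _ Cf) (@dom_catr [:: k] _ _ _ Dg) fg.
have DC a b (h : V -> R) t y : dom (k :: l) a h -> a <= b ->
    dom1 (b * kappa ^+ size l) (fun s => iint l h (upd (upd y j t) k s)).
  move=> ah ab; have [c H] := dom_iint_line (upd y j t) ukl ah; split=> // u.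
  apply: le_trans (H u) _; rewrite ler_wpM2r ?cauchy_weight_ge0//.
  by rewrite ler_wpM2r// exprn_ge0// kappa_ge0.
apply: (@int1_derive_under _
  (fun t s => iint l f (upd (upd x j t) k s))
  (fun t s => iint l g (upd (upd x j t) k s)) (Num.max C D * kappa ^+ size l)).
- by move=> t _; apply: DC Cf _; rewrite le_max lexx.
- by move=> t _; apply: DC Dg _; rewrite le_max lexx orbT.
- move=> t u _; rewrite updC//.
  by under eq_fun do rewrite updC//; exact: IH.
Qed.

(** If [j] is not the outermost variable, the inner integral vanishes by induction. If it is, the
    derivative moves out of the inner integrals by [pd_iint], and [int1_derive] concludes on the
    line. *)
Lemma iint_pd l C D j f g x : j \in l -> uniq l -> dom l C f -> dom l D g ->
  pd j f g -> iint l g x = 0.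
Proof.
elim: l x => // k l IH x; rewrite inE => jkl ukl Cf Dg fg.
have [kl ul] := andP ukl.
have [jk|jk] := eqVneq j k; last first.
  rewrite (negbTE jk) /= in jkl; rewrite /= (_ : (fun s => _) = (fun=> 0 * 0)).
    by rewrite (int1Z 0 (C := 1) (f := fun=> 0)) ?mul0r//; split=> [s|s];
      [exact: cvg_cst|rewrite normr0 mulr_ge0// cauchy_weight_ge0].
  by apply/funext => s; rewrite mulr0 IH//; exact: (@dom_catr [:: k]).
subst k.
have H := pd_iint kl ul (@dom_catr [:: j] _ _ _ Cf) (@dom_catr [:: j] _ _ _ Dg) fg.
have le_dom a b (h : V -> R) : dom (j :: l) a h -> a <= b ->
    dom1 (b * kappa ^+ size l) (fun s => iint l h (upd x j s)).
  move=> ah ab; have [c Hh] := dom_iint_line x ukl ah; split=> // u.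
  apply: le_trans (Hh u) _; rewrite ler_wpM2r ?cauchy_weight_ge0//.
  by rewrite ler_wpM2r// exprn_ge0// kappa_ge0.
apply: (@int1_derive _ (Num.max C D * kappa ^+ size l) (fun s => iint l f (upd x j s))).
- by move=> s; exact: H.
- by apply: le_dom Dg _; rewrite le_max lexx orbT.
- by have [] : dom1 (Num.max C D * kappa ^+ size l) (fun s => iint l f (upd x j s))
    by apply: le_dom Cf _; rewrite le_max lexx.
Qed.

Lemma iint_eq0 l C f x : uniq l -> dom l C f -> (forall y, 0 <= f y) ->
  iint l f x = 0 -> forall y, (forall j, j \notin l -> y j 0 = x j 0) -> f y = 0.
Proof.
elim: l x => [x _ _ _ fx y yx|j l IH x ujl Cf f0 If y yx].
  by rewrite (_ : y = x)//; apply/colP => j; exact: yx.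
have [jl ul] := andP ujl.
have Cf' := @dom_catr [:: j] _ _ _ Cf.
apply: (IH (upd x j (y j 0))) => //.
- apply: (int1_eq0 (dom_iint_line x ujl Cf)) => // s.
  have D0 : dom l 0 (fun=> 0 : R).
    by split=> [z|z]; [exact: continuous_cst|rewrite normr0 mul0r].
  have := le_iint (upd x j s) ul D0 Cf' f0.
  by have := iintZ 0 (upd x j s) ul D0; under [X in iint _ X _]eq_fun do rewrite mul0r; rewrite mul0r => ->.
- move=> i il; rewrite updE; case: eqP => [->//|/eqP ij].
  by apply: yx; rewrite inE negb_or ij.
Qed.

Lemma dom_le l C D f : C <= D -> dom l C f -> dom l D f.
Proof.
move=> CD [cf fC]; split=> // x; apply: le_trans (fC x) _.
by apply: ler_wpM2r CD; exact/ltW/weight_gt0.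
Qed.

(** Applies [le_int1_derive] once per coordinate, ending with the derivative that is mixed in all of
    them. [S] is any class of dominated functions stable under [d]; it will be the real or the
    imaginary parts of Schwartz functions. *)
Lemma le_iint_pd (S : (V -> R) -> Prop) (d : 'I_n -> (V -> R) -> V -> R) :
  (forall f, S f -> exists C, dom (enum 'I_n) C f) ->
  (forall j f, S f -> S (d j f) /\ pd j f (d j f)) ->
  forall l f x, uniq l -> S f ->
  `|f x| <= iint l (fun y => `|foldl (fun g j => d j g) f l y|) x.
Proof.
move=> domS dS; elim=> [//|j l IH] f x ujl Sf.
have [jl ul] := andP ujl.
have [Sdf df] := dS j f Sf.
have [C Cf] := domS _ Sf; have [D Ddf] := domS _ Sdf.
have D1 g : dom (enum 'I_n) (Num.max C D) g ->
    dom1 (Num.max C D) (fun s => g (upd x j s)).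
  move/(@dom_enum [:: j] _ _ isT); move/(dom_line x (isT : j \notin [::])).
  by rewrite /weight big_nil mulr1.
have Cf1 := D1 _ (dom_le (_ : C <= Num.max C D) Cf).
have Df1 := D1 _ (dom_le (_ : D <= Num.max C D) Ddf).
rewrite le_max lexx in Cf1; rewrite le_max lexx orbT in Df1.
rewrite -{1}(upd_id x j).
have := le_int1_derive (df x) (Df1 isT) (Cf1 isT).2 (x j 0).
move=> /le_trans; apply.
have [E HE] : exists E, dom (enum 'I_n) E (foldl (fun g j => d j g) (d j f) l).
  apply: domS; elim: l {IH jl ul ujl} (d j f) Sdf => //= k l IH g Sg.
  by apply: IH; case: (dS k g Sg).
apply: (le_int1 (dom1_norm (Df1 isT)) (dom_iint_line x ujl (dom_enum ujl (dom_norm HE)))).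
by move=> s; exact: IH.
Qed.

Definition intV f : R := iint (enum 'I_n) f 0.

Definition domV C f := dom (enum 'I_n) C f.

Lemma intVD C D f g : domV C f -> domV D g ->
  intV (fun y => f y + g y) = intV f + intV g.
Proof. exact: iintD (enum_uniq _). Qed.

Lemma intVZ C a f : domV C f -> intV (fun y => a * f y) = a * intV f.
Proof. exact: iintZ (enum_uniq _). Qed.

Lemma le_intV C D f g : domV C f -> domV D g -> (forall y, f y <= g y) ->
  intV f <= intV g.
Proof. exact: le_iint (enum_uniq _). Qed.

Lemma intV_cvg C (F : nat -> V -> R) f :
  (forall k, domV C (F k)) -> domV C f ->
  (forall y, F k y @[k --> \oo] --> f y) ->
  intV (F k) @[k --> \oo] --> intV f.
Proof. exact: iint_cvg (enum_uniq _). Qed.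

Lemma intV_pd C D j f g : domV C f -> domV D g -> pd j f g -> intV g = 0.
Proof. by apply: iint_pd (enum_uniq _); rewrite mem_enum. Qed.

Lemma intV_eq0 C f : domV C f -> (forall y, 0 <= f y) -> intV f = 0 ->
  forall y, f y = 0.
Proof.
move=> Cf f0 If y; apply: (iint_eq0 (enum_uniq _) Cf f0 If) => j.
by rewrite mem_enum.
Qed.

Lemma domV_weight : domV 1 (weight (enum 'I_n)).
Proof.
split=> [|x]; last by rewrite mul1r ger0_norm// ltW// weight_gt0.
rewrite /weight; elim: (enum 'I_n) => [|j l IH].
  by under eq_fun do rewrite big_nil; exact: continuous_cst.
under eq_fun do rewrite big_cons; apply: continuous_mul => // x.
exact: (@continuous_comp V R R (fun x => x j 0) w x
  (@coord_continuous _ _ _ j 0 x) (@continuous_cauchy_weight R _)).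
Qed.

Lemma le_intV_weight C f : domV C f -> intV f <= C * intV (weight (enum 'I_n)).
Proof.
move=> Cf; rewrite -(intVZ C domV_weight).
apply: (le_intV Cf (domZ C domV_weight)) => y.
by apply: le_trans (ler_norm _) _; case: Cf.
Qed.

End IteratedIntegral.

(** * Hardy's theorem on the line *)

Section Annulus.
Variable R : realType.
Implicit Types (u : nat -> R) (x z t : R).

Lemma series_exp_le x N : 0 <= x -> \sum_(0 <= k < N) x ^+ k / k`!%:R <= expR x.
Proof.
move=> x0; rewrite /expR; apply: (@nondecreasing_cvgn_le _ (series (exp_coeff x))).
  apply: nondecreasing_series => k _ _; exact: exp_coeff_ge0.
exact: is_cvg_series_exp_coeff.
Qed.

Lemma series_tail_le u (l : R) z t N : (forall k, `|u k| <= `|z| ^+ k / k`!%:R) ->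
  series u @ \oo --> l -> 1 <= t ->
  `|l - series u N| <= t ^- N * expR (t * `|z|).
Proof.
move=> uz ul t1; have t0 : 0 < t by exact: lt_le_trans t1.
have H : `|series u M - series u N| @[M --> \oo] --> `|l - series u N|.
  by apply: cvg_norm; apply: cvgB => //; exact: cvg_cst.
rewrite -(cvg_lim _ H)//; apply: limr_le; first by apply/cvg_ex; eexists; exact: H.
near=> M.
have NM : (N <= M)%N by near: M; exact: nbhs_infty_ge.
rewrite sub_series_geq//; apply: le_trans (ler_norm_sum _ _ _) _.
have tz : 0 <= t * `|z| by rewrite mulr_ge0// ltW.
apply: (@le_trans _ _ (t ^- N * \sum_(0 <= k < M) (t * `|z|) ^+ k / k`!%:R)); last first.
  by rewrite ler_wpM2l ?invr_ge0 ?exprn_ge0 ?(ltW t0)// series_exp_le.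
rewrite mulr_sumr [leRHS](@big_cat_nat _ _ _ N)//=.
rewrite ler_wpDl//.
  by apply: sumr_ge0 => k _; rewrite mulr_ge0 ?invr_ge0 ?exprn_ge0 ?(ltW t0)// divr_ge0 ?exprn_ge0.
rewrite big_nat_cond [leRHS]big_nat_cond; apply: ler_sum => k /andP[/andP[Nk _] _].
apply: le_trans (uz k) _; rewrite exprMn mulrA mulrA ler_wpM2r ?invr_ge0//.
rewrite ler_peMl ?exprn_ge0// -(subnKC Nk) exprD mulKf ?gt_eqF ?exprn_gt0//.
exact: exprn_ege1.
Unshelve. all: end_near. Qed.

Lemma powM_exp_le (m : nat) (r : R) : 0 < r ->
  exists C, forall z, `|z| ^+ m <= C * expR (r * `|z|).
Proof.
move=> r0; exists (m`!%:R / r ^+ m) => z.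
have := @series_exp_le (r * `|z|) m.+1; rewrite mulr_ge0 ?(ltW r0)// => /(_ isT).
rewrite big_nat_recr//= => H.
have H2 : (r * `|z|) ^+ m / m`!%:R <= expR (r * `|z|).
  apply: le_trans H; rewrite lerDr; apply: sumr_ge0 => k _.
  by rewrite divr_ge0// exprn_ge0// mulr_ge0// ltW.
rewrite mulrAC ler_pdivlMr ?exprn_gt0// -exprMn mulrC -ler_pdivrMl ?ltr0n ?fact_gt0//.
by rewrite [leLHS]mulrC.
Qed.

(* [Z] stands for the functions of the frequency that are annihilated by a
   continuous functional; the hypotheses say that the generalised Laurent series
   given by the functional vanishes on a real interval, and the conclusion that
   it vanishes on the whole universal cover of the annulus. *)
Section Continuation.
Variables (Z : (R -> R) -> Prop) (r : R).
Hypothesis r_gt0 : 0 < r.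
Hypothesis Z_lin : forall a phi psi, Z phi -> Z psi -> Z (fun z => a * phi z + psi z).
Hypothesis Z_closed : forall phi, (forall e, 0 < e ->
  exists2 psi, Z psi & forall z, `|phi z - psi z| <= e * expR (r * `|z|)) -> Z phi.
Hypothesis Z_exp : forall x, `|x| <= r -> Z (fun z => expR (z * x)).

Let Z0 : Z (fun=> 0).
Proof.
have := Z_lin (-1) (Z_exp (_ : `|0| <= r)) (Z_exp (_ : `|0| <= r)).
rewrite normr0 (ltW r_gt0) => /(_ isT isT).
by under eq_fun do rewrite mulN1r addNr.
Qed.

Let Z_sum (c : nat -> R) (phi : nat -> R -> R) N : (forall k, (k < N)%N -> Z (phi k)) ->
  Z (fun z => \sum_(0 <= k < N) c k * phi k z).
Proof.
elim: N => [_|N IH H]; first by under eq_fun do rewrite big_nil.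
under eq_fun do rewrite big_nat_recr//= addrC.
by apply: Z_lin; [exact: H|apply: IH => k /ltnW; exact: H].
Qed.

(** A derivative at 0 of the family of exponentials: [z ^+ m] is the limit, as [x] tends to 0, of
    [m! / x ^+ m] times [expR (z * x)] minus its Taylor polynomial of degree below [m], which lies
    in [Z] by induction. *)
Let Z_monomial m : Z (fun z => z ^+ m).
Proof.
elim/ltn_ind: m => m IH; apply: Z_closed => e e0.
pose C := m`!%:R / r ^+ m.+1.
have C0 : 0 < C by rewrite divr_gt0 ?exprn_gt0// ltr0n fact_gt0.
(* The tail estimate at [t = r / x] leaves the error [C * x * expR (r |z|)]: [x <= e / C] makes it
   small enough, and [x <= r] gives [t >= 1]. *)
pose x := Num.min (r) (e / C).
have x0 : 0 < x by rewrite lt_min r_gt0 divr_gt0.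
have xr : x <= r by rewrite ge_min lexx.
have xn0 : x != 0 by rewrite gt_eqF.
exists (fun z => (m`!%:R / x ^+ m) * expR (z * x) +
   (- (m`!%:R / x ^+ m)) * \sum_(0 <= k < m) (x ^+ k / k`!%:R) * z ^+ k + 0).
  under eq_fun do rewrite -addrA.
  apply: Z_lin; first by apply: Z_exp; rewrite ger0_norm// ltW.
  by apply: Z_lin => //; exact: Z_sum.
move=> z; have := @series_tail_le (exp_coeff (z * x)) (expR (z * x)) (z * x) (r / x) m.+1.
have -> : r / x * `|z * x| = r * `|z|.
  by rewrite normrM (ger0_norm (ltW x0)); field.
move=> /(_ _ _ _)/le_trans H.
have {H} : `|expR (z * x) - series (exp_coeff (z * x)) m.+1| <= (r / x) ^- m.+1 * expR (r * `|z|).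
  apply: H => //.
  - by move=> k; rewrite /exp_coeff/= normrM normrX normfV (ger0_norm (ler0n _ _)).
  - exact: is_cvg_series_exp_coeff.
  - by rewrite ler_pdivlMr// mul1r.
rewrite seriesSr /series/= => H.
have -> : z ^+ m - (m`!%:R / x ^+ m * expR (z * x) +
   - (m`!%:R / x ^+ m) * (\sum_(0 <= k < m) x ^+ k / k`!%:R * z ^+ k) + 0) =
   - (m`!%:R / x ^+ m) * (expR (z * x) - (\sum_(0 <= k < m) exp_coeff (z * x) k + exp_coeff (z * x) m)).
  rewrite (_ : \sum_(0 <= k < m) x ^+ k / k`!%:R * z ^+ k =
               \sum_(0 <= k < m) exp_coeff (z * x) k); last first.
    by apply: eq_bigr => k _; rewrite /exp_coeff/= exprMn; ring.
  rewrite [exp_coeff _ m]/exp_coeff/= exprMn.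
  move: (\sum_(0 <= k < m) _) => S; field.
  by rewrite expf_neq0// pnatr_eq0 -lt0n fact_gt0.
have q0 : 0 <= m`!%:R / x ^+ m by rewrite divr_ge0// exprn_ge0// ltW.
rewrite normrM normrN (ger0_norm q0).
apply: le_trans (ler_wpM2l q0 H) _.
rewrite mulrA ler_wpM2r ?expR_ge0//.
have -> : m`!%:R / x ^+ m * (r / x) ^- m.+1 = C * x.
  rewrite /C expr_div_n invf_div (exprS x); field.
  by rewrite !expf_neq0// gt_eqF.
by rewrite mulrC -ler_pdivlMr// ge_min lexx orbT.
Qed.

(** Moving the angle by [h] means a Taylor expansion in [h], which brings in all powers of [z] times
    the cosine and the sine; the induction has to carry all of them. *)
Let P (a : R) := forall m, Z (fun z => z ^+ m * cos (z * a)) /\ Z (fun z => z ^+ m * sin (z * a)).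

(** The addition formulas, with [cos (z * h)] and [sin (z * h)] replaced by partial sums of their
    series. The tail estimate with [t = 2] and [h <= r / 4] costs the growth [expR (r / 2 * |z|)];
    the other half of the allowed growth absorbs [z ^+ m]. The step length does not depend on [a],
    so finitely many steps reach any angle. *)
Let P_step a h : 0 <= h <= r / 4 -> P a -> P (a + h).
Proof.
move=> /andP[h0 hr] Pa.
have key (m : nat) (c s : nat -> R) (A B : R -> R) :
    (forall k, `|c k| <= (k`!%:R)^-1) -> (forall k, `|s k| <= (k`!%:R)^-1) ->
    (forall z, series (fun k => c k * (z * h) ^+ k) @ \oo --> A z) ->
    (forall z, series (fun k => s k * (z * h) ^+ k) @ \oo --> B z) ->
    Z (fun z => z ^+ m * (cos (z * a) * A z + sin (z * a) * B z)).
  move=> c1 s1 cA sB; apply: Z_closed => e e0.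
  have r2 : 0 < r / 2 by rewrite divr_gt0.
  have [C HC] := powM_exp_le m r2.
  have C0 : 0 <= C.
    have := HC 0; rewrite normr0 mulr0 expR0 mulr1; apply: le_trans.
    exact: exprn_ge0.
  have [N HN] : exists N, C * (2 * 2 ^- N) <= e.
    have : (2^-1 : R) ^+ k @[k --> \oo] --> (0 : R) by apply: cvg_expr; rewrite ger0_norm; lra.
    have d0 : 0 < e / ((C + 1) * 2) by rewrite divr_gt0//; lra.
    move=> /cvgr0Pnorm_le/(_ _ d0)[N _ /(_ N)] /= /(_ (leqnn _)).
    rewrite ger0_norm ?exprn_ge0// ler_pdivlMr; last by lra.
    rewrite exprVn => H; exists N; have : 0 <= 2 ^- N :> R by rewrite invr_ge0 exprn_ge0.
    by move: (2 ^- N) H => y; nra.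
  exists (fun z => \sum_(0 <= k < N) (c k * h ^+ k) * (z ^+ (m + k) * cos (z * a)) +
                1 * \sum_(0 <= k < N) (s k * h ^+ k) * (z ^+ (m + k) * sin (z * a))).
    under eq_fun do rewrite addrC.
    apply: Z_lin.
    - by apply: (@Z_sum (fun k => s k * h ^+ k)) => k _; case: (Pa (m + k)%N).
    - by apply: (@Z_sum (fun k => c k * h ^+ k)) => k _; case: (Pa (m + k)%N).
  move=> z.
  have tail (d : nat -> R) (l : R) : (forall k, `|d k| <= (k`!%:R)^-1) ->
      series (fun k => d k * (z * h) ^+ k) @ \oo --> l ->
      `|l - series (fun k => d k * (z * h) ^+ k) N| <= 2 ^- N * expR (r / 2 * `|z|).
    move=> d1 dl; have := @series_tail_le _ l (z * h) 2 N _ dl.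
    move=> /(_ _ _)/le_trans; apply.
    - by move=> k; rewrite normrM normrX mulrC ler_wpM2l// exprn_ge0.
    - by lra.
    - rewrite ler_wpM2l ?invr_ge0 ?exprn_ge0// ler_expR normrM (ger0_norm h0).
      by have := normr_ge0 z; nra.
  have tA := tail c (A z) c1 (cA z); have tB := tail s (B z) s1 (sB z).
  have -> : z ^+ m * (cos (z * a) * A z + sin (z * a) * B z) -
     (\sum_(0 <= k < N) c k * h ^+ k * (z ^+ (m + k) * cos (z * a)) +
      1 * \sum_(0 <= k < N) s k * h ^+ k * (z ^+ (m + k) * sin (z * a))) =
     z ^+ m * (cos (z * a) * (A z - series (fun k => c k * (z * h) ^+ k) N) +
               sin (z * a) * (B z - series (fun k => s k * (z * h) ^+ k) N)).
    have E (d : nat -> R) y : \sum_(0 <= k < N) d k * h ^+ k * (z ^+ (m + k) * y) =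
        z ^+ m * y * series (fun k => d k * (z * h) ^+ k) N.
      by rewrite /series/= mulr_sumr; apply: eq_bigr => k _; rewrite exprD exprMn; ring.
    by rewrite !E; ring.
  rewrite normrM normrX.
  have le1 : `|cos (z * a) * (A z - series (fun k => c k * (z * h) ^+ k) N) +
               sin (z * a) * (B z - series (fun k => s k * (z * h) ^+ k) N)|
             <= 2 * 2 ^- N * expR (r / 2 * `|z|).
    apply: le_trans (ler_normD _ _) _; rewrite !normrM.
    have hc : `|cos (z * a)| <= 1 by rewrite ler_norml cos_geN1 cos_le1.
    have hs : `|sin (z * a)| <= 1 by rewrite ler_norml sin_geN1 sin_le1.
    apply: (@le_trans _ _ (2 ^- N * expR (r / 2 * `|z|) + 2 ^- N * expR (r / 2 * `|z|))).
      by apply: lerD; [apply: le_trans tA|apply: le_trans tB]; rewrite ler_piMl.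
    by lra.
  apply: le_trans (ler_pM _ _ (HC z) le1) _; rewrite ?exprn_ge0//.
  have -> : r * `|z| = r / 2 * `|z| + r / 2 * `|z| by field.
  rewrite expRD mulrACA ler_wpM2r ?mulr_ge0 ?expR_ge0//.
have ck1 k : `|(~~ odd k)%:R * (-1) ^+ k./2 * (k`!%:R)^-1 : R| <= (k`!%:R)^-1.
  by rewrite !normrM normrX normrN1 expr1n mulr1 normfV !ger0_norm// ler_piMl// lern1 leq_b1.
have sk1 k : `|(odd k)%:R * (-1) ^+ k.-1./2 * (k`!%:R)^-1 : R| <= (k`!%:R)^-1.
  by rewrite !normrM normrX normrN1 expr1n mulr1 normfV !ger0_norm// ler_piMl// lern1 leq_b1.
have cosS z : series (fun k => (~~ odd k)%:R * (-1) ^+ k./2 * (k`!%:R)^-1 * (z * h) ^+ k) @ \oo --> cos (z * h).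
  by rewrite unlock -cos_coeffE; exact: is_cvg_series_cos_coeff.
have sinS z : series (fun k => (odd k)%:R * (-1) ^+ k.-1./2 * (k`!%:R)^-1 * (z * h) ^+ k) @ \oo --> sin (z * h).
  by rewrite unlock -sin_coeffE; exact: is_cvg_series_sin_coeff.
move=> m; split.
- rewrite (_ : (fun z => _) = (fun z => z ^+ m *
      (cos (z * a) * cos (z * h) + sin (z * a) * - sin (z * h)))); last first.
    by apply/funext => z; rewrite mulrDr cosD mulrN.
  apply: (key m _ (fun k => - ((odd k)%:R * (-1) ^+ k.-1./2 * (k`!%:R)^-1))
    (fun z => cos (z * h)) (fun z => - sin (z * h)) ck1 _ cosS).
    by move=> k; rewrite normrN.
  move=> z; rewrite (_ : series _ = - series (fun k =>
      (odd k)%:R * (-1) ^+ k.-1./2 * (k`!%:R)^-1 * (z * h) ^+ k)).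
    by apply: cvgN; exact: sinS.
  by apply/funext => N; rewrite /series/= fctE -sumrN; apply: eq_bigr => k _; rewrite mulNr.
- rewrite (_ : (fun z => _) = (fun z => z ^+ m *
      (cos (z * a) * sin (z * h) + sin (z * a) * cos (z * h)))); last first.
    by apply/funext => z; rewrite mulrDr sinD addrC.
  exact: (key m _ _ (fun z => sin (z * h)) (fun z => cos (z * h)) sk1 ck1 sinS cosS).
Qed.

Lemma annulus_continuation a : 0 <= a -> Z (fun z => sin (z * a)).
Proof.
move=> a0; suff : P a by move=> /(_ 0%N)[_]; under eq_fun do rewrite mul1r.
pose N := (Num.truncn (4 * a / r)).+1.
have N0 : 0 < N%:R :> R by rewrite ltr0n.
have hN : 0 <= a / N%:R <= r / 4.
  rewrite divr_ge0//= ler_pdivrMr//.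
  have : 4 * a / r < N%:R by exact: truncnS_gt.
  by rewrite ltr_pdivrMr//; lra.
suff H k : P (k%:R * (a / N%:R)).
  by have := H N; rewrite mulrC divfK// gt_eqF.
elim: k => [|k IH].
  rewrite mul0r => m; split.
    by under eq_fun do rewrite mulr0 cos0 mulr1.
  by under eq_fun do rewrite mulr0 sin0 mulr0.
rewrite -natr1 mulrDl mul1r; exact: P_step.
Qed.

End Continuation.
End Annulus.

(** * Gaussian moments as powers of the frequency *)

Section GaussianMoments.
Variable R : realType.
Local Notation w := (@cauchy_weight R).
Implicit Types (y s : R) (k : nat).

Lemma gauss_le_weight k (c : R) : 0 < c ->
  exists C, forall s, s ^+ k.*2 * expR (- (c * s ^+ 2)) <= C * w s.
Proof.
move=> c0; have [C HC] := powM_exp_le k c0; have [D HD] := powM_exp_le k.+1 c0.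
exists (C + D) => s; rewrite ler_pdivlMr ?ltr_wpDr ?sqr_ge0// mulrAC expRN.
rewrite ler_pdivrMr ?expR_gt0//.
have := HC (s ^+ 2); have := HD (s ^+ 2).
rewrite ger0_norm ?sqr_ge0// -!exprM !mul2n doubleS exprSr exprSr => hD hC.
by rewrite mulrDr mulr1 [X in _ + _ * X]expr2 mulrA mulrDl; exact: lerD.
Qed.

(** The frequency is written [expR y]: its powers are then exponentials in [y], the functions that
    the annulus argument starts from. *)
Definition gaussm k y s : R := s ^+ k.*2 * expR (- (expR y * s ^+ 2)).

Lemma gaussm_ge0 k y s : 0 <= gaussm k y s.
Proof. by rewrite mulr_ge0 ?expR_ge0// -mul2n exprM exprn_ge0// sqr_ge0. Qed.

Lemma continuous_gaussm k y : continuous (gaussm k y).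
Proof.
move=> s; apply: cvgM; first exact: exprn_continuous.
apply: continuous_comp; last exact: continuous_expR.
apply: cvgN; apply: cvgM; first exact: cvg_cst.
exact: exprn_continuous.
Qed.

Lemma gaussm_dom k y0 : exists C, forall y, y0 <= y -> dom1 C (gaussm k y).
Proof.
have [C HC] := gauss_le_weight k (expR_gt0 y0).
exists C => y yy0; split; first exact: continuous_gaussm.
move=> s; rewrite ger0_norm ?gaussm_ge0//; apply: le_trans (HC s).
rewrite ler_wpM2l//; first by rewrite -mul2n exprM exprn_ge0// sqr_ge0.
by rewrite ler_expR lerN2 ler_wpM2r ?sqr_ge0// ler_expR.
Qed.

Definition gmoment k y : R := int1 (gaussm k y).

Lemma gaussm_derive k y s : is_derive y (1 : R) (fun r => gaussm k r s)
  (- (expR y * gaussm k.+1 y s)).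
Proof.
rewrite /gaussm; apply: is_derive_eq.
by rewrite doubleS !exprS /GRing.scale/=; ring.
Qed.

Lemma is_derive_exprn (n : nat) s :
  is_derive s (1 : R) (fun x => x ^+ n.+1) (n.+1%:R * s ^+ n).
Proof.
have /= H := @is_deriveX R R id n.+1 s 1 1 (is_derive_id s 1).
rewrite -[X in is_derive _ _ _ X](mulr1 (n.+1%:R * s ^+ n)).
rewrite (_ : (fun x => _) = id ^+ n.+1); first exact: H.
by apply/funext => x; rewrite exprfctE.
Qed.

Lemma gmoment_parts k y : (k.*2.+1)%:R * gmoment k y = 2 * expR y * gmoment k.+1 y.
Proof.
have [C HC] := gaussm_dom k y; have [D HD] := gaussm_dom k.+1 y.
have {}HC := HC _ (lexx y); have {}HD := HD _ (lexx y).
have C0 := dom1_ge0 HC; have D0 := dom1_ge0 HD.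
have d1 := dom1Z (k.*2.+1)%:R HC; have d2 := dom1Z (2 * expR y) HD.
have dB := dom1B d1 d2.
(* One constant for the function and its derivative, as [int1_derive] asks. *)
pose E := Num.max (C + D) (`|(k.*2.+1)%:R| * C + `|2 * expR y| * D).
have dE : dom1 E (fun s => k.*2.+1%:R * gaussm k y s - 2 * expR y * gaussm k.+1 y s).
  case: dB => c b; split=> // s; apply: le_trans (b s) _.
  by rewrite ler_wpM2r ?cauchy_weight_ge0// /E le_max lexx orbT.
apply/eqP; rewrite -subr_eq0 -(int1Z _ HC) -(int1Z _ HD) -(int1B d1 d2); apply/eqP.
apply: (@int1_derive _ E (fun s => s ^+ k.*2.+1 * expR (- (expR y * s ^+ 2)))) => //.
- move=> s; have e1 := is_derive_exprn k.*2 s; have e2 := is_derive_exprn 1 s.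
  rewrite /gaussm; apply: is_derive_eq.
  by rewrite /GRing.scale/= !doubleS/= !exprS; ring.
(* The primitive is [s] times the [k]-th integrand; [|s| <= 1 + s ^+ 2] bounds it by the [k]-th and
   the next one. *)
- move=> s; rewrite exprS -mulrA -/(gaussm k y s).
  apply: (@le_trans _ _ ((C + D) * w s)); last first.
    by rewrite ler_wpM2r ?cauchy_weight_ge0// /E le_max lexx.
  rewrite normrM (ger0_norm (gaussm_ge0 _ _ _)) mulrDl.
  have h1 := (HC.2 s); have h2 := HD.2 s.
  rewrite !ger0_norm ?gaussm_ge0// in h1 h2.
  apply: le_trans (lerD h1 h2).
  have -> : gaussm k.+1 y s = s ^+ 2 * gaussm k y s.
    by rewrite /gaussm doubleS !exprS; ring.
  have g0 := gaussm_ge0 k y s; rewrite -(@real_normK _ s) ?num_real//.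
  have := mulr_ge0 g0 (sqr_ge0 (`|s| - 1)); have := mulr_ge0 g0 (normr_ge0 s).
  by move: (gaussm k y s) g0 `|s| => g g0 a; nra.
Qed.

Lemma gmoment_derive k y :
  is_derive y (1 : R) (gmoment k) (- (k%:R + 2^-1) * gmoment k y).
Proof.
have -> : - (k%:R + 2^-1) * gmoment k y = int1 (fun s => - (expR y * gaussm k.+1 y s)).
  have [D HD] := gaussm_dom k.+1 y.
  under eq_fun do rewrite -mulNr.
  rewrite (int1Z _ (HD _ (lexx y))) -/(gmoment _ _).
  have := gmoment_parts k y; rewrite -addn1 natrD -mul2n natrM => H.
  have -> : - (k%:R + 2^-1) * gmoment k y = - ((2 * k%:R + 1) * gmoment k y) / 2 by field.
  by rewrite H; field.
have [C HC] := gaussm_dom k (y - 1); have [D HD] := gaussm_dom k.+1 (y - 1).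
have C0 := dom1_ge0 (HC _ (lexx _)); have D0 := dom1_ge0 (HD _ (lexx _)).
have yr r : `|r - y| <= 1 -> y - 1 <= r /\ r <= y + 1 by rewrite ler_norml; lra.
apply: (@int1_derive_under _ (gaussm k) (fun y s => - (expR y * gaussm k.+1 y s))
   (Num.max C (expR (y + 1) * D))).
- move=> r /yr[ry _]; have [c h] := HC r ry; split=> // s.
  by apply: le_trans (h s) _; rewrite ler_wpM2r ?cauchy_weight_ge0// le_max lexx.
- move=> r /yr[ry ry2]; have [c h] := HD r ry; split=> [s|s].
    by apply: cvgN; apply: cvgM; [exact: cvg_cst|exact: c].
  rewrite normrN normrM ger0_norm ?expR_ge0//.
  apply: (@le_trans _ _ (expR (y + 1) * D * w s)).
    by rewrite -mulrA ler_pM ?expR_ge0// ler_expR.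
  by rewrite ler_wpM2r ?cauchy_weight_ge0// le_max lexx orbT.
- by move=> r s _; exact: gaussm_derive.
Qed.

(** Homogeneity of degree [- (k + 1/2)] in the frequency, read off the differential equation
    [gmoment_derive] instead of a change of variables. *)
Lemma gmomentE k y : gmoment k y = gmoment k 0 * expR (- (k%:R + 2^-1) * y).
Proof.
pose h y := gmoment k y * expR ((k%:R + 2^-1) * y).
have dh x : is_derive x (1 : R) h 0.
  have d1 := gmoment_derive k x.
  by apply: is_derive_eq; rewrite /GRing.scale/=; ring.
have <- : h 0 = gmoment k 0.
  by rewrite /h (mulr0 (k%:R + 2^-1)) expR0 (mulr1 (gmoment k 0)).
rewrite -(is_derive_0_is_cst y 0 dh) /h mulNr expRN mulfK//.
by rewrite gt_eqF ?expR_gt0.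
Qed.

Lemma gmoment_ge0 k y : 0 <= gmoment k y.
Proof. by apply: Rintegral_ge0 => s _; exact: gaussm_ge0. Qed.

Lemma gmoment0_gt0 y : 0 < gmoment 0 y.
Proof.
rewrite lt_def gmoment_ge0 andbT; apply/eqP => h.
have [C HC] := gaussm_dom 0 y.
have := int1_eq0 (HC _ (lexx y)) (gaussm_ge0 0 y) h 0.
by rewrite /gaussm expr0 mul1r; apply/eqP; rewrite gt_eqF ?expR_gt0.
Qed.

End GaussianMoments.

(** * The vanishing theorem in one variable *)

Section HardyOnTheLine.
Variable R : realType.
Local Notation w := (@cauchy_weight R).
Implicit Types (y s : R) (k N : nat).

Lemma int1_sum (F : nat -> R -> R) N : (forall k, exists C, dom1 C (F k)) ->
  (exists C, dom1 C (fun s => \sum_(0 <= k < N) F k s)) /\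
  int1 (fun s => \sum_(0 <= k < N) F k s) = \sum_(0 <= k < N) int1 (F k).
Proof.
move=> HF; elim: N => [|N [[C HC] IH]].
  rewrite (_ : (fun s => _) = (fun=> 0)); last by apply/funext => s; rewrite big_nil.
  rewrite big_nil; split.
    by exists 0; split=> [s|s]; [exact: cvg_cst|rewrite normr0 mul0r].
  by rewrite /int1 Rintegral_cst ?mul0r.
rewrite (_ : (fun s => _) = (fun s => \sum_(0 <= k < N) F k s + F N s)); last first.
  by apply/funext => s; rewrite big_nat_recr.
have [D HD] := HF N; split; first by exists (C + D); exact: dom1D.
by rewrite (int1D HC HD) IH big_nat_recr.
Qed.

Lemma dom1_of_le C E (f g : R -> R) : continuous f -> 0 <= C -> dom1 E g ->
  (forall s, `|f s| <= C * g s) -> dom1 (C * E) f.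
Proof.
move=> cf C0 [_ gE] fg; split=> // s; apply: le_trans (fg s) _.
rewrite -mulrA ler_wpM2l//; exact: le_trans (ler_norm _) (gE s).
Qed.

Lemma dom1_gauss (c : R) : 0 < c -> exists E, dom1 E (fun s => expR (- (c * s ^+ 2))).
Proof.
move=> c0; have [C HC] := gaussm_dom 0 (ln c); exists C.
have := HC _ (lexx _); rewrite /gaussm lnK ?posrE//.
by under [X in dom1 _ X -> _]eq_fun do rewrite expr0 mul1r.
Qed.

Lemma continuous_gauss (c : R) : continuous (fun s => expR (- (c * s ^+ 2))).
Proof.
move=> s; apply: continuous_comp; last exact: continuous_expR.
by apply: cvgN; apply: cvgM; [exact: cvg_cst|exact: exprn_continuous].
Qed.

Section Hardy.
Variables (f : R -> R) (m : nat -> R) (C a b : R).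
Hypotheses (cf : continuous f) (a_gt0 : 0 < a) (ab : a < b).
Hypothesis f_decay : forall s, `|f s| <= C * expR (- (b * s ^+ 2)).
Hypothesis m_ge0 : forall k, 0 <= m k.
Hypothesis m_growth : forall s N,
  \sum_(0 <= k < N) m k * s ^+ k.*2 <= C * expR (a * s ^+ 2).
Hypothesis fm : forall s,
  \sum_(0 <= k < N) (-1) ^+ k * m k * s ^+ k.*2 @[N --> \oo] --> f s.

Let D y : R := int1 (fun s => f s * expR (- (expR y * s ^+ 2))).

Let b_gt0 : 0 < b. Proof. exact: lt_trans ab. Qed.

Let C_ge0 : 0 <= C.
Proof. by have := m_growth 0 0; rewrite big_nil expr0n mulr0 expR0 mulr1. Qed.

(** The Taylor series of [f] is integrated termwise. As the [m k] are nonnegative, [m_growth] bounds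
    the partial sums for any choice of signs, and the Gaussian of rate [expR y - a] dominates them
    all. The signs [(-1) ^+ k] give the value of [D], the signs 1 the absolute convergence. *)
Let large_frequencies y : ln a < y ->
  \sum_(0 <= k < N) (-1) ^+ k * m k * gmoment k y @[N --> \oo] --> D y /\
  exists M, forall N, \sum_(0 <= k < N) m k * gmoment k y <= M.
Proof.
move=> ay; have c0 : 0 < expR y - a.
  by rewrite subr_gt0 -[a]lnK ?posrE// ltr_expR.
pose F (e : nat -> R) N s := \sum_(0 <= k < N) e k * m k * gaussm k y s.
have domF e : (forall k, `|e k| <= 1) ->
    exists E, forall N, dom1 E (F e N).
  move=> e1; have [E HE] := dom1_gauss c0; exists (C * E) => N.
  have [|[E' [cF _]] _] := @int1_sum (fun k s => e k * m k * gaussm k y s) N.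
    move=> k; have [G HG] := gaussm_dom k y; exists (`|e k * m k| * G).
    exact: dom1Z (HG _ (lexx y)).
  apply: (dom1_of_le cF C_ge0 HE) => s.
  apply: le_trans (ler_norm_sum _ _ _) _.
  apply: (@le_trans _ _ ((\sum_(0 <= k < N) m k * s ^+ k.*2) * expR (- (expR y * s ^+ 2)))).
    rewrite mulr_suml; apply: ler_sum => k _.
    rewrite normrM (ger0_norm (gaussm_ge0 k y s)) normrM (ger0_norm (m_ge0 k)) /gaussm !mulrA.
    rewrite ler_wpM2r ?expR_ge0// -!mulrA ler_piMl// mulr_ge0// -mul2n exprM exprn_ge0//.
    exact: sqr_ge0.
  apply: le_trans (ler_wpM2r _ (m_growth s N)) _; first exact: expR_ge0.
  by rewrite -mulrA -expRD ler_wpM2l// ler_expR; lra.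
have intF e N : int1 (F e N) = \sum_(0 <= k < N) e k * m k * gmoment k y.
  have [|_ ->] := @int1_sum (fun k s => e k * m k * gaussm k y s) N.
    move=> k; have [G HG] := gaussm_dom k y; exists (`|e k * m k| * G).
    exact: dom1Z (HG _ (lexx y)).
  apply: eq_bigr => k _; have [G HG] := gaussm_dom k y.
  exact: int1Z (HG _ (lexx y)).
split.
  have [|E HE] := domF (fun k => (-1) ^+ k).
    by move=> k; rewrite normrX normrN1 expr1n.
  rewrite (_ : (fun N => _) = (fun N => int1 (F (fun k => (-1) ^+ k) N))); last first.
    by apply/funext => N; rewrite intF.
  apply: (int1_cvg HE).
  - by move=> s; apply: cvgM; [exact: cf|exact: continuous_gauss].
  - move=> s; rewrite /F /gaussm.
    rewrite (_ : (fun N => _) = (fun N => (\sum_(0 <= k < N)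
        (-1) ^+ k * m k * s ^+ k.*2) * expR (- (expR y * s ^+ 2)))); last first.
      by apply/funext => N; rewrite mulr_suml; apply: eq_bigr => k _; rewrite mulrA.
    by apply: cvgM; [exact: fm|exact: cvg_cst].
have [|E HE] := domF (fun=> 1); first by move=> k; rewrite normr1.
exists (E * int1 w) => N; have := le_norm_int1 (HE N); rewrite intF.
apply: le_trans; under eq_bigr do rewrite -[m _]mul1r.
exact: ler_norm.
Qed.

Let alpha k : R := int1 (fun s => f s * ((- s ^+ 2) ^+ k / k`!%:R)).

Let dom_alpha k : exists E, dom1 E (fun s => f s * ((- s ^+ 2) ^+ k / k`!%:R)).
Proof.
have [E HE] := gaussm_dom k (ln b); have {}HE := HE _ (lexx _).
exists (C * E); apply: (dom1_of_le _ C_ge0 HE).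
  move=> s; apply: cvgM; first exact: cf.
  apply: cvgM; last exact: cvg_cst.
  apply: (@continuous_comp _ _ _ (fun x : R => - x ^+ 2) (fun x => x ^+ k)).
    by apply: cvgN; exact: exprn_continuous.
  exact: exprn_continuous.
move=> s; rewrite normrM /gaussm lnK ?posrE// normrM normrX normrN normfV.
rewrite (ger0_norm (sqr_ge0 s)) (ger0_norm (ler0n _ _)) -exprM mul2n.
apply: (@le_trans _ _ (C * expR (- (b * s ^+ 2)) * s ^+ k.*2)); last first.
  by rewrite -[leLHS]mulrA [expR _ * _]mulrC.
apply: ler_pM => //; first by rewrite divr_ge0// -mul2n exprM exprn_ge0 ?sqr_ge0.
rewrite ler_pdivrMr ?ltr0n ?fact_gt0// ler_peMr ?ler1n ?fact_gt0//.
by rewrite -mul2n exprM exprn_ge0 ?sqr_ge0.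
Qed.

(** Here the Gaussian is expanded instead of [f], and the decay of [f] dominates the partial sums by
    a Gaussian of rate [b - expR y]. *)
Let small_frequencies y : y < ln b ->
  \sum_(0 <= k < N) alpha k * expR (k%:R * y) @[N --> \oo] --> D y /\
  exists M, forall N, \sum_(0 <= k < N) `|alpha k| * expR (k%:R * y) <= M.
Proof.
move=> yb; have c0 : 0 < b - expR y.
  by rewrite subr_gt0 -[ltRHS]lnK ?posrE// ltr_expR.
have expRE s k : expR (k%:R * y) * (s ^+ 2) ^+ k = (expR y * s ^+ 2) ^+ k.
  by rewrite [RHS]exprMn -expRM_natl.
have le_exp s N : `|f s| * \sum_(0 <= k < N) ((expR y * s ^+ 2) ^+ k / k`!%:R) <=
    C * expR (- ((b - expR y) * s ^+ 2)).
  have := @series_exp_le _ (expR y * s ^+ 2) N; rewrite mulr_ge0 ?expR_ge0 ?sqr_ge0//.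
  move=> /(_ isT) H; apply: le_trans (ler_pM _ _ (f_decay s) H) _ => //.
    by apply: sumr_ge0 => k _; rewrite divr_ge0// exprn_ge0// mulr_ge0 ?expR_ge0 ?sqr_ge0.
  by rewrite -mulrA -expRD ler_wpM2l// ler_expR; lra.
split.
  pose F N s := \sum_(0 <= k < N) expR (k%:R * y) * (f s * ((- s ^+ 2) ^+ k / k`!%:R)).
  have hF k : exists E, dom1 E (fun s => expR (k%:R * y) * (f s * ((- s ^+ 2) ^+ k / k`!%:R))).
    by have [E HE] := dom_alpha k; eexists; exact: dom1Z HE.
  have [E HE] := dom1_gauss c0.
  have HF N : dom1 (C * E) (F N).
    have [[E' [cF _]] _] := int1_sum N hF.
    apply: (dom1_of_le cF C_ge0 HE) => s; apply: le_trans (le_exp s N).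
    apply: le_trans (ler_norm_sum _ _ _) _; rewrite mulr_sumr.
    apply: ler_sum => k _; rewrite !normrM ger0_norm ?expR_ge0// mulrCA ler_wpM2l//.
    rewrite normrX normrN normfV (ger0_norm (sqr_ge0 s)) (ger0_norm (ler0n _ _)).
    by rewrite mulrA expRE.
  have := @int1_cvg _ (C * E) F (fun s => f s * expR (- (expR y * s ^+ 2))) HF.
  rewrite (_ : (fun N => int1 _) = (fun N => \sum_(0 <= k < N) alpha k * expR (k%:R * y))).
    apply.
    - by move=> s; apply: cvgM; [exact: cf|exact: continuous_gauss].
    - move=> s; rewrite /F.
      rewrite (_ : (fun N => _) = (fun N => f s * series (exp_coeff (- (expR y * s ^+ 2))) N)).
        by apply: cvgM; [exact: cvg_cst|exact: is_cvg_series_exp_coeff].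
      apply/funext => N; rewrite /series/= mulr_sumr; apply: eq_bigr => k _.
      rewrite /exp_coeff/= (_ : (- (expR y * s ^+ 2)) ^+ k =
          expR (k%:R * y) * (- s ^+ 2) ^+ k); first by ring.
      by rewrite -mulrN [LHS]exprMn -expRM_natl.
  apply/funext => N; have [_ ->] := int1_sum N hF.
  apply: eq_bigr => k _; have [E' HE'] := dom_alpha k.
  by rewrite (int1Z _ HE') mulrC.
have [E HE] := dom1_gauss c0.
have ha k : exists E, dom1 E (fun s => expR (k%:R * y) * `|f s * ((- s ^+ 2) ^+ k / k`!%:R)|).
  by have [E' HE'] := dom_alpha k; eexists; exact: dom1Z (dom1_norm HE').
exists (C * int1 (fun s => expR (- ((b - expR y) * s ^+ 2)))) => N.
have [[E' HE'] intF] := int1_sum N ha.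
rewrite -(int1Z _ HE).
apply: (@le_trans _ _ (\sum_(0 <= k < N) int1
    (fun s => expR (k%:R * y) * `|f s * ((- s ^+ 2) ^+ k / k`!%:R)|))).
  apply: ler_sum => k _; have [E2 HE2] := dom_alpha k.
  rewrite (int1Z _ (dom1_norm HE2)) mulrC ler_wpM2l ?expR_ge0//.
  exact: le_normr_Rintegral (dom1_integrable HE2).
rewrite -intF; apply: (le_int1 HE' (dom1Z C HE)) => s.
apply: le_trans (le_exp s N); rewrite mulr_sumr.
apply: ler_sum => k _; rewrite !normrM mulrCA ler_wpM2l//.
rewrite normrX normrN normfV (ger0_norm (sqr_ge0 s)) (ger0_norm (ler0n _ _)).
by rewrite mulrA expRE.
Qed.

Lemma hardy_real : m 0%N = 0.
Proof.
(* The quarter keeps even the end points [y0 - r] and [y0 + r] strictly between [ln a] and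
   [ln b]. *)
pose y0 := (ln a + ln b) / 2; pose r := (ln b - ln a) / 4.
have lnab : ln a < ln b by rewrite ltr_ln ?posrE.
have r0 : 0 < r by rewrite /r; lra.
have inr x : `|x| <= r -> ln a < y0 + x /\ y0 + x < ln b.
  by rewrite ler_norml /y0 /r => /andP[? ?]; lra.
pose A k := alpha k * expR (k%:R * y0).
pose B k := (-1) ^+ k * m k * gmoment k y0.
(* Pairs a function of the exponent with the difference of the two expansions of [D] at [y0]; the
   exponents are [k] and [- (k + 1/2)]. For [phi z = expR (z * x)] this is the difference at
   [y0 + x]. *)
pose L (phi : R -> R) N :=
  \sum_(0 <= k < N) (A k * phi k%:R - B k * phi (- (k%:R + 2^-1))).
pose Z phi := L phi N @[N --> \oo] --> (0 : R).
(* Continuity of [L] for the weight [expR (r |z|)]: the exponents [k] are worst at [y0 + r], the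
   negative ones at [y0 - r], and both series converge absolutely there. *)
have [M1 HM1] : exists M, forall N, \sum_(0 <= k < N) `|A k| * expR (r * `|k%:R|) <= M.
  have rr : `|r| <= r by rewrite ger0_norm// ltW.
  have [_ [M HM]] := small_frequencies (inr _ rr).2.
  exists M => N; apply: le_trans (HM N); apply: ler_sum => k _.
  rewrite /A normrM (ger0_norm (expR_ge0 _)) -mulrA -expRD (ger0_norm (ler0n R k)).
  by rewrite (mulrDr k%:R y0 r) (mulrC r).
have [M2 HM2] : exists M, forall N, \sum_(0 <= k < N) `|B k| * expR (r * `|- (k%:R + 2^-1)|) <= M.
  have rr : `|- r| <= r by rewrite normrN ger0_norm// ltW.
  have [_ [M HM]] := large_frequencies (inr _ rr).1.
  exists M => N; apply: le_trans (HM N); apply: ler_sum => k _.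
  rewrite /B !normrM normrX normrN1 expr1n mul1r normrN !ger0_norm ?gmoment_ge0//.
  rewrite -mulrA ler_wpM2l// gmomentE -mulrA -expRD [leRHS]gmomentE.
  by rewrite ler_wpM2l ?gmoment_ge0// ler_expR; lra.
have Zlin c phi psi : Z phi -> Z psi -> Z (fun z => c * phi z + psi z).
  move=> Zf Zg; rewrite /Z (_ : L _ = fun N => c * L phi N + L psi N).
    rewrite -(addr0 0) -{1}(mulr0 c).
    by apply: cvgD => //; apply: cvgM => //; exact: cvg_cst.
  apply/funext => N; rewrite /L mulr_sumr -big_split/=; apply: eq_bigr => k _.
  by ring.
have Zclosed phi : (forall e, 0 < e ->
    exists2 psi, Z psi & forall z, `|phi z - psi z| <= e * expR (r * `|z|)) -> Z phi.
  move=> H; apply/cvgr0Pnorm_le => e e0.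
  have M0 : 0 <= M1 + M2.
    by have := HM1 0%N; have := HM2 0%N; rewrite !big_nil; lra.
  have d0 : 0 < e / (2 * (M1 + M2 + 1)) by rewrite divr_gt0//; lra.
  have [psi Zpsi Hpsi] := H _ d0.
  have e2 : 0 < e / 2 by lra.
  move/cvgr0Pnorm_le: Zpsi => /(_ _ e2) Zpsi; near=> N.
  have Hd : `|L phi N - L psi N| <= e / 2.
    rewrite /L -sumrB; apply: le_trans (ler_norm_sum _ _ _) _.
    apply: (@le_trans _ _ (e / (2 * (M1 + M2 + 1)) *
       (\sum_(0 <= k < N) `|A k| * expR (r * `|k%:R|) +
        \sum_(0 <= k < N) `|B k| * expR (r * `|- (k%:R + 2^-1)|)))).
      rewrite -big_split/= mulr_sumr; apply: ler_sum => k _.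
      rewrite (_ : _ - _ = A k * (phi k%:R - psi k%:R) -
         B k * (phi (- (k%:R + 2^-1)) - psi (- (k%:R + 2^-1)))); last by ring.
      apply: le_trans (ler_normB _ _) _; rewrite !normrM mulrDr.
      apply: lerD; rewrite [leRHS]mulrCA; apply: ler_wpM2l => //; exact: Hpsi.
    apply: (@le_trans _ _ (e / (2 * (M1 + M2 + 1)) * (M1 + M2))).
      by rewrite ler_wpM2l ?(ltW d0)// lerD.
    rewrite mulrAC ler_pdivrMr; last by lra.
    by nra.
  rewrite (_ : L phi N = (L phi N - L psi N) + L psi N); last by rewrite subrK.
  apply: le_trans (ler_normD _ _) _.
  have : `|L psi N| <= e / 2 by near: N.
  by lra.
have Zexp x : `|x| <= r -> Z (fun z => expR (z * x)).
  move=> /inr[xa xb].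
  have [H1 _] := large_frequencies xa; have [H2 _] := small_frequencies xb.
  rewrite /Z -(subrr (D (y0 + x))).
  rewrite (_ : L _ = fun N => \sum_(0 <= k < N) alpha k * expR (k%:R * (y0 + x)) -
     \sum_(0 <= k < N) (-1) ^+ k * m k * gmoment k (y0 + x)); first exact: cvgB.
  apply/funext => N; rewrite /L -sumrB; apply: eq_bigr => k _.
  rewrite /A /B -(mulrA (alpha k)) -expRD -mulrDr; congr (_ - _).
  rewrite (gmomentE k y0) (gmomentE k (y0 + x)) (mulrDr (- _) y0 x) expRD.
  by rewrite !mulrA.
have := annulus_continuation r0 Zlin Zclosed Zexp (pi_ge0 R).
have sink k : sin (k%:R * pi) = 0 :> R.
  have := alternatingn (@sinDpi R) k 0.
  by rewrite add0r mulr_natl => ->; rewrite sin0 mulr0.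
have sink2 k : sin (- (k%:R + 2^-1) * pi) = - (-1) ^+ k :> R.
  have := alternatingn (@sinDpi R) k (pi / 2).
  rewrite sin_pihalf mulr1 -mulr_natl => <-.
  by rewrite mulNr sinN; congr (- sin _); field.
move=> /cvgr_dist_le H.
(* The sign of the sine, the minus in [L] and the sign in [B k] multiply to plus, so that no term
   can compensate the one at [k = 0]. *)
have : forall N, (0 < N)%N -> m 0%N * gmoment 0 y0 <= L (fun z => sin (z * pi)) N.
  case=> // N _; rewrite /L big_nat_recl//= sink sink2 mulr0 sub0r /B expr0 mul1r.
  rewrite mulrN opprK mulr1 lerDl; apply: sumr_ge0 => k _.
  rewrite sink sink2 mulr0 sub0r mulrN opprK mulrC !mulrA -exprMn mulrNN mulr1 expr1n mul1r.
  by rewrite mulr_ge0// gmoment_ge0.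
move=> H2; apply/eqP; rewrite eq_le m_ge0 andbT leNgt; apply/negP => m0.
have p0 : 0 < m 0%N * gmoment 0 y0 by rewrite mulr_gt0// gmoment0_gt0.
have p2 : 0 < m 0%N * gmoment 0 y0 / 2 by lra.
have [N _ HN] := H _ p2.
have := HN N.+1 (leqnSn _); have := H2 N.+1 isT; rewrite /= sub0r normrN.
have := ler_norm (L (fun z => sin (z * pi)) N.+1).
by move: p0; lra.
Unshelve. all: end_near. Qed.

End Hardy.
End HardyOnTheLine.

(** * Local boundedness by propagation *)

Section LocalBoundedness.
Variable R : realType.
Implicit Types (F : R -> R -> Prop) (s t : R).

(** [F C t] is to be read: the state at time [t] is bounded by [C], in a sense that weakens as [C]
    grows. *)
Definition loc_bounded F t :=
  exists d C, 0 < d /\ forall r, `|r - t| < d -> F C r.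

Definition bounded_between F s t :=
  exists C, forall r, Num.min s t <= r <= Num.max s t -> F C r.

(** Compactness of the interval, through the supremum of the points up to which a single constant
    works. *)
Lemma loc_bounded_itv F a b : (forall C D t, C <= D -> F C t -> F D t) ->
  a <= b -> (forall t, a <= t <= b -> loc_bounded F t) ->
  exists C, forall t, a <= t <= b -> F C t.
Proof.
move=> Fmono ab loc.
pose A := [set x | a <= x <= b /\ exists C, forall t, a <= t <= x -> F C t].
have Aa : A a.
  split; first by rewrite lexx.
  have [|d [C [d0 H]]] := loc a; first by rewrite lexx.
  exists C => t /le_anti <-; apply: H.
  by rewrite subrr normr0.
have supA : has_sup A.
  by split; [exists a|exists b => x [/andP[]]].
have lea : a <= sup A by exact: ub_le_sup supA.2 _ Aa.
have leb : sup A <= b by apply: ge_sup; [exists a|move=> x [/andP[]]].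
have [|d [C [d0 H]]] := loc (sup A); first by rewrite lea leb.
have [x [/andP[ax xb] [D HD]] xd] := sup_adherent d0 supA.
have key y : a <= y <= b -> y < sup A + d -> A y.
  move=> /andP[ay yb] yd; split; first by rewrite ay yb.
  exists (Num.max C D) => t /andP[at_ ty]; have [tx|xt] := leP t x.
    by apply: (Fmono D); [rewrite le_max lexx orbT|apply: HD; rewrite at_ tx].
  apply: (Fmono C); first by rewrite le_max lexx.
  by apply: H; rewrite ltr_norml; lra.
have [bd|bd] := ltP b (sup A + d).
  by have [||_ //] := key b; rewrite ?lexx ?ab.
have : sup A + d / 2 <= sup A.
  apply: (ub_le_sup supA.2); apply: key; last by lra.
  by apply/andP; split; lra.
by lra.
Qed.

Section Gap.
Variables (F : R -> R -> Prop) (E : nat -> set R) (c : nat -> R).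
Hypothesis Fmono : forall C D t, C <= D -> F C t -> F D t.
Hypothesis Ffin : forall t, exists C, F C t.
Hypothesis Ecover : forall t, exists N, E N t.
Hypothesis propagation : forall N s t, `|s - t| <= 1 -> E N t ->
  bounded_between F s t -> F (c N) s.

(** Let [sup A] be the last point up to [t] without local bound; such points form a closed set, so
    [sup A] is one of them and lies in [E N]. Propagating from it to [t] needs some bound on the
    whole gap, and local boundedness gives none near [sup A]. Propagation in the other direction,
    from [t], supplies one. *)
Lemma gap_bound N p t : p < t -> t <= p + 1 -> ~ loc_bounded F p ->
  (forall r, p <= r <= t -> ~ loc_bounded F r -> E N r) -> F (c N) t.
Proof.
move=> pt tp1 np HN.
pose A := [set r | p <= r <= t /\ ~ loc_bounded F r].
have Ap : A p by split=> //; rewrite lexx ltW.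
have supA : has_sup A by split; [exists p|exists t => x [/andP[]]].
have lea : p <= sup A by exact: ub_le_sup supA.2 _ Ap.
have leb : sup A <= t by apply: ge_sup; [exists p|move=> x [/andP[]]].
have nsup : ~ loc_bounded F (sup A).
  move=> [d [C [d0 H]]].
  have [x [/andP[ax xb] nx] xd] := sup_adherent d0 supA.
  apply: (nx); have xs : x <= sup A.
    by apply: (ub_le_sup supA.2); split=> //; apply/andP.
  exists (d - (sup A - x)), C; split; first by lra.
  by move=> r; rewrite ltr_norml => hr; apply: H; rewrite ltr_norml; lra.
have Esup : E N (sup A) by apply: HN; rewrite ?lea ?leb.
(* Backwards from [t]: the constant [c M] depends on [t] but holds on the whole gap. *)
have [M EM] := Ecover t.
have bnd s : sup A < s -> s <= t -> F (c M) s.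
  move=> As st; apply: (propagation _ EM).
    by rewrite ler_norml; lra.
  have [|C HC] := @loc_bounded_itv F s t Fmono st.
    move=> r /andP[sr rt]; apply: contrapT => nr.
    have : r <= sup A by apply: (ub_le_sup supA.2); split=> //; lra.
    by lra.
  by exists C; rewrite (min_idPl st) (max_idPr st).
(* Forwards from [sup A]: the bound just found only serves as a finiteness hypothesis, and the
   resulting constant [c N] no longer depends on [t]. *)
have [C HC] := Ffin (sup A).
apply: (propagation _ Esup); first by rewrite ler_norml; lra.
exists (Num.max C (c M)); rewrite (min_idPr leb) (max_idPl leb) => r /andP[r1 r2].
have [rs|rs] := eqVneq r (sup A).
  by rewrite rs; apply: Fmono HC; rewrite le_max lexx.
apply: (Fmono (C := c M)); first by rewrite le_max lexx orbT.
by apply: bnd => //; rewrite lt_neqAle eq_sym rs.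
Qed.

End Gap.

(** Time reversal, by which [gap_bound] also serves the times to the left of the bad point. *)
Lemma loc_boundedN F t : loc_bounded (fun C r => F C (- r)) t <-> loc_bounded F (- t).
Proof.
have normE r : `|- r - t| = `|r - - t| by rewrite -normrN; congr `|_|; ring.
split=> -[d [C [d0 H]]]; exists d, C; split=> // r hr.
  by have := H (- r); rewrite opprK; apply; rewrite normE.
by apply: H; rewrite -normE opprK.
Qed.

Lemma bounded_betweenN F s t :
  bounded_between (fun C r => F C (- r)) s t -> bounded_between F (- s) (- t).
Proof.
move=> [C H]; exists C => r hr; have := H (- r); rewrite opprK; apply.
move: hr; rewrite -oppr_max -oppr_min => /andP[h1 h2].
by apply/andP; split; lra.
Qed.

(* Baire category on the closed set of the points where [F] is not locally
   bounded: by nested intervals this set is covered near one of its points by a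
   single [E N], and propagation through the gaps then bounds [F] there. *)
Theorem locally_bounded_of_propagation (F : R -> R -> Prop) (E : nat -> set R) :
  (forall C D t, C <= D -> F C t -> F D t) ->
  (forall t, exists C, F C t) ->
  (forall N, closed (E N)) -> (forall t, exists N, E N t) ->
  (forall N, exists c, forall s t, `|s - t| <= 1 -> E N t ->
     bounded_between F s t -> F c s) ->
  forall a b, a <= b -> exists C, forall t, a <= t <= b -> F C t.
Proof.
move=> Fmono Ffin Eclosed Ecover /choice[c propagation] a b ab.
apply: loc_bounded_itv => // t0 _; apply: contrapT => nt0.
have [p [d [N [d0 [np HN]]]]] : exists p d N, 0 < d /\ ~ loc_bounded F p /\
    forall r, `|r - p| < d -> ~ loc_bounded F r -> E N r.
  apply: contrapT => H.
  pose good (x : R * R) := 0 < x.2 /\ ~ loc_bounded F x.1.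
  have step (N : nat) (x : {x : R * R | good x}) : exists y : {x : R * R | good x},
      (forall r, `|r - (sval y).1| <= (sval y).2 -> `|r - (sval x).1| < (sval x).2) /\
      (forall r, `|r - (sval y).1| <= (sval y).2 -> ~ E N r).
    case: x => -[p d] [/= d0 np].
    have [r [rp [nr nE]]] : exists r, `|r - p| < d /\ ~ loc_bounded F r /\ ~ E N r.
      apply: contrapT => H2; apply: H; exists p, d, N; split=> //; split=> // r rp nr.
      by apply: contrapT => nE; apply: H2; exists r.
    have : open (~` E N) by rewrite openC; exact: Eclosed.
    rewrite openE => /(_ r nE) /nbhs_ballP[e /= e0 He].
    (* Halving both radii makes the closed interval of the next stage avoid [E N] and stay inside
       the open interval of this one. *)
    pose e' := Num.min (e / 2) ((d - `|r - p|) / 2).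
    have e'0 : 0 < e' by rewrite lt_min; apply/andP; split; lra.
    have e'e : e' <= e / 2 by rewrite ge_min lexx.
    have e'd : e' <= (d - `|r - p|) / 2 by rewrite ge_min lexx orbT.
    have gy : good (r, e') by [].
    exists (exist _ (r, e') gy); split=> /= q qr.
      rewrite -(subrK r q) -addrA; apply: le_lt_trans (ler_normD _ _) _.
      by lra.
    by apply: He; rewrite /ball/= distrC; lra.
  have [f Hf] : exists f : nat -> {x : R * R | good x} -> {x : R * R | good x},
      forall N x,
      (forall r, `|r - (sval (f N x)).1| <= (sval (f N x)).2 -> `|r - (sval x).1| < (sval x).2) /\
      (forall r, `|r - (sval (f N x)).1| <= (sval (f N x)).2 -> ~ E N r).
    have /choice[f Hf] : forall Nx : nat * {x : R * R | good x}, exists y : {x : R * R | good x},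
      (forall r, `|r - (sval y).1| <= (sval y).2 -> `|r - (sval Nx.2).1| < (sval Nx.2).2) /\
      (forall r, `|r - (sval y).1| <= (sval y).2 -> ~ E Nx.1 r).
      by move=> [N x]; exact: step.
    by exists (fun N x => f (N, x)) => N x; exact: (Hf (N, x)).
  have g0 : good (t0, 1) by split.
  pose x := fix x k := if k is k'.+1 then f k' (x k') else exist _ (t0, 1) g0.
  pose l k := (sval (x k)).1 - (sval (x k)).2; pose u k := (sval (x k)).1 + (sval (x k)).2.
  have inI k r : `|r - (sval (x k)).1| <= (sval (x k)).2 <-> l k <= r <= u k.
    by rewrite ler_norml /l /u; split; lra.
  have lu k : l k <= u k by rewrite /l /u; have [] := svalP (x k); lra.
  have nest k r : l k.+1 <= r <= u k.+1 -> l k <= r <= u k.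
    by move=> /inI h; apply/inI/ltW; exact: (Hf k (x k)).1.
  have nest2 k j r : l (j + k)%N <= r <= u (j + k)%N -> l k <= r <= u k.
    by elim: j => // j IH /nest.
  have lku k j : l k <= u j.
    have h1 : l k <= l (j + k)%N <= u k by apply: (nest2 k j); rewrite lexx lu.
    have h2 : l j <= l (j + k)%N <= u j by rewrite addnC; apply: (nest2 j k); rewrite lexx lu.
    by case/andP: h1 => h1 _; case/andP: h2 => _ h2; exact: le_trans h1 h2.
  pose q := sup (range l).
  have hs : has_sup (range l).
    by split; [exists (l 0%N), 0%N|exists (u 0%N) => _ [k _ <-]; exact: lku].
  have qI k : l k <= q <= u k.
    apply/andP; split; first by apply: (ub_le_sup hs.2); exists k.
    by apply: ge_sup; [exists (l 0%N), 0%N|move=> _ [j _ <-]; exact: lku].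
  have [N EN] := Ecover q.
  by apply: (Hf N (x N)).2 EN; exact/(inI N.+1)/qI.
have [C HC] := Ffin p.
(* The 1 is the range in time of the propagation hypothesis. *)
apply: (np); exists (Num.min d 1), (Num.max C (c N)); split=> [|r].
  by rewrite lt_min d0 ltr01.
rewrite lt_min => /andP[rd r1].
have [rp|pr|->] := ltgtP r p; last by apply: Fmono HC; rewrite le_max lexx.
- apply: (Fmono (c N)); first by rewrite le_max lexx orbT.
  rewrite -[r]opprK.
  apply: (@gap_bound (fun C r => F C (- r)) (fun N => [set r | E N (- r)]) c _ _ _ _ N (- p)).
  + by move=> C1 D t; exact: Fmono.
  + by move=> t; exact: Ffin.
  + by move=> t; exact: Ecover.
  + move=> M s t st Et /bounded_betweenN; apply: propagation => //.
    by rewrite -opprD normrN.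
  + by rewrite ltrN2.
  + by move: r1; rewrite ltr_norml; lra.
  + by move/loc_boundedN; rewrite opprK.
  + move=> s /andP[s1 s2] ns; apply: HN; last by move=> h; apply: ns; apply/loc_boundedN.
    by move: rd; rewrite !ltr_norml; lra.
- apply: (Fmono (c N)); first by rewrite le_max lexx orbT.
  apply: (gap_bound Fmono Ffin Ecover propagation pr) => //.
  + by move: r1; rewrite ltr_norml; lra.
  + move=> s /andP[s1 s2]; apply: HN.
    by move: rd; rewrite !ltr_norml; lra.
Qed.

End LocalBoundedness.

(** * Complex calculus and Weyl operators *)

Section RealCalculus.
Variables (R : realType) (n : nat).
Notation V := 'cV[R]_n.
Implicit Types (f g : V -> R) (x y v : V) (j : 'I_n) (t : R).

Lemma colV_sum_delta x : x = \sum_i x i 0 *: delta_mx i 0.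
Proof.
apply/colP => j; rewrite summxE (bigD1 j)//= big1 => [|i ij].
  by rewrite !mxE !eqxx mulr1 addr0.
by rewrite !mxE eq_sym (negbTE ij) mulr0.
Qed.

Lemma derive_linear f x v : differentiable f x ->
  'D_v f x = \sum_i v i 0 * 'D_(delta_mx i 0) f x.
Proof.
move=> df; rewrite deriveE// {1}(colV_sum_delta v) linear_sum.
by apply: eq_bigr => i _; rewrite linearZ/= deriveE.
Qed.

Lemma is_derive_curve f (c : R -> V) (dc : V) t : differentiable f (c t) ->
  (forall i, is_derive t (1 : R) (fun r => c r i 0) (dc i 0)) ->
  is_derive t (1 : R) (fun r => f (c r)) (\sum_i dc i 0 * 'D_(delta_mx i 0) f (c t)).
Proof.
move=> df dci.
have cE : c = \sum_i (fun r : R => c r i 0 *: (delta_mx i 0 : V)).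
  by apply/funext => r; rewrite fct_sumE {1}(colV_sum_delta (c r)).
have d1 i : differentiable (fun r => c r i 0 : R) t.
  by apply/derivable1_diffP; case: (dci i).
have d2 i : differentiable (fun r : R => c r i 0 *: (delta_mx i 0 : V)) t.
  exact: differentiableZl.
have dC : differentiable c t by rewrite cE; exact: differentiable_sum.
have dfc : differentiable (fun r => f (c r)) t by exact: (differentiable_comp dC df).
have D1 : 'D_(1 : R) c t = dc.
  rewrite {1}cE derive_sum; last by move=> i; exact/diff_derivable.
  rewrite (colV_sum_delta dc); apply: eq_bigr => i _.
  rewrite deriveE// diffZl//=.
  have [_ <-] := dci i; rewrite deriveE//.
apply: DeriveDef; first exact/diff_derivable.
rewrite -derive_linear// [LHS]deriveE// (diff_comp dC df)/= -[in RHS]D1.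
by rewrite !deriveE.
Qed.

Lemma is_derive_line f x v t : differentiable f (x + t *: v) ->
  is_derive t (1 : R) (fun r => f (x + r *: v)) ('D_v f (x + t *: v)).
Proof.
move=> df; rewrite derive_linear//.
apply: (is_derive_curve df) => i.
rewrite (_ : (fun r => _) = (fun r => x i 0 + v i 0 * r)); last first.
  by apply/funext => r; rewrite !mxE mulrC.
by apply: is_derive_eq; rewrite /GRing.scale/=; ring.
Qed.

Lemma pd_derive f j : (forall x, differentiable f x) ->
  pd j f (fun x => 'D_(delta_mx j 0) f x).
Proof.
move=> df x s.
rewrite (_ : (fun t => _) = (fun t => f (x + (- x j 0) *: delta_mx j 0 + t *: delta_mx j 0))).
  have := @is_derive_line f (x + (- x j 0) *: delta_mx j 0) (delta_mx j 0) s (df _).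
  by rewrite /upd -addrA -scalerDl [- _ + _]addrC.
by apply/funext => t; rewrite /upd -addrA -scalerDl [- _ + _]addrC.
Qed.

Lemma lipschitz_partial f (C : R) x y : (forall z, differentiable f z) ->
  (forall j z, `|'D_(delta_mx j 0) f z| <= C) ->
  `|f y - f x| <= C * \sum_j `|y j 0 - x j 0|.
Proof.
move=> df Cf; have := @le_norm_diff _ (fun r => f (x + r *: (y - x)))
  (fun r => 'D_(y - x) f (x + r *: (y - x))) (C * \sum_j `|y j 0 - x j 0|) 0 1.
rewrite scale1r scale0r addr0 [x + _]addrC subrK subr0 normr1 mulr1; apply.
  by move=> t _; exact: is_derive_line.
move=> t _; rewrite derive_linear//; apply: le_trans (ler_norm_sum _ _ _) _.
by rewrite mulr_sumr; apply: ler_sum => j _; rewrite normrM mulrC !mxE ler_wpM2r.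
Qed.

Lemma derive_translate f x y v : 'D_v (fun z => f (z - y)) x = 'D_v f (x - y).
Proof.
have E : (fun h : R => h^-1 *: (((fun z => f (z - y)) \o shift x) (h *: v) - f (x - y))) =
         (fun h : R => h^-1 *: ((f \o shift (x - y)) (h *: v) - f (x - y))).
  by apply/funext => h /=; rewrite addrA.
by rewrite /derive E.
Qed.

Lemma differentiable_translate f x y : differentiable f (x - y) ->
  differentiable (fun z => f (z - y)) x.
Proof.
move=> df; apply: (@differentiable_comp _ _ _ _ (fun z => z - y) f) => //.
Qed.

End RealCalculus.

Section ComplexNorm.
Variable R : realType.
Local Notation C := R[i].
Local Notation re := (@complex.Re R).
Local Notation im := (@complex.Im R).
Implicit Types (z u : C) (a b : R).

(** The modulus on [R[i]] takes its values in [R[i]]; estimates use this equivalent real-valued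
    norm, which is submultiplicative but only bounds phases by 2. Identities for the squared norm
    use the exact [sqn]. *)
Definition cabs z : R := `|re z| + `|im z|.

Definition sqn z : R := re z ^+ 2 + im z ^+ 2.

Lemma cplx_eq z u : re z = re u -> im z = im u -> z = u.
Proof. by case: z => a b; case: u => c d /= -> ->. Qed.

Lemma reD z u : re (z + u) = re z + re u. Proof. by case: z; case: u. Qed.
Lemma imD z u : im (z + u) = im z + im u. Proof. by case: z; case: u. Qed.
Lemma reN z : re (- z) = - re z. Proof. by case: z. Qed.
Lemma imN z : im (- z) = - im z. Proof. by case: z. Qed.
Lemma reM z u : re (z * u) = re z * re u - im z * im u.
Proof. by case: z; case: u. Qed.
Lemma imM z u : im (z * u) = re z * im u + im z * re u.
Proof. by case: z; case: u. Qed.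
Lemma reR a : re a%:C = a. Proof. by []. Qed.
Lemma imR a : im a%:C = 0. Proof. by []. Qed.
Lemma re0 : re 0 = 0. Proof. by []. Qed.
Lemma im0 : im 0 = 0. Proof. by []. Qed.
Lemma re1 : re 1 = 1. Proof. by []. Qed.
Lemma im1 : im 1 = 0. Proof. by []. Qed.
Lemma rei : re 'i = 0. Proof. by []. Qed.
Lemma imi : im 'i = 1. Proof. by []. Qed.

Lemma recplx a b : re (Complex a b) = a. Proof. by []. Qed.
Lemma imcplx a b : im (Complex a b) = b. Proof. by []. Qed.

Lemma re_sum (I : Type) (r : seq I) (F : I -> C) :
  re (\sum_(i <- r) F i) = \sum_(i <- r) re (F i).
Proof. by elim/big_rec2: _ => // i y1 y2 _ <-; rewrite reD. Qed.

Lemma im_sum (I : Type) (r : seq I) (F : I -> C) :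
  im (\sum_(i <- r) F i) = \sum_(i <- r) im (F i).
Proof. by elim/big_rec2: _ => // i y1 y2 _ <-; rewrite imD. Qed.

Definition creim_opE := (reD, imD, reN, imN, reM, imM, recplx, imcplx).
Definition creimE := (creim_opE, reR, imR, re0, im0, re1, im1, rei, imi).

Lemma cabs_ge0 z : 0 <= cabs z. Proof. exact: addr_ge0. Qed.

Lemma cabsD z u : cabs (z + u) <= cabs z + cabs u.
Proof. by rewrite /cabs !creimE addrACA lerD ?ler_normD. Qed.

Lemma cabsN z : cabs (- z) = cabs z.
Proof. by rewrite /cabs !creimE !normrN. Qed.

Lemma cabsM z u : cabs (z * u) <= cabs z * cabs u.
Proof.
rewrite /cabs !creimE.
apply: (@le_trans _ _ ((`|re z| * `|re u| + `|im z| * `|im u|) +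
                       (`|re z| * `|im u| + `|im z| * `|re u|))); last by lra.
by apply: lerD; rewrite -!normrM ?ler_normB ?ler_normD.
Qed.

Lemma cabs_le_re z : `|re z| <= cabs z. Proof. by rewrite lerDl. Qed.
Lemma cabs_le_im z : `|im z| <= cabs z. Proof. by rewrite lerDr. Qed.

Lemma sqn_le_cabs z : sqn z <= cabs z ^+ 2.
Proof.
rewrite /sqn /cabs -[re z ^+ 2]real_normK ?num_real// -[im z ^+ 2]real_normK ?num_real//.
by have := normr_ge0 (re z); have := normr_ge0 (im z); nra.
Qed.

Lemma cabs_le_sqn z : cabs z ^+ 2 <= 2 * sqn z.
Proof.
rewrite /sqn /cabs -[re z ^+ 2]real_normK ?num_real// -[im z ^+ 2]real_normK ?num_real//.
by have := sqr_ge0 (`|re z| - `|im z|); nra.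
Qed.

Lemma sqn_ge0 z : 0 <= sqn z. Proof. by rewrite addr_ge0 ?sqr_ge0. Qed.

Lemma sqnM z u : sqn (z * u) = sqn z * sqn u.
Proof. by rewrite /sqn !creimE; ring. Qed.

Lemma sqn_eq0 z : sqn z = 0 -> z = 0.
Proof.
rewrite /sqn => /eqP; rewrite paddr_eq0 ?sqr_ge0// !sqrf_eq0 => /andP[/eqP r0 /eqP i0].
exact: cplx_eq.
Qed.

Lemma sqn_normr z a : `|z| <= a%:C -> sqn z <= a ^+ 2.
Proof.
case: z => x y; rewrite normc_def lecR /sqn /= => h.
have h0 : 0 <= x ^+ 2 + y ^+ 2 by rewrite addr_ge0 ?sqr_ge0.
by rewrite -[leLHS]sqr_sqrtr// lerXn2r// ?nnegrE ?sqrtr_ge0// (le_trans _ h)// sqrtr_ge0.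
Qed.

End ComplexNorm.

Section ComplexCalculus.
Variables (R : realType) (n : nat).
Local Notation C := R[i].
Notation V := 'cV[R]_n.
Local Notation re := (@complex.Re R).
Local Notation im := (@complex.Im R).
Implicit Types (f g : V -> C) (x y v a : V) (j : 'I_n) (t b : R) (c : C).

Lemma cdiff_eq f (p q : V -> R) x : (forall y, re (f y) = p y) ->
  (forall y, im (f y) = q y) -> differentiable p x -> differentiable q x ->
  cdifferentiable f x.
Proof. by move=> /funext fp /funext fq dp dq; split; [rewrite fp|rewrite fq]. Qed.

Lemma cpartial_eq f (p q : V -> R) j x : (forall y, re (f y) = p y) ->
  (forall y, im (f y) = q y) ->
  cpartial j f x = Complex ('D_(delta_mx j 0) p x) ('D_(delta_mx j 0) q x).
Proof. by move=> /funext fp /funext fq; rewrite /cpartial fp fq. Qed.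

Lemma cdiffD f g x : cdifferentiable f x -> cdifferentiable g x ->
  cdifferentiable (fun x => f x + g x) x.
Proof.
move=> [f1 f2] [g1 g2].
by apply: (cdiff_eq (fun y => reD (f y) (g y)) (fun y => imD (f y) (g y)));
  exact: differentiableD.
Qed.

Lemma cdiffM f g x : cdifferentiable f x -> cdifferentiable g x ->
  cdifferentiable (fun x => f x * g x) x.
Proof.
move=> [f1 f2] [g1 g2].
apply: (cdiff_eq (fun y => reM (f y) (g y)) (fun y => imM (f y) (g y))).
  by apply: differentiableB; exact: differentiableM.
by apply: differentiableD; exact: differentiableM.
Qed.

Lemma cdiff_cst c x : cdifferentiable (fun=> c : C) x.
Proof. by split; exact: differentiable_cst. Qed.

Lemma cdiffZ c f x : cdifferentiable f x -> cdifferentiable (fun x => c * f x) x.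
Proof. by apply: cdiffM; exact: cdiff_cst. Qed.

Lemma cdiff_coord j x : cdifferentiable (fun x => (x j 0)%:C) x.
Proof. by split; [exact: differentiable_coord|exact: differentiable_cst]. Qed.

Lemma cdiff_translate f x y : cdifferentiable f (x - y) ->
  cdifferentiable (fun z => f (z - y)) x.
Proof.
by move=> [f1 f2]; split;
  [exact: (@differentiable_translate _ _ (fun z => re (f z)))
  |exact: (@differentiable_translate _ _ (fun z => im (f z)))].
Qed.

Lemma cpartialD j f g x : cdifferentiable f x -> cdifferentiable g x ->
  cpartial j (fun x => f x + g x) x = cpartial j f x + cpartial j g x.
Proof.
move=> [f1 f2] [g1 g2].
rewrite (cpartial_eq _ _ (fun y => reD (f y) (g y)) (fun y => imD (f y) (g y))).
by rewrite !deriveD//; exact: diff_derivable.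
Qed.

Lemma cpartialM j f g x : cdifferentiable f x -> cdifferentiable g x ->
  cpartial j (fun x => f x * g x) x = cpartial j f x * g x + f x * cpartial j g x.
Proof.
move=> [f1 f2] [g1 g2]; have d (h : V -> R) : differentiable h x ->
  derivable h x (delta_mx j 0) by exact: diff_derivable.
have dM (h k : V -> R) : differentiable h x -> differentiable k x ->
    'D_(delta_mx j 0) (fun y => h y * k y) x =
    h x * 'D_(delta_mx j 0) k x + k x * 'D_(delta_mx j 0) h x.
  by move=> dh dk; rewrite (@deriveM _ _ h k)//; exact: d.
have ddM (h k : V -> R) : differentiable h x -> differentiable k x ->
    derivable (fun y => h y * k y) x (delta_mx j 0).
  by move=> dh dk; apply: d; exact: differentiableM.
rewrite (cpartial_eq _ _ (fun y => reM (f y) (g y)) (fun y => imM (f y) (g y))).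
have dB (h k : V -> R) : derivable h x (delta_mx j 0) -> derivable k x (delta_mx j 0) ->
    'D_(delta_mx j 0) (fun y => h y - k y) x =
    'D_(delta_mx j 0) h x - 'D_(delta_mx j 0) k x by exact: deriveB.
have dD (h k : V -> R) : derivable h x (delta_mx j 0) -> derivable k x (delta_mx j 0) ->
    'D_(delta_mx j 0) (fun y => h y + k y) x =
    'D_(delta_mx j 0) h x + 'D_(delta_mx j 0) k x by exact: deriveD.
rewrite dB; [|exact: ddM|exact: ddM]; rewrite dD; [|exact: ddM|exact: ddM].
by rewrite !dM// /cpartial; apply: cplx_eq; rewrite !creim_opE; ring.
Qed.

Lemma cpartial_cst j c x : cpartial j (fun=> c) x = 0.
Proof. by apply: cplx_eq => /=; exact: derive_cst. Qed.

Lemma cpartialZ j c f x : cdifferentiable f x ->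
  cpartial j (fun x => c * f x) x = c * cpartial j f x.
Proof.
by move=> df; rewrite cpartialM ?cpartial_cst ?mul0r ?add0r//; exact: cdiff_cst.
Qed.

Lemma cpartial_coord j k x : cpartial j (fun x => (x k 0)%:C) x = (k == j)%:R%:C.
Proof.
apply: cplx_eq => /=; last exact: derive_cst.
have H := @is_derive_line _ _ (fun x => x k 0) x (delta_mx j 0) 0
  (differentiable_coord _ _ _).
have := @derive_val _ _ _ _ _ _ _ H; rewrite scale0r addr0 => <-.
rewrite (_ : (fun r => _) = (fun r => x k 0 + (k == j)%:R * r)); last first.
  by apply/funext => r; rewrite !mxE eqxx andbT mulrC.
by rewrite derive_val /GRing.scale/=; ring.
Qed.

Lemma cpartial_translate j f x y :
  cpartial j (fun z => f (z - y)) x = cpartial j f (x - y).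
Proof.
apply: cplx_eq => /=.
  exact: (@derive_translate _ _ (fun z => re (f z))).
exact: (@derive_translate _ _ (fun z => im (f z))).
Qed.

Definition phase a b x : C := Complex (cos (dot a x + b)) (sin (dot a x + b)).

Lemma differentiable_affine a b x : differentiable (fun x => dot a x + b) x.
Proof.
apply: differentiableD; last exact: differentiable_cst.
rewrite (_ : dot a = \sum_i (fun x : V => a i 0 * x i 0)); last first.
  by apply/funext => z; rewrite fct_sumE.
apply: differentiable_sum => i.
apply: differentiableM; first exact: differentiable_cst.
exact: differentiable_coord.
Qed.

Lemma cdiff_phase a b x : cdifferentiable (phase a b) x.
Proof.
have d (h : R -> R) : (forall t, differentiable h t) ->
    differentiable (fun x => h (dot a x + b)) x.
  move=> dh; apply: (@differentiable_comp _ _ _ _ (fun x => dot a x + b) h) => //.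
  exact: differentiable_affine.
by split=> /=; apply: d => t; apply/derivable1_diffP.
Qed.

Lemma dot_line a x v t : dot a (x + t *: v) = dot a x + t * dot a v.
Proof.
rewrite /dot mulr_sumr -big_split/=; apply: eq_bigr => i _.
by rewrite !mxE; ring.
Qed.

Lemma dot_delta a j : dot a (delta_mx j 0) = a j 0.
Proof.
rewrite /dot (bigD1 j)//= big1 => [|i ij]; first by rewrite !mxE !eqxx mulr1 addr0.
by rewrite !mxE (negbTE ij) mulr0.
Qed.

Lemma cpartial_phase a b j x :
  cpartial j (phase a b) x = 'i * (a j 0)%:C * phase a b x.
Proof.
have [d1 d2] := cdiff_phase a b x.
have key (h dh : R -> R) : (forall t, is_derive t (1 : R) h (dh t)) ->
    differentiable (fun x => h (dot a x + b)) x ->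
    'D_(delta_mx j 0) (fun x => h (dot a x + b)) x = a j 0 * dh (dot a x + b).
  move=> hd dx; have := @is_derive_line _ _ (fun x => h (dot a x + b)) x (delta_mx j 0) 0.
  rewrite scale0r addr0 => /(_ dx) H.
  have := @derive_val _ _ _ _ _ _ _ H => <-.
  rewrite (_ : (fun r => _) = (fun r => h (dot a x + b + a j 0 * r))); last first.
    by apply/funext => r; rewrite dot_line dot_delta; congr h; ring.
  have dd : is_derive (0 : R) (1 : R) (fun r => dot a x + b + a j 0 * r) (a j 0).
    by apply: is_derive_eq; rewrite /GRing.scale/=; ring.
  have hh := hd (dot a x + b + a j 0 * 0).
  have hd2 := @is_derive1_comp R h (fun r => dot a x + b + a j 0 * r) 0 _ _ hh dd.
  by rewrite (@derive_val _ _ _ _ _ _ _ hd2) mulrC mulr0 addr0.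
rewrite /cpartial /phase; apply: cplx_eq; rewrite !creimE.
  by rewrite (key _ (fun t => - sin t))//; ring.
by rewrite (key _ cos)//; ring.
Qed.

End ComplexCalculus.

Section ComplexCurves.
Variable R : realType.
Local Notation C := R[i].
Local Notation re := (@complex.Re R).
Local Notation im := (@complex.Im R).
Implicit Types (f g : R -> C) (t : R) (d e : C).

Definition cis_derive f t d :=
  is_derive t (1 : R) (fun r => re (f r)) (re d) /\
  is_derive t (1 : R) (fun r => im (f r)) (im d).

Lemma cis_derive_eq f t d e : cis_derive f t d -> d = e -> cis_derive f t e.
Proof. by move=> fd <-. Qed.

Lemma cis_derive_cst c t : cis_derive (fun=> c) t 0.
Proof. by split; exact: is_derive_cst. Qed.

Lemma cis_deriveD f g t d e : cis_derive f t d -> cis_derive g t e ->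
  cis_derive (fun r => f r + g r) t (d + e).
Proof.
move=> [f1 f2] [g1 g2]; split; rewrite ?reD ?imD.
  by rewrite (_ : (fun r => _) = (fun r => re (f r) + re (g r)));
    [exact: is_deriveD|apply/funext => r; exact: reD].
by rewrite (_ : (fun r => _) = (fun r => im (f r) + im (g r)));
  [exact: is_deriveD|apply/funext => r; exact: imD].
Qed.

Lemma cis_deriveM f g t d e : cis_derive f t d -> cis_derive g t e ->
  cis_derive (fun r => f r * g r) t (d * g t + f t * e).
Proof.
move=> [f1 f2] [g1 g2]; split.
  rewrite (_ : (fun r => _) = (fun r => re (f r) * re (g r) - im (f r) * im (g r)));
    last by apply/funext => r; exact: reM.
  by apply: is_derive_eq; rewrite !creim_opE /GRing.scale/=; ring.
rewrite (_ : (fun r => _) = (fun r => re (f r) * im (g r) + im (f r) * re (g r)));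
  last by apply/funext => r; exact: imM.
by apply: is_derive_eq; rewrite !creim_opE /GRing.scale/=; ring.
Qed.

Lemma cis_derive_cis (theta : R -> R) t (d : R) : is_derive t (1 : R) theta d ->
  cis_derive (fun r => Complex (cos (theta r)) (sin (theta r))) t
    ('i * d%:C * Complex (cos (theta t)) (sin (theta t))).
Proof.
move=> td; split.
  have H := @is_derive1_comp R cos theta t _ _ (is_derive_cos (theta t)) td.
  by apply: is_derive_eq; rewrite !creimE; ring.
have H := @is_derive1_comp R sin theta t _ _ (is_derive_sin (theta t)) td.
by apply: is_derive_eq; rewrite !creimE; ring.
Qed.

Lemma cis_derive_le f df (K s t : R) : (forall r, Num.min s t <= r <= Num.max s t -> cis_derive f r (df r)) ->
  (forall r, Num.min s t <= r <= Num.max s t -> cabs (df r) <= K) ->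
  cabs (f t - f s) <= 2 * K * `|t - s|.
Proof.
move=> fd dfK; rewrite /cabs !creimE mulrDl mulrDl mul1r.
apply: lerD.
  apply: (@le_norm_diff R (fun r => re (f r)) (fun r => re (df r))).
    by move=> r /fd[].
  by move=> r /dfK; exact/le_trans/cabs_le_re.
apply: (@le_norm_diff R (fun r => im (f r)) (fun r => im (df r))).
  by move=> r /fd[].
by move=> r /dfK; exact/le_trans/cabs_le_im.
Qed.

End ComplexCurves.

(** * Seminorms by words in the generators, and Weyl operators *)

Section SchwartzSeminorms.
Variables (R : realType) (n : nat).
Local Notation C := R[i].
Notation V := 'cV[R]_n.
Local Notation re := (@complex.Re R).
Local Notation im := (@complex.Im R).
Implicit Types (f g : V -> C) (x y v eta : V) (j : 'I_n) (a : 'I_n + 'I_n) (K L : R) (k : nat) (c : C).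

Definition gen a f : V -> C :=
  match a with
  | inl j => fun x => (x j 0)%:C * f x
  | inr j => cpartial j f
  end.

(** All words of length at most [k] in the coordinates and the partial derivatives, in any order,
    are bounded by [K]. The recursion avoids multi-indices and any normal ordering. *)
Fixpoint Bnd k K f : Prop :=
  [/\ forall x, cdifferentiable f x, forall x, cabs (f x) <= K
    & if k is k'.+1 then forall a, Bnd k' K (gen a f) else True].

Lemma Bnd_diff k K f x : Bnd k K f -> cdifferentiable f x.
Proof. by case: k => [|k] []. Qed.

Lemma Bnd_cabs k K f x : Bnd k K f -> cabs (f x) <= K.
Proof. by case: k => [|k] []. Qed.

Lemma Bnd_gen k K f a : Bnd k.+1 K f -> Bnd k K (gen a f).
Proof. by case=> _ _; apply. Qed.

Lemma Bnd_ge0 k K f : Bnd k K f -> 0 <= K.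
Proof. by move/Bnd_cabs => /(_ 0); apply: le_trans; exact: cabs_ge0. Qed.

Lemma Bnd_le k K L f : K <= L -> Bnd k K f -> Bnd k L f.
Proof.
move=> KL; elim: k f => [|k IH] f [df fK H]; split=> // x; first exact: le_trans (fK x) KL.
  exact: le_trans (fK x) KL.
exact: IH (H x).
Qed.

Lemma Bnd_leq k m K f : (m <= k)%N -> Bnd k K f -> Bnd m K f.
Proof.
elim: m k f => [|m IH] k f; first by move=> _ fK; split=> // x; [exact: Bnd_diff fK|exact: Bnd_cabs fK].
case: k => // k mk [df fK H]; split=> // a; exact: IH (H a).
Qed.

Lemma genD a f g : (forall x, cdifferentiable f x) -> (forall x, cdifferentiable g x) ->
  gen a (fun x => f x + g x) = (fun x => gen a f x + gen a g x).
Proof.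
move=> df dg; apply/funext => x; case: a => j /=; first by rewrite mulrDr.
exact: cpartialD.
Qed.

Lemma genZ a c f : (forall x, cdifferentiable f x) ->
  gen a (fun x => c * f x) = (fun x => c * gen a f x).
Proof.
move=> df; apply/funext => x; case: a => j /=; first by rewrite mulrCA.
exact: cpartialZ.
Qed.

Lemma BndD k K L f g : Bnd k K f -> Bnd k L g -> Bnd k (K + L) (fun x => f x + g x).
Proof.
elim: k f g => [|k IH] f g fK gL.
  have [df hf _] := fK; have [dg hg _] := gL; split=> // x; first exact: cdiffD.
  exact: le_trans (cabsD _ _) (lerD (hf x) (hg x)).
have [df hf Hf] := fK; have [dg hg Hg] := gL; split=> [x|x|a]; first exact: cdiffD.
  exact: le_trans (cabsD _ _) (lerD (hf x) (hg x)).
by rewrite genD//; exact: IH (Hf a) (Hg a).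
Qed.

Lemma BndZ k K c f : Bnd k K f -> Bnd k (cabs c * K) (fun x => c * f x).
Proof.
elim: k f => [|k IH] f fK.
  have [df hf _] := fK; split=> // x; first exact: cdiffZ.
  by apply: le_trans (cabsM _ _) _; rewrite ler_wpM2l ?cabs_ge0.
have [df hf Hf] := fK; split=> [x|x|a]; first exact: cdiffZ.
  by apply: le_trans (cabsM _ _) _; rewrite ler_wpM2l ?cabs_ge0.
by rewrite genZ//; exact: IH (Hf a).
Qed.

Section Heisenberg.
Variable hbar : R.
Hypothesis hbar_gt0 : 0 < hbar.

(* [exp (i (eta . x - y . p) / hbar)] in closed form: the constant half phase comes
   from the commutator of [x] and [p]. *)
Definition rho y eta f : V -> C :=
  fun x => phase (hbar^-1 *: eta) (- (dot eta y / (2 * hbar))) x * f (x - y).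

(** The scalar that conjugation by [rho] adds to the generator [a]; see [gen_rho]. *)
Definition shiftc y eta a : C :=
  match a with
  | inl j => (y j 0)%:C
  | inr j => 'i * (eta j 0 / hbar)%:C
  end.

Lemma cdiff_rho y eta f x : (forall x, cdifferentiable f x) -> cdifferentiable (rho y eta f) x.
Proof.
move=> df; apply: cdiffM; first exact: cdiff_phase.
exact: cdiff_translate.
Qed.

Lemma rhoD y eta f g : rho y eta (fun x => f x + g x) = (fun x => rho y eta f x + rho y eta g x).
Proof. by apply/funext => x; rewrite /rho mulrDr. Qed.

Lemma rhoZ y eta c f : rho y eta (fun x => c * f x) = (fun x => c * rho y eta f x).
Proof. by apply/funext => x; rewrite /rho mulrCA. Qed.

Lemma gen_rho y eta a f : (forall x, cdifferentiable f x) ->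
  gen a (rho y eta f) = rho y eta (fun x => gen a f x + shiftc y eta a * f x).
Proof.
move=> df; apply/funext => x; case: a => j /=.
  rewrite /rho !mxE (_ : (x j 0)%:C = (x j 0 - y j 0)%:C + (y j 0)%:C); first by ring.
  by rewrite -rmorphD subrK.
rewrite /rho cpartialM; [|exact: cdiff_phase|exact: cdiff_translate].
rewrite cpartial_phase cpartial_translate !mxE [hbar^-1 * _]mulrC.
by ring.
Qed.

Lemma cabs_phase (b : R) v x : cabs (phase v b x) <= 2.
Proof.
rewrite /cabs /phase/=.
have hc : `|cos (dot v x + b)| <= 1 by rewrite ler_norml cos_geN1 cos_le1.
have hs : `|sin (dot v x + b)| <= 1 by rewrite ler_norml sin_geN1 sin_le1.
by lra.
Qed.

Lemma cabs_rho y eta f K x : (forall x, cabs (f x) <= K) -> cabs (rho y eta f x) <= 2 * K.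
Proof.
move=> fK; apply: le_trans (cabsM _ _) _; apply: ler_pM; rewrite ?cabs_ge0//.
exact: cabs_phase.
Qed.

(** Commuting one generator past [rho] costs a factor [1 + q], and there are at most [k] of them;
    the 2 is the bound on the phase. *)
Lemma Bnd_rho k K f y eta (q : R) : (forall a, cabs (shiftc y eta a) <= q) -> 0 <= q ->
  Bnd k K f -> Bnd k (2 * (1 + q) ^+ k * K) (rho y eta f).
Proof.
move=> hq q0; elim: k K f => [|k IH] K f fK.
  have [df hf _] := fK; split=> // x; first exact: cdiff_rho.
  by rewrite expr0 mulr1; exact: cabs_rho.
have [df hf Hf] := fK; have K0 := Bnd_ge0 fK; split=> [x|x|a]; first exact: cdiff_rho.
  apply: le_trans (cabs_rho _ _ _ hf) _.
  by rewrite mulrAC ler_peMr ?mulr_ge0// exprn_ege1//; lra.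
rewrite gen_rho// exprSr mulrA -[X in Bnd _ X]mulrA; apply: IH.
rewrite mulrDl mul1r; apply: BndD; first exact: Hf.
apply: Bnd_le (BndZ _ (Bnd_leq (leqnSn k) fK)).
by rewrite ler_wpM2r.
Qed.

(** The derivative [w] along the moving base point is left as a hypothesis, so that the formula
    serves a fixed function as well as a solution that itself depends on time. The halved difference
    is half the symplectic product of [(y, eta)] with its velocity. *)
Lemma cis_derive_rho (y eta : R -> V) (dy deta : V) (u : R -> V -> C) (w : C) x (t : R) :
  (forall i, is_derive t (1 : R) (fun r => y r i 0) (dy i 0)) ->
  (forall i, is_derive t (1 : R) (fun r => eta r i 0) (deta i 0)) ->
  cis_derive (fun r => u r (x - y r)) t w ->
  cis_derive (fun r => rho (y r) (eta r) (u r) x) t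
   (phase (hbar^-1 *: eta t) (- (dot (eta t) (y t) / (2 * hbar))) x *
     (w + 'i * ((dot deta (x - y t) + (dot deta (y t) - dot (eta t) dy) / 2) / hbar)%:C * u t (x - y t))).
Proof.
move=> yd ed uw.
pose theta r := dot (hbar^-1 *: eta r) x + - (dot (eta r) (y r) / (2 * hbar)).
have dsum (F : 'I_n -> R -> R) (dF : 'I_n -> R) :
    (forall i, is_derive t (1 : R) (F i) (dF i)) ->
    is_derive t (1 : R) (fun r => \sum_i F i r) (\sum_i dF i).
  move=> H; rewrite (_ : (fun r => _) = \sum_i F i); first exact: is_derive_sum.
  by apply/funext => r; rewrite fct_sumE.
have d1 : is_derive t (1 : R) (fun r => dot (hbar^-1 *: eta r) x) (dot deta x / hbar).
  rewrite /dot mulr_suml; apply: dsum => i.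
  rewrite (_ : (fun r => _) = (fun r => (x i 0 / hbar) * eta r i 0)); last first.
    by apply/funext => r; rewrite !mxE; ring.
  have := ed i => edi.
  by apply: is_derive_eq; rewrite /GRing.scale/=; ring.
have d2 : is_derive t (1 : R) (fun r => dot (eta r) (y r)) (dot deta (y t) + dot (eta t) dy).
  rewrite /dot -big_split/=; apply: dsum => i.
  have := ed i => edi; have := yd i => ydi.
  by apply: is_derive_eq; rewrite /GRing.scale/=; ring.
have dth : is_derive t (1 : R) theta
    ((dot deta (x - y t) + (dot deta (y t) - dot (eta t) dy) / 2) / hbar).
  rewrite /theta (_ : (fun r => _) = (fun r => dot (hbar^-1 *: eta r) x +
      (- (2 * hbar)^-1) * dot (eta r) (y r))); last by apply/funext => r; rewrite mulNr mulrC.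
  apply: is_derive_eq; rewrite /GRing.scale/=.
  have -> : dot deta (x - y t) = dot deta x - dot deta (y t).
    by rewrite /dot -sumrB; apply: eq_bigr => i _; rewrite !mxE mulrBr.
  by field; rewrite gt_eqF.
apply: cis_derive_eq (cis_deriveM (cis_derive_cis dth) uw) _.
by rewrite /phase -/(theta t); ring.
Qed.

Lemma cis_derive_translate f (y : R -> V) (dy : V) x t : (forall x, cdifferentiable f x) ->
  (forall i, is_derive t (1 : R) (fun r => y r i 0) (dy i 0)) ->
  cis_derive (fun r => f (x - y r)) t (- \sum_i (dy i 0)%:C * cpartial i f (x - y t)).
Proof.
move=> df yd.
have dc i : is_derive t (1 : R) (fun r => (x - y r) i 0) ((- dy) i 0).
  rewrite (_ : (fun r => _) = (fun r => x i 0 - y r i 0)); last first.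
    by apply/funext => r; rewrite !mxE.
  by have := yd i => ydi; apply: is_derive_eq; rewrite !mxE; ring.
have [f1 f2] := df (x - y t).
split.
  have := @is_derive_curve _ _ (fun z => re (f z)) (fun r => x - y r) (- dy) t f1 dc.
  rewrite reN re_sum -sumrN => H; apply: (@is_derive_eq _ _ _ _ _ _ _ _ H).
  by apply: eq_bigr => i _; rewrite !mxE reM !creimE; ring.
have := @is_derive_curve _ _ (fun z => im (f z)) (fun r => x - y r) (- dy) t f2 dc.
rewrite imN im_sum -sumrN => H; apply: (@is_derive_eq _ _ _ _ _ _ _ _ H).
by apply: eq_bigr => i _; rewrite !mxE imM !creimE; ring.
Qed.

End Heisenberg.
End SchwartzSeminorms.

(** * Difference quotients of Weyl operators *)

Section DifferenceQuotients.
Variables (R : realType) (n : nat) (hbar : R).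
Hypothesis hbar_gt0 : 0 < hbar.
Local Notation C := R[i].
Notation V := 'cV[R]_n.
Local Notation re := (@complex.Re R).
Local Notation im := (@complex.Im R).
Local Notation rho := (@rho R n hbar).
Local Notation shiftc := (@shiftc R n hbar).
Implicit Types (f g : V -> C) (x y v eta : V) (j : 'I_n) (a : 'I_n + 'I_n) (K L h q : R) (k : nat) (c : C) (z : V * V).

Definition delta h z f : V -> C :=
  fun x => (h^-1)%:C * (rho (h *: z.1) (h *: z.2) f x - f x).

Lemma dotZl (b : R) x y : dot (b *: x) y = b * dot x y.
Proof. by rewrite /dot mulr_sumr; apply: eq_bigr => i _; rewrite !mxE mulrA. Qed.

Lemma dotZr (b : R) x y : dot x (b *: y) = b * dot x y.
Proof. by rewrite /dot mulr_sumr; apply: eq_bigr => i _; rewrite !mxE mulrCA. Qed.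

Lemma dot0l x : dot 0 x = 0.
Proof. by rewrite /dot big1// => i _; rewrite mxE mul0r. Qed.

Lemma dot0r x : dot x 0 = 0.
Proof. by rewrite /dot big1// => i _; rewrite mxE mulr0. Qed.

Lemma is_derive_ray v i (t : R) : is_derive t (1 : R) (fun r => (r *: v) i 0) (v i 0).
Proof.
rewrite (_ : (fun r => _) = (fun r => v i 0 * r)).
  by apply: is_derive_eq; rewrite /GRing.scale/=; ring.
by apply/funext => r; rewrite !mxE mulrC.
Qed.

Lemma shiftcZ (b : R) y eta a : shiftc (b *: y) (b *: eta) a = b%:C * shiftc y eta a.
Proof.
case: a => j /=; rewrite !mxE; first by rewrite rmorphM.
by rewrite mulrCA -rmorphM mulrA.
Qed.

Lemma rho00 f : rho 0 0 f = f.
Proof.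
apply/funext => x; rewrite /rho scaler0 subr0.
by rewrite /phase !dot0l mul0r oppr0 addr0 cos0 sin0 -[Complex 1 0]/(1 : C) mul1r.
Qed.

Lemma cabsR (b : R) : cabs b%:C = `|b|.
Proof. by rewrite /cabs/= normr0 addr0. Qed.

Lemma cabs_sum (I : Type) (r : seq I) (F : I -> C) :
  cabs (\sum_(i <- r) F i) <= \sum_(i <- r) cabs (F i).
Proof.
elim/big_rec2: _ => [|i y1 y2 _ H]; first by rewrite /cabs !creimE normr0 addr0.
by apply: le_trans (cabsD _ _) _; rewrite lerD2l.
Qed.

Lemma cabs_delta q K f h z x : 0 < h -> h <= 1 -> 0 <= q ->
  (forall a, cabs (shiftc z.1 z.2 a) <= q) ->
  Bnd 1 K f -> cabs (delta h z f x) <= 8 * n%:R * q * K.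
Proof.
move=> h0 h1 q0 hq fK; case: z hq => y eta /= hq; have K0 := Bnd_ge0 fK.
have df u : cdifferentiable f u by exact: Bnd_diff fK.
apply: le_trans (cabsM _ _) _; rewrite cabsR normfV (gtr0_norm h0) mulrC ler_pdivrMr//.
have D (t : R) := @cis_derive_rho _ _ _ hbar_gt0 (fun r => r *: y) (fun r => r *: eta) y eta
  (fun=> f) _ x t (fun i => is_derive_ray y i t) (fun i => is_derive_ray eta i t)
  (@cis_derive_translate _ _ f (fun r => r *: y) y x t df (fun i => is_derive_ray y i t)).
(* The constant: 2 for the phase, times a translation and a multiplication part of [n] terms each,
   every term at most [q * K]. [cis_derive_le] doubles it once more. *)
have := @cis_derive_le _ (fun r => rho (r *: y) (r *: eta) f x) _ (4 * n%:R * q * K) 0 h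
  (fun r _ => D r).
rewrite subr0 (gtr0_norm h0) !scale0r rho00.
rewrite (_ : 2 * (4 * n%:R * q * K) * h = 8 * n%:R * q * K * h); last by ring.
apply=> t _; apply: le_trans (cabsM _ _) _.
rewrite (_ : 4 * n%:R * q * K = 2 * (n%:R * q * K + n%:R * q * K)); last by ring.
apply: ler_pM; rewrite ?cabs_ge0 ?cabs_phase//.
apply: le_trans (cabsD _ _) (lerD _ _).
  rewrite cabsN; apply: le_trans (cabs_sum _ _) _.
  apply: (@le_trans _ _ (\sum_(i < n) q * K)); last first.
    by rewrite sumr_const card_ord -[_ *+ n]mulr_natl mulrA.
  apply: ler_sum => i _; apply: le_trans (cabsM _ _) _.
  apply: ler_pM; rewrite ?cabs_ge0//; first exact: (hq (inl i)).
  exact: Bnd_cabs (Bnd_gen (inr i) fK).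
rewrite dotZr dotZl subrr mul0r addr0.
set u := x - t *: y.
rewrite (_ : 'i * (dot eta u / hbar)%:C * f u = \sum_i ('i * (eta i 0 / hbar)%:C) * ((u i 0)%:C * f u)).
  apply: le_trans (cabs_sum _ _) _.
  apply: (@le_trans _ _ (\sum_(i < n) q * K)); last first.
    by rewrite sumr_const card_ord -[_ *+ n]mulr_natl mulrA.
  apply: ler_sum => i _; apply: le_trans (cabsM _ _) _.
  apply: ler_pM; rewrite ?cabs_ge0//; first exact: (hq (inr i)).
  exact: (Bnd_cabs u (Bnd_gen (inl i) fK)).
rewrite /dot mulr_suml rmorph_sum mulr_sumr mulr_suml; apply: eq_bigr => i _.
by rewrite !rmorphM/=; ring.
Qed.

(** The shift of the generator is proportional to [h], which cancels the [h^-1] of the quotient: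
    what remains is a translate of [f], not a second quotient. *)
Lemma gen_delta a h z f : h != 0 -> (forall x, cdifferentiable f x) -> 
  (forall x, cdifferentiable (gen a f) x) ->
  gen a (delta h z f) = fun x => delta h z (gen a f) x + shiftc z.1 z.2 a * rho (h *: z.1) (h *: z.2) f x.
Proof.
move=> h0 df dgf; have dr x : cdifferentiable (rho (h *: z.1) (h *: z.2) f) x by exact: cdiff_rho.
rewrite /delta (genZ a _ (f := fun x => rho (h *: z.1) (h *: z.2) f x - f x)); last first.
  by move=> x; apply: cdiffD => //; rewrite (_ : (fun y => _) = fun y => -1 * f y);
    [exact: cdiffZ|apply/funext => y; rewrite mulN1r].
rewrite (_ : (fun x => rho (h *: z.1) (h *: z.2) f x - f x) =
  (fun x => rho (h *: z.1) (h *: z.2) f x + -1 * f x)); last by apply/funext => x; rewrite mulN1r.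
rewrite genD//; last by move=> x; exact: cdiffZ.
rewrite (genZ a _ df) gen_rho// shiftcZ rhoD.
rewrite rhoZ.
apply/funext => x; have hh : (h^-1)%:C * h%:C = 1 by rewrite -rmorphM mulVf.
have E (A B S : C) : (h^-1)%:C * (A + h%:C * S + -1 * B) = (h^-1)%:C * (A - B) + S.
  transitivity ((h^-1)%:C * (A - B) + ((h^-1)%:C * h%:C) * S); first by ring.
  by rewrite hh mul1r.
by rewrite -[X in _ * (_ + X + _)]mulrA; exact: E.
Qed.

(** Like a derivative, the quotient costs one order, with a constant that is uniform in [h];
    [gen_delta] provides the induction. *)
Lemma Bnd_delta k q : 0 <= q -> exists2 M, 0 <= M & forall K f h z,
  0 < h -> h <= 1 -> (forall a, cabs (shiftc z.1 z.2 a) <= q) ->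
  Bnd k.+1 K f -> Bnd k (M * K) (delta h z f).
Proof.
move=> q0; have M0 : 0 <= 8 * n%:R * q by rewrite !mulr_ge0.
have cd K f h z : Bnd 1 K f -> forall x, cdifferentiable (delta h z f) x.
  move=> fK x; have df u : cdifferentiable f u by exact: Bnd_diff fK.
  apply: cdiffZ; rewrite (_ : (fun y => _) = fun y => rho (h *: z.1) (h *: z.2) f y + -1 * f y).
    by apply: cdiffD; [exact: cdiff_rho|exact: cdiffZ].
  by apply/funext => y; rewrite mulN1r.
elim: k => [|k [M Mge IH]].
  exists (8 * n%:R * q) => // K f h z h0 h1 hq fK; split=> // x; first exact: cd fK _.
  exact: cabs_delta.
exists (8 * n%:R * q + (M + 2 * (1 + q) ^+ k * q)).
  by rewrite !addr_ge0// !mulr_ge0// exprn_ge0//; lra.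
move=> K f h z h0 h1 hq fK; have K0 := Bnd_ge0 fK.
have p0 : 0 <= 2 * (1 + q) ^+ k * q * K by rewrite !mulr_ge0// exprn_ge0//; lra.
have fK1 : Bnd 1 K f by apply: Bnd_leq fK.
split=> [x|x|a]; first exact: cd fK1 _.
  apply: le_trans (cabs_delta x h0 h1 q0 hq fK1) _.
  by rewrite ler_wpM2r// lerDl addr_ge0// !mulr_ge0// exprn_ge0//; lra.
rewrite gen_delta ?gt_eqF//; last 2 first.
- by move=> x; exact: Bnd_diff fK.
- by move=> x; exact: Bnd_diff (Bnd_gen a fK).
have hq' a' : cabs (shiftc (h *: z.1) (h *: z.2) a') <= q.
  rewrite shiftcZ; apply: le_trans (cabsM _ _) _; rewrite cabsR gtr0_norm//.
  by apply: le_trans (hq a'); rewrite ler_piMl// cabs_ge0.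
have b1 := IH _ _ h z h0 h1 hq (Bnd_gen a fK).
have b2 := BndZ (shiftc z.1 z.2 a) (Bnd_rho hq' q0 (Bnd_leq (leq_trans (leqnSn _) (leqnSn _)) fK : Bnd k K f)).
apply: Bnd_le (BndD b1 b2).
have hs : cabs (shiftc z.1 z.2 a) * (2 * (1 + q) ^+ k * K) <= 2 * (1 + q) ^+ k * q * K.
  rewrite -[leRHS]mulrA [leRHS]mulrCA; apply: ler_wpM2r; last exact: hq.
  by rewrite !mulr_ge0// exprn_ge0//; lra.
have m0 : 0 <= 8 * n%:R * q * K by rewrite mulr_ge0.
rewrite [leRHS]mulrDl [X in _ <= _ + X]mulrDl.
by move: (M * K) (8 * n%:R * q * K) (2 * (1 + q) ^+ k * q * K) hs m0 => A B D; lra.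
Qed.

End DifferenceQuotients.

Section IteratedIntegralConst.
Variables (R : realType) (n : nat).

Lemma iint_const (l : seq 'I_n) (f : 'cV[R]_n -> R) (x y : 'cV[R]_n) :
  (forall j, j \notin l -> x j 0 = y j 0) -> iint l f x = iint l f y.
Proof.
elim: l x y => [|j l IH] x y xy /=; first by congr f; apply/colP => i; exact: xy.
congr int1; apply/funext => s; apply: IH => i il; rewrite !updE; case: eqP => // /eqP ij.
by apply: xy; rewrite inE negb_or ij.
Qed.

End IteratedIntegralConst.

(** * From square-integral bounds to pointwise bounds *)

Section Sobolev.
Variables (R : realType) (n : nat).
Local Notation C := R[i].
Notation V := 'cV[R]_n.
Local Notation re := (@complex.Re R).
Local Notation im := (@complex.Im R).
Implicit Types (f g : V -> C) (x y : V) (j : 'I_n) (l : seq 'I_n) (a : 'I_n + 'I_n) (A B K L : R) (k : nat) (c : C).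

Definition schw f := forall k, exists K, Bnd k K f.

Lemma schw_diff f x : schw f -> cdifferentiable f x.
Proof. by move=> /(_ 0%N)[K fK]; exact: Bnd_diff fK. Qed.

Lemma schw_gen a f : schw f -> schw (gen a f).
Proof. by move=> fS k; have [K fK] := fS k.+1; exists K; exact: Bnd_gen. Qed.

Lemma schwD f g : schw f -> schw g -> schw (fun x => f x + g x).
Proof.
by move=> fS gS k; have [K fK] := fS k; have [L gL] := gS k; exists (K + L); exact: BndD.
Qed.

Lemma schwZ c f : schw f -> schw (fun x => c * f x).
Proof. by move=> fS k; have [K fK] := fS k; exists (cabs c * K); exact: BndZ. Qed.

(** Multiplication by [1 + x j 0 ^+ 2], the inverse of the Cauchy weight, written with generators so
    that its cost in orders is visible. *)
Definition bump j f : V -> C := fun x => f x + gen (inl j) (gen (inl j) f) x.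

Lemma bumpE j f x : f x = (cauchy_weight (x j 0))%:C * bump j f x.
Proof.
rewrite /bump/= (_ : f x + _ = (1 + x j 0 ^+ 2)%:C * f x).
  rewrite mulrA -rmorphM mulVf ?rmorph1 ?mul1r// gt_eqF// ltr_wpDr ?sqr_ge0//.
by rewrite rmorphD rmorph1 rmorphXn/=; ring.
Qed.

Lemma Bnd_bump k K j f : Bnd k.+2 K f -> Bnd k (2 * K) (bump j f).
Proof.
move=> fK; rewrite (_ : 2 * K = K + K); last by ring.
apply: BndD; first exact: Bnd_leq (leq_trans (leqnSn _) (leqnSn _)) fK.
exact: Bnd_gen (Bnd_gen (inl j) fK).
Qed.

Lemma Bnd_weight l K f x : Bnd (size l).*2 K f ->
  cabs (f x) <= 2 ^+ size l * K * weight l x.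
Proof.
elim: l K f => [|j l IH] K f fK; first by rewrite expr0 mul1r /weight big_nil mulr1; exact: Bnd_cabs fK.
rewrite (bumpE j f x); apply: le_trans (cabsM _ _) _.
have := IH _ _ (Bnd_bump j fK).
rewrite /weight big_cons exprS => H.
rewrite {1}/cabs/= normr0 addr0 (gtr0_norm (cauchy_weight_gt0 _)).
apply: le_trans (ler_wpM2l (cauchy_weight_ge0 _) H) _.
by rewrite le_eqVlt; apply/orP; left; apply/eqP; ring.
Qed.

Local Notation W := (weight (enum 'I_n)).
Local Notation cn := (2 ^+ size (enum 'I_n) : R).

Lemma continuous_re f : (forall x, cdifferentiable f x) -> continuous (fun x => re (f x)).
Proof. by move=> df x; have [d _] := df x; exact: differentiable_continuous d. Qed.

Lemma continuous_im f : (forall x, cdifferentiable f x) -> continuous (fun x => im (f x)).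
Proof. by move=> df x; have [_ d] := df x; exact: differentiable_continuous d. Qed.

Lemma continuous_sqn f : (forall x, cdifferentiable f x) -> continuous (fun x => sqn (f x)).
Proof.
by move=> df; apply: continuous_add; apply: continuous_mul;
  try exact: continuous_re; exact: continuous_im.
Qed.

Lemma dom_re K f : Bnd (size (enum 'I_n)).*2 K f -> domV (cn * K) (fun x => re (f x)).
Proof.
move=> fK; split; first by apply: continuous_re => x; exact: Bnd_diff fK.
by move=> x; apply: le_trans (cabs_le_re _) (Bnd_weight x fK).
Qed.

Lemma dom_im K f : Bnd (size (enum 'I_n)).*2 K f -> domV (cn * K) (fun x => im (f x)).
Proof.
move=> fK; split; first by apply: continuous_im => x; exact: Bnd_diff fK.
by move=> x; apply: le_trans (cabs_le_im _) (Bnd_weight x fK).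
Qed.

Lemma dom_sqn K f : Bnd (size (enum 'I_n)).*2 K f ->
  domV (cn * K * K) (fun x => sqn (f x)).
Proof.
move=> fK; split; first by apply: continuous_sqn => x; exact: Bnd_diff fK.
move=> x; rewrite ger0_norm ?sqn_ge0//; apply: le_trans (sqn_le_cabs _) _.
rewrite mulrAC expr2; apply: ler_pM; rewrite ?cabs_ge0//; first exact: Bnd_weight.
exact: Bnd_cabs fK.
Qed.

Definition N2 f : R := intV (fun x => sqn (f x)).

Lemma N2D f g : schw f -> schw g -> N2 (fun x => f x + g x) <= 2 * N2 f + 2 * N2 g.
Proof.
move=> fS gS; have [K fK] := fS (size (enum 'I_n)).*2; have [L gL] := gS (size (enum 'I_n)).*2.
have df := dom_sqn fK; have dg := dom_sqn gL.
rewrite /N2 -(intVZ _ df) -(intVZ _ dg) -(intVD (domZ 2 df) (domZ 2 dg)).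
apply: (le_intV (dom_sqn (BndD fK gL)) (domD (domZ 2 df) (domZ 2 dg))) => x.
rewrite /sqn !creimE.
by have := sqr_ge0 (re (f x) - re (g x)); have := sqr_ge0 (im (f x) - im (g x)); nra.
Qed.

(** The counterpart of [Bnd] for squared L2 norms, which are what conservation controls; [EB_Bnd]
    converts one into the other. *)
Fixpoint EB k B f : Prop :=
  N2 f <= B /\ if k is k'.+1 then forall a, EB k' B (gen a f) else True.

Lemma EB_N2 k B f : EB k B f -> N2 f <= B.
Proof. by case: k => [|k] []. Qed.

Lemma EB_gen k B a f : EB k.+1 B f -> EB k B (gen a f).
Proof. by case=> _; apply. Qed.

Lemma EB_leq k m B f : (m <= k)%N -> EB k B f -> EB m B f.
Proof.
elim: m k f => [|m IH] k f; first by move=> _ fB; split=> //; exact: EB_N2 fB.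
case: k => // k mk [fB H]; split=> // a; exact: IH (H a).
Qed.

Lemma EBD k A B f g : schw f -> schw g -> EB k A f -> EB k B g ->
  EB k (2 * A + 2 * B) (fun x => f x + g x).
Proof.
elim: k f g => [|k IH] f g fS gS fA gB.
  split=> //; apply: le_trans (N2D fS gS) _.
  by apply: lerD; rewrite ler_wpM2l//; [exact: EB_N2 fA|exact: EB_N2 gB].
split=> [|a].
  apply: le_trans (N2D fS gS) _.
  by apply: lerD; rewrite ler_wpM2l//; [exact: EB_N2 fA|exact: EB_N2 gB].
rewrite genD; [|by move=> x; exact: schw_diff|by move=> x; exact: schw_diff].
by apply: IH; [exact: schw_gen|exact: schw_gen|exact: EB_gen|exact: EB_gen].
Qed.

(** [g] is [f] multiplied by [1 + x j 0 ^+ 2] for each [j] in [l]: two orders and a factor 4 per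
    coordinate buy one factor of the weight. *)
Lemma EB_weight l B f : schw f -> EB (size l).*2 B f ->
  exists g, [/\ schw g, N2 g <= 4 ^+ size l * B & forall x, f x = (weight l x)%:C * g x].
Proof.
elim: l B f => [|j l IH] B f fS fB.
  exists f; split=> // [|x]; first by rewrite expr0 mul1r; exact: EB_N2 fB.
  by rewrite /weight big_nil mul1r.
have bS : schw (bump j f) by apply: schwD => //; do 2! apply: schw_gen.
have bB : EB (size l).*2 (4 * B) (bump j f).
  rewrite (_ : 4 * B = 2 * B + 2 * B); last by ring.
  apply: EBD => //; first by do 2! apply: schw_gen.
    exact: EB_leq (leq_trans (leqnSn _) (leqnSn _)) fB.
  exact: EB_gen (EB_gen (inl j) fB).
have [g [gS gB gE]] := IH _ _ bS bB.
exists g; split=> // [|x]; first by rewrite /= exprSr -mulrA.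
by rewrite (bumpE j f x) gE mulrA -rmorphM /weight big_cons.
Qed.

Lemma EB_cpartials l k B f : schw f -> EB (size l + k) B f ->
  schw (foldl (fun g j => cpartial j g) f l) /\
  EB k B (foldl (fun g j => cpartial j g) f l).
Proof.
elim: l f => [|j l IH] f fS fB //=.
by apply: IH; [exact: (schw_gen (inr j))|exact: (EB_gen (inr j) fB)].
Qed.

Let part (b : bool) (c : C) : R := if b then re c else im c.

(** By [le_iint_pd] a value of [f] is at most the integral of its full mixed derivative, which is
    the weight times some [h] with bounded [N2]. The inequality [c <= 1/2 + c^2 / 2] then replaces
    Cauchy-Schwarz for this integral. Orders: one derivative and two weights per coordinate, hence
    [3 n]. *)
Let sobolev_part b B f : schw f -> EB (3 * size (enum 'I_n))%N B f ->
  forall x, `|part b (f x)| <= intV W / 2 + 4 ^+ size (enum 'I_n) * B.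
Proof.
move=> fS fB x; set l := enum 'I_n in fB *.
have [gS gB] : schw (foldl (fun g j => cpartial j g) f l) /\
    EB (size l).*2 B (foldl (fun g j => cpartial j g) f l).
  by apply: EB_cpartials => //; rewrite -mul2n -mulSn.
set g := foldl _ f l in gS gB.
have [h [hS hB gE]] := EB_weight gS gB.
pose S (p : V -> R) := exists f, schw f /\ p = (fun x => part b (f x)).
have domp f' K : Bnd (size (enum 'I_n)).*2 K f' -> domV (cn * K) (fun x => part b (f' x)).
  by case: b {S}; [exact: dom_re|exact: dom_im].
have domS p : S p -> exists K, domV K p.
  move=> [f' [f'S ->]]; have [K f'K] := f'S (size (enum 'I_n)).*2.
  by exists (cn * K); exact: domp.
pose d j (p : V -> R) : V -> R := fun x => 'D_(delta_mx j 0) p x.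
have dpart j f' : d j (fun x => part b (f' x)) = fun x => part b (cpartial j f' x).
  by rewrite /d /part; case: b {S domp domS}.
have dS j p : S p -> S (d j p) /\ pd j p (d j p).
  move=> [f' [f'S ->]]; split; first by exists (cpartial j f'); split=> //; exact: (schw_gen (inr j)).
  apply: pd_derive => y; have [d1 d2] := schw_diff y f'S.
  by rewrite /part; case: b {S domp domS dpart}.
have H := @le_iint_pd R n S d domS dS l (fun x => part b (f x)) x (enum_uniq _) (ex_intro _ f (conj fS erefl)).
have E r f' : foldl (fun q j => d j q) (fun x => part b (f' x)) r =
    fun x => part b (foldl (fun g j => cpartial j g) f' r x).
  by elim: r f' => //= j r IH f'; rewrite dpart IH.
rewrite E -/g (@iint_const _ _ l _ x 0) in H; last by move=> j; rewrite mem_enum.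
apply: le_trans H _.
have [K gK] := gS (size (enum 'I_n)).*2; have [L hL] := hS (size (enum 'I_n)).*2.
have dW := domZ (2^-1) (domV_weight R n); have dh := dom_sqn hL.
apply: (@le_trans _ _ (2^-1 * intV W + N2 h)); last first.
  by rewrite [_^-1 * _]mulrC lerD2l.
rewrite -(intVZ _ (domV_weight R n)) -(intVD dW dh).
apply: (le_intV (dom_norm (domp _ _ gK)) (domD dW dh)) => y.
have W0 := weight_gt0 l y; have W1 := weight_le1 l y.
have s0 := sqn_ge0 (h y).
have : `|part b (g y)| <= cabs (g y).
  by rewrite /part; case: (b); [exact: cabs_le_re|exact: cabs_le_im].
rewrite gE => /le_trans; apply; apply: le_trans (cabsM _ _) _.
rewrite {1}/cabs/= normr0 addr0 (gtr0_norm W0).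
have := cabs_le_sqn (h y); have := sqr_ge0 (cabs (h y) - 1).
move: (weight l y) (sqn (h y)) (cabs (h y)) W0 W1 s0 => w s c w0 w1 s0 h1 h2.
have h3 : c <= 2^-1 + s by nra.
by nra.
Qed.

Lemma sobolev B f : schw f -> EB (3 * size (enum 'I_n))%N B f ->
  forall x, cabs (f x) <= intV W + 2 * (4 ^+ size (enum 'I_n) * B).
Proof.
move=> fS fB x; have := sobolev_part true fS fB x.
have := sobolev_part false fS fB x; rewrite /= /cabs; lra.
Qed.

Lemma EB_Bnd k B f : schw f -> EB (k + 3 * size (enum 'I_n))%N B f ->
  Bnd k (intV W + 2 * (4 ^+ size (enum 'I_n) * B)) f.
Proof.
elim: k f => [|k IH] f fS fB; split=> //; try by move=> x; exact: schw_diff.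
- exact: sobolev.
- by apply: sobolev => //; apply: EB_leq fB; rewrite leq_addl.
- by move=> a; apply: IH; [exact: schw_gen|exact: EB_gen].
Qed.

End Sobolev.

(** * Schwartz functions have bounded words *)

Section SchwartzSpace.
Variables (R : realType) (n : nat).
Local Notation C := R[i].
Notation V := 'cV[R]_n.
Implicit Types (f g : V -> C) (x y : V) (j : 'I_n) (s : seq 'I_n) (K : R).

Let mono (a : 'I_n -> nat) x : R := \prod_(i < n) x i 0 ^+ a i.

Let mono0 x : (mono (fun=> 0%N) x)%:C = 1.
Proof. by rewrite /mono big1 ?rmorph1// => i _; rewrite expr0. Qed.

Let rapid f := (forall s x, cdifferentiable (cpartials s f) x) /\
  (forall a s, exists K, forall x, cabs ((mono a x)%:C * cpartials s f x) <= K).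

Let schwartz_rapid f : schwartz f -> rapid f.
Proof.
move=> [df bf]; split=> // a s; have [K HK] := bf a s; exists (2 * K) => x.
have := sqn_normr (HK x); set z := (_ * _) => h.
have K0 : 0 <= K.
  have : 0 <= `|z| by []; rewrite /z => /le_trans /(_ (HK x)).
  by rewrite -[0 in X in X -> _]/(0%:C) lecR.
have := cabs_le_sqn z; have := cabs_ge0 z => c0 c1.
by rewrite -ler_sqr ?nnegrE ?mulr_ge0//; nra.
Qed.

Let rapid_partial j f : rapid f -> rapid (cpartial j f).
Proof.
move=> [df bf].
have E s : cpartials s (cpartial j f) = cpartials (rcons s j) f by rewrite /cpartials foldr_rcons.
by split=> [s x|a s]; rewrite E.
Qed.

(** The words left after deleting one occurrence of [j], with multiplicity: the correction terms of
    the Leibniz rule in [cpartials_coord]. *)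
Fixpoint rems j s : seq (seq 'I_n) :=
  if s is k :: s' then (if j == k then [:: s'] else [::]) ++ map (cons k) (rems j s')
  else [::].

Let cpartials_coord j f s : (forall s x, cdifferentiable (cpartials s f) x) ->
  cpartials s (fun x => (x j 0)%:C * f x) =
  fun x => (x j 0)%:C * cpartials s f x + \sum_(r <- rems j s) cpartials r f x.
Proof.
move=> df; elim: s => [|k s IH] /=; first by apply/funext => x; rewrite big_nil addr0.
apply/funext => x; rewrite IH.
have dS r y : cdifferentiable (fun x => \sum_(q <- r) cpartials q f x) y.
  elim: r => [|q r IHr].
    by rewrite (_ : (fun x => _) = fun=> 0);
      [exact: cdiff_cst|apply/funext => z; rewrite big_nil].
  rewrite (_ : (fun x => _) = fun x => cpartials q f x + \sum_(q <- r) cpartials q f x).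
    exact: cdiffD.
  by apply/funext => z; rewrite big_cons.
rewrite cpartialD//; last by apply: cdiffM => //; exact: cdiff_coord.
rewrite cpartialM//; last exact: cdiff_coord.
rewrite cpartial_coord big_cat big_map.
have -> : cpartial k (fun x => \sum_(q <- rems j s) cpartials q f x) x =
          \sum_(q <- rems j s) cpartials (k :: q) f x.
  elim: (rems j s) => [|q r IHr].
    rewrite big_nil (_ : (fun x => _) = fun=> 0); first by rewrite cpartial_cst.
    by apply/funext => z; rewrite big_nil.
  rewrite (_ : (fun x => _) = fun x => cpartials q f x + \sum_(q <- r) cpartials q f x).
    by rewrite cpartialD// IHr big_cons.
  by apply/funext => z; rewrite big_cons.
rewrite addrA; congr (_ + _); rewrite addrC; congr (_ + _).
by case: eqP => _; rewrite ?big_seq1 ?big_nil ?mul1r ?mul0r.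
Qed.

Let rapid_coord j f : rapid f -> rapid (fun x => (x j 0)%:C * f x).
Proof.
move=> [df bf].
have dS r y : cdifferentiable (fun x => \sum_(q <- r) cpartials q f x) y.
  elim: r => [|q r IHr].
    by rewrite (_ : (fun x => _) = fun=> 0);
      [exact: cdiff_cst|apply/funext => z; rewrite big_nil].
  rewrite (_ : (fun x => _) = fun x => cpartials q f x + \sum_(q <- r) cpartials q f x).
    exact: cdiffD.
  by apply/funext => z; rewrite big_cons.
split=> [s x|a s]; rewrite cpartials_coord//.
  by apply: cdiffD => //; apply: cdiffM => //; exact: cdiff_coord.
have [K HK] := bf (fun i => a i + (i == j))%N s.
have [L HL] : exists L, forall x, cabs ((mono a x)%:C * \sum_(q <- rems j s) cpartials q f x) <= L.
  elim: (rems j s) => [|q r [L HL]].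
    by exists 0 => x; rewrite big_nil mulr0 /cabs !creimE normr0 addr0.
  have [M HM] := bf a q; exists (M + L) => x; rewrite big_cons mulrDr.
  exact: le_trans (cabsD _ _) (lerD (HM x) (HL x)).
exists (K + L) => x; rewrite mulrDr; apply: le_trans (cabsD _ _) (lerD _ (HL x)).
apply: le_trans (HK x); rewrite mulrA -rmorphM (_ : mono a x * x j 0 = mono (fun i => a i + (i == j))%N x)//.
rewrite /mono (bigD1 j)//= [in RHS](bigD1 j)//= eqxx addn1 exprSr mulrAC; congr (_ * _).
by apply: eq_bigr => i /negbTE ->; rewrite addn0.
Qed.

(** The definition of [schwartz] has all coordinates outside and all derivatives inside, whereas
    [Bnd] mixes them. Stability of the class under each generator bridges the gap. *)
Lemma schwartz_schw f : schwartz f -> schw f.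
Proof.
move=> /schwartz_rapid fR k; elim: k f fR => [|k IH] f fR.
  have [K HK] := fR.2 (fun=> 0%N) [::]; exists K; split=> // x; first exact: (fR.1 [::]).
  by have := HK x; rewrite mono0 mul1r.
have gR a : rapid (gen a f) by case: a => j; [exact: rapid_coord|exact: rapid_partial].
have /choice[L HL] := fun a => IH _ (gR a).
have [K HK] := fR.2 (fun=> 0%N) [::].
have L0 a : 0 <= L a := Bnd_ge0 (HL a).
have K0 : 0 <= K by exact: le_trans (cabs_ge0 _) (HK 0).
exists (K + \sum_a L a); split=> [x|x|a]; first exact: (fR.1 [::]).
  have := HK x; rewrite mono0 mul1r.
  by move=> /le_trans; apply; rewrite lerDl sumr_ge0.
by apply: Bnd_le (HL a); rewrite (bigD1 a)//= addrCA lerDl addr_ge0// sumr_ge0.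
Qed.

End SchwartzSpace.

(** * Quadratic Hamiltonians and conservation of the norm *)

Section MatrixExponential.
Variable R : realType.

Lemma cvg_mx_entries (m n : nat) (u : nat -> 'M[R]_(m, n)) (l : 'M[R]_(m, n)) :
  (forall i j, u k i j @[k --> \oo] --> l i j) -> u k @[k --> \oo] --> l.
Proof.
move=> ul; apply/cvg_ballP => e e0.
have : \forall k \near \oo, forall ij : 'I_m * 'I_n, ball (l ij.1 ij.2) e (u k ij.1 ij.2).
  apply: filter_forall => -[i j]; exact: (cvg_ball (ul i j)).
by apply: filterS => k H; split=> // i j; exact: (H (i, j)).
Qed.

Lemma cvg_sum_seq (I : Type) (r : seq I) (u : I -> nat -> R) (l : I -> R) :
  (forall i, u i k @[k --> \oo] --> l i) ->
  \sum_(i <- r) u i k @[k --> \oo] --> \sum_(i <- r) l i.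
Proof.
move=> ul; elim: r => [|i r IH].
  by rewrite (_ : (fun k => _) = fun=> 0) ?big_nil; [exact: cvg_cst|apply/funext => k; rewrite big_nil].
rewrite big_cons (_ : (fun k => _) = fun k => u i k + \sum_(j <- r) u j k).
  exact: cvgD.
by apply/funext => k; rewrite big_cons.
Qed.

Lemma is_cvg_pseries_exp (c : nat -> R) (M b K : R) : 0 <= M ->
  (forall k, `|c k| <= M * (b ^+ k / k`!%:R)) -> 0 <= b -> cvgn (pseries c K).
Proof.
move=> M0 cb b0; apply: normed_cvg.
apply: (@series_le_cvg _ _ (fun k => M * exp_coeff (b * `|K|) k)) => [k|k|k|] //=.
- by rewrite mulr_ge0// exp_coeff_ge0// mulr_ge0.
- rewrite normrM normrX /exp_coeff/= exprMn mulrAC mulrA.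
  by rewrite ler_wpM2r ?exprn_ge0// -mulrA; exact: cb.
- rewrite (_ : (fun k => _) = M *: exp_coeff (b * `|K|))//.
  by apply: is_cvg_seriesZ; exact: is_cvg_series_exp_coeff.
Qed.

Section Flow.
Variables (m : nat) (X : 'M[R]_m).
Implicit Types (i j : 'I_m) (k : nat) (t : R).

Let b : R := \sum_i \sum_j `|X i j|.

Let b_ge0 : 0 <= b.
Proof. by apply: sumr_ge0 => i _; apply: sumr_ge0. Qed.

Let rowsum_le k i : \sum_j `|(X ^+ k) i j| <= b ^+ k.
Proof.
elim: k i => [|k IH] i.
  rewrite !expr0 (bigD1 i)//= big1 => [|j ij]; first by rewrite mxE eqxx normr1 addr0.
  by rewrite mxE eq_sym (negbTE ij) normr0.
rewrite exprS exprS.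
apply: (@le_trans _ _ (\sum_j \sum_l `|X i l| * `|(X ^+ k) l j|)).
  apply: ler_sum => j _; rewrite mxE; apply: le_trans (ler_norm_sum _ _ _) _.
  by apply: ler_sum => l _; rewrite normrM.
rewrite exchange_big /=.
apply: (@le_trans _ _ (\sum_l `|X i l| * b ^+ k)).
  by apply: ler_sum => l _; rewrite -mulr_sumr ler_wpM2l.
rewrite -mulr_suml ler_wpM2r ?exprn_ge0// /b [leRHS](bigD1 i)//= lerDl.
by apply: sumr_ge0 => l _; apply: sumr_ge0.
Qed.

Let coef i j k : R := (X ^+ k) i j / k`!%:R.

Let coef_le i j k l : `|(X ^+ (k + l)) i j / k`!%:R| <= b ^+ l * (b ^+ k / k`!%:R).
Proof.
rewrite normrM normfV (ger0_norm (ler0n R _)) mulrA ler_wpM2r ?invr_ge0// -exprD addnC.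
apply: le_trans (rowsum_le _ i); rewrite (bigD1 j)//= lerDl.
exact: sumr_ge0.
Qed.

Let diffs_coef i j : pseries_diffs (coef i j) = fun k => (X ^+ (k + 1)) i j / k`!%:R.
Proof.
apply/funext => k; rewrite /pseries_diffs /coef addn1 factS natrM invfM.
by rewrite mulrCA mulVKf.
Qed.

Let diffs2_coef i j : pseries_diffs (pseries_diffs (coef i j)) = fun k => (X ^+ (k + 2)) i j / k`!%:R.
Proof.
rewrite diffs_coef; apply/funext => k; rewrite /pseries_diffs addn1 -addn2 factS natrM invfM.
by rewrite mulrCA mulVKf.
Qed.

Let cvg_coef i j l K : cvgn (pseries (fun k => (X ^+ (k + l)) i j / k`!%:R) K).
Proof.
by apply: (@is_cvg_pseries_exp _ (b ^+ l) b) => //; rewrite exprn_ge0.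
Qed.

Let coef0 i j : coef i j = fun k => (X ^+ (k + 0)) i j / k`!%:R.
Proof. by apply/funext => k; rewrite addn0. Qed.

Let expr_scalemx t k : (t *: X) ^+ k = t ^+ k *: X ^+ k.
Proof.
elim: k => [|k IH]; first by rewrite !expr0 scale1r.
rewrite !exprS IH -[LHS]/((t *: X) *m (t ^+ k *: X ^+ k)).
by rewrite -scalemxAl -scalemxAr scalerA.
Qed.

(** Each entry is a scalar power series in [t], so termwise differentiation of such series yields
    the equation of the flow. *)
Lemma expmx_entry t i j : expmx (t *: X) i j = limn (pseries (coef i j) t).
Proof.
have H : series (fun k => k`!%:R^-1 *: (t *: X) ^+ k) N @[N --> \oo] -->
    (\matrix_(i, j) limn (pseries (coef i j) t) : 'M[R]_m).
  apply: cvg_mx_entries => i' j'; rewrite mxE.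
  rewrite (_ : (fun N => _) = pseries (coef i' j') t).
    by rewrite coef0; exact: cvg_coef.
  apply/funext => N; rewrite /pseries /series/= summxE; apply: eq_bigr => k _.
  by rewrite expr_scalemx !mxE /coef; ring.
by rewrite /expmx (cvg_lim _ H)// mxE.
Qed.

Lemma expmx0 : expmx (0 *: X) = 1.
Proof.
apply/matrixP => i j; rewrite expmx_entry.
(* At time 0 the partial sums are constant from the first term on, hence the shift by one. *)
apply: cvg_lim => //; rewrite -(cvg_shiftS _)/=.
rewrite (_ : (fun N => _) = fun=> (1 : 'M[R]_m) i j); first exact: cvg_cst.
apply/funext => N; rewrite /pseries/series/= big_nat_recl//= big1 => [|k _].
  by rewrite /coef expr0 expr0 fact0 divr1 mulr1 addr0.
by rewrite expr0n mulr0.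
Qed.

Lemma is_derive_expmx t i j :
  is_derive t (1 : R) (fun r => expmx (r *: X) i j) ((X *m expmx (t *: X)) i j).
Proof.
rewrite (_ : (fun r => _) = fun r => limn (pseries (coef i j) r)); last first.
  by apply/funext => r; exact: expmx_entry.
have -> : (X *m expmx (t *: X)) i j = limn (pseries (pseries_diffs (coef i j)) t).
  apply/esym/cvg_lim => //; rewrite mxE.
  rewrite (_ : pseries _ _ = fun N => \sum_l X i l * pseries (coef l j) t N).
    apply: (@cvg_sum_seq _ _ (fun l N => X i l * pseries (coef l j) t N)).
    move=> l; apply: cvgM; first exact: cvg_cst.
    by rewrite expmx_entry coef0; exact: cvg_coef.
  apply/funext => N; rewrite diffs_coef /pseries/series/=.
  under [RHS]eq_bigr do rewrite mulr_sumr.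
  rewrite [RHS]exchange_big/=; apply: eq_bigr => k _.
  rewrite addn1 exprS mxE mulr_suml mulr_suml; apply: eq_bigr => l _.
  by rewrite /coef; ring.
apply: (@pseries_snd_diffs _ _ (`|t| + 1)).
- by rewrite coef0; exact: cvg_coef.
- by rewrite diffs_coef; exact: cvg_coef.
- by rewrite diffs2_coef; exact: cvg_coef.
- by rewrite [ltRHS]ger0_norm ?ltrDl// addr_ge0.
Qed.

Lemma expmx_bounded : exists M, forall t i j, `|t| <= 1 -> `|expmx (t *: X) i j| <= M.
Proof.
exists (expR b) => t i j t1; rewrite expmx_entry.
have cv : cvgn (pseries (coef i j) t) by rewrite coef0; exact: cvg_coef.
have H : `|pseries (coef i j) t N| @[N --> \oo] --> `|limn (pseries (coef i j) t)|.
  by apply: cvg_norm.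
rewrite -(cvg_lim _ H)//; apply: limr_le; first by apply/cvg_ex; eexists; exact: H.
apply: nearW => N; rewrite /pseries/series/=; apply: le_trans (ler_norm_sum _ _ _) _.
apply: (@le_trans _ _ (series (exp_coeff b) N)).
  apply: ler_sum => k _; rewrite normrM normrX /exp_coeff/=.
  have := coef_le i j k 0; rewrite addn0 expr0 mul1r => h.
  apply: le_trans h; rewrite ler_piMr//; exact: exprn_ile1.
apply: nondecreasing_cvgn_le; last exact: is_cvg_series_exp_coeff.
by apply: nondecreasing_series => k _ _; exact: exp_coeff_ge0.
Qed.

End Flow.
End MatrixExponential.

(** * Symmetry of the quantized Hamiltonian *)

Section QuadraticHamiltonian.
Variables (R : realType) (n : nat) (hbar : R).
Local Notation C := R[i].
Notation V := 'cV[R]_n.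
Local Notation re := (@complex.Re R).
Local Notation im := (@complex.Im R).
Implicit Types (f g v : V -> C) (x y : V) (j k : 'I_(n + n)) (K L : R) (m : nat) (c : C).
Local Notation cn := (2 ^+ size (enum 'I_n) : R).
Local Notation n2 := (size (enum 'I_n)).*2.

Definition zcoef j : C := if fintype.split j is inl _ then 1 else - ('i * hbar%:C).

Lemma zhatE j f : zhat hbar j f = fun x => zcoef j * gen (fintype.split j) f x.
Proof.
rewrite /zhat /zcoef; case: (fintype.split j) => k //=.
by apply/funext => x; rewrite mul1r.
Qed.

Lemma Bnd_cst0 m : Bnd m 0 (fun _ : V => 0 : C).
Proof.
elim: m => [|m IH]; split=> [x|x|] //; try exact: cdiff_cst.
- by rewrite /cabs !creimE normr0 addr0.
- by rewrite /cabs !creimE normr0 addr0.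
- case=> j /=; first by under eq_fun do rewrite mulr0.
  by rewrite (_ : cpartial j _ = fun=> 0)//; apply/funext => x; rewrite cpartial_cst.
Qed.

Lemma Bnd_sum (I : Type) (r : seq I) m (K : I -> R) (F : I -> V -> C) :
  (forall i, Bnd m (K i) (F i)) ->
  Bnd m (\sum_(i <- r) K i) (fun x => \sum_(i <- r) F i x).
Proof.
move=> H; elim: r => [|i r IH].
  rewrite big_nil (_ : (fun x => _) = fun=> 0); first exact: Bnd_cst0.
  by apply/funext => x; rewrite big_nil.
rewrite big_cons (_ : (fun x => _) = fun x => F i x + \sum_(j <- r) F j x).
  exact: BndD.
by apply/funext => x; rewrite big_cons.
Qed.

Lemma Bnd_zhat m K j f : Bnd m.+1 K f -> Bnd m (cabs (zcoef j) * K) (zhat hbar j f).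
Proof. by move=> fK; rewrite zhatE; apply: BndZ; exact: Bnd_gen. Qed.

(** [ip] and [ix] are the real and imaginary parts of [z] times the conjugate of [u], kept apart so
    that all integrals are real. *)
Definition ip (z u : C) : R := re z * re u + im z * im u.
Definition ix (z u : C) : R := im z * re u - re z * im u.

Lemma abs_ip z u : `|ip z u| <= cabs z * cabs u.
Proof.
rewrite /ip /cabs; apply: le_trans (ler_normD _ _) _; rewrite !normrM.
have := normr_ge0 (re z); have := normr_ge0 (im z); have := normr_ge0 (re u); have := normr_ge0 (im u).
by move: `|re z| `|im z| `|re u| `|im u| => a b c d; nra.
Qed.

Lemma abs_ix z u : `|ix z u| <= cabs z * cabs u.
Proof.
rewrite /ix /cabs; apply: le_trans (ler_normB _ _) _; rewrite !normrM.
have := normr_ge0 (re z); have := normr_ge0 (im z); have := normr_ge0 (re u); have := normr_ge0 (im u).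
by move: `|re z| `|im z| `|re u| `|im u| => a b c d; nra.
Qed.

Lemma dom_of_prod K L f g (h : V -> R) : Bnd n2 K f -> (forall x, cabs (g x) <= L) ->
  continuous h -> (forall x, `|h x| <= cabs (f x) * cabs (g x)) -> domV (cn * K * L) h.
Proof.
move=> fK gL ch hfg; split=> // x; apply: le_trans (hfg x) _.
rewrite mulrAC; apply: ler_pM; rewrite ?cabs_ge0//; exact: Bnd_weight.
Qed.

Lemma continuous_ip f g : (forall x, cdifferentiable f x) -> (forall x, cdifferentiable g x) ->
  continuous (fun x => ip (f x) (g x)).
Proof.
move=> df dg; apply: continuous_add; apply: continuous_mul;
 by [exact: continuous_re|exact: continuous_im].
Qed.

Lemma continuous_ix f g : (forall x, cdifferentiable f x) -> (forall x, cdifferentiable g x) ->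
  continuous (fun x => ix (f x) (g x)).
Proof.
move=> df dg; apply: continuous_sub; apply: continuous_mul;
 by [exact: continuous_re|exact: continuous_im].
Qed.

Lemma dom_ip m K L f g : Bnd n2 K f -> Bnd m L g -> domV (cn * K * L) (fun x => ip (f x) (g x)).
Proof.
move=> fK gL; apply: (dom_of_prod fK (fun x => Bnd_cabs x gL)).
  by apply: continuous_ip => x; [exact: Bnd_diff fK|exact: Bnd_diff gL].
by move=> x; exact: abs_ip.
Qed.

Lemma dom_ix m K L f g : Bnd n2 K f -> Bnd m L g -> domV (cn * K * L) (fun x => ix (f x) (g x)).
Proof.
move=> fK gL; apply: (dom_of_prod fK (fun x => Bnd_cabs x gL)).
  by apply: continuous_ix => x; [exact: Bnd_diff fK|exact: Bnd_diff gL].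
by move=> x; exact: abs_ix.
Qed.

Lemma intV_ip_parts (i : 'I_n) K L f g : Bnd n2.+1 K f -> Bnd n2.+1 L g ->
  intV (fun x => ip (cpartial i f x) (g x) + ip (f x) (cpartial i g x)) = 0.
Proof.
move=> fK gL.
have fK' : Bnd n2 K f by exact: Bnd_leq (leqnSn _) fK.
have d1 := dom_ip fK' gL.
have d2 := dom_ip (Bnd_gen (inr i) fK : Bnd n2 K (cpartial i f)) gL.
have d3 := dom_ip fK' (Bnd_gen (inr i) gL : Bnd n2 L (cpartial i g)).
have df x : cdifferentiable f x by exact: Bnd_diff fK.
have dg x : cdifferentiable g x by exact: Bnd_diff gL.
apply: (intV_pd d1 (domD d2 d3) (j := i)) => x s.
have [f1 f2] : pd i (fun x => re (f x)) (fun x => re (cpartial i f x)) /\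
    pd i (fun x => im (f x)) (fun x => im (cpartial i f x)).
  by split; apply: pd_derive => y; case: (df y).
have [g1 g2] : pd i (fun x => re (g x)) (fun x => re (cpartial i g x)) /\
    pd i (fun x => im (g x)) (fun x => im (cpartial i g x)).
  by split; apply: pd_derive => y; case: (dg y).
have := f1 x s; have := f2 x s; have := g1 x s; have := g2 x s => h1 h2 h3 h4.
by rewrite /ip; apply: is_derive_eq; rewrite /GRing.scale/=; ring.
Qed.

(** The imaginary part of the symmetry of the canonical operators. For the momenta it is integration
    by parts: the factor [i hbar] turns [ix] into [ip]. *)
Lemma intV_zhat_sym j K L f g : Bnd n2.+1 K f -> Bnd n2.+1 L g ->
  intV (fun x => ix (zhat hbar j f x) (g x)) = intV (fun x => ix (f x) (zhat hbar j g x)).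
Proof.
move=> fK gL; rewrite /zhat; case: (fintype.split j) => i.
  by congr intV; apply/funext => x; rewrite /ix !creimE; ring.
have fK' : Bnd n2 K f by exact: Bnd_leq (leqnSn _) fK.
have d2 := dom_ip (Bnd_gen (inr i) fK : Bnd n2 K (cpartial i f)) gL.
have d3 := dom_ip fK' (Bnd_gen (inr i) gL : Bnd n2 L (cpartial i g)).
have E := intV_ip_parts i fK gL.
have -> : (fun x => ix (- ('i * hbar%:C) * cpartial i f x) (g x)) =
    fun x => - hbar * ip (cpartial i f x) (g x).
  by apply/funext => x; rewrite /ix /ip !reM !imM !creimE; ring.
have -> : (fun x => ix (f x) (- ('i * hbar%:C) * cpartial i g x)) =
    fun x => hbar * ip (f x) (cpartial i g x).
  by apply/funext => x; rewrite /ix /ip !reM !imM !creimE; ring.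
rewrite (intVZ _ d2) (intVZ _ d3); move: E; rewrite (intVD d2 d3) => /eqP.
by rewrite addr_eq0 => /eqP ->; ring.
Qed.

Lemma intV_sum (I : Type) (r : seq I) (K : I -> R) (F : I -> V -> R) :
  (forall i, domV (K i) (F i)) ->
  domV (\sum_(i <- r) K i) (fun x => \sum_(i <- r) F i x) /\
  intV (fun x => \sum_(i <- r) F i x) = \sum_(i <- r) intV (F i).
Proof.
move=> H; elim: r => [|i r [IH1 IH2]].
  rewrite big_nil big_nil (_ : (fun x => _) = fun x => 0 * weight (enum 'I_n) x); last first.
    by apply/funext => x; rewrite big_nil mul0r.
  rewrite (intVZ 0 (domV_weight R n)) mul0r; split=> //.
  by have := domZ 0 (domV_weight R n); rewrite normr0 mul0r.
rewrite !big_cons (_ : (fun x => _) = fun x => F i x + \sum_(j <- r) F j x); last first.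
  by apply/funext => x; rewrite big_cons.
by rewrite (intVD (H i) IH1) IH2; split=> //; exact: domD (H i) IH1.
Qed.

Variable M : 'M[R]_(n + n).
Hypothesis Msym : M^T = M.

Definition Hop f x : C :=
  (2^-1)%:C * \sum_j \sum_k (M j k)%:C * zhat hbar j (zhat hbar k f) x.

Lemma Bnd_Hop : exists2 cH, 0 <= cH & forall m K f, Bnd m.+2 K f -> Bnd m (cH * K) (Hop f).
Proof.
exists (cabs (2^-1)%:C * \sum_j \sum_k (cabs (M j k)%:C * (cabs (zcoef j) * cabs (zcoef k)))).
  rewrite mulr_ge0 ?cabs_ge0//; apply: sumr_ge0 => j _; apply: sumr_ge0 => k _.
  by rewrite !mulr_ge0 ?cabs_ge0.
move=> m K f fK; rewrite -mulrA; apply: BndZ.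
rewrite mulr_suml; apply: Bnd_sum => j; rewrite mulr_suml; apply: Bnd_sum => k.
rewrite -mulrA; apply: BndZ; rewrite -mulrA.
by apply: Bnd_zhat; exact: Bnd_zhat.
Qed.

(** After moving the outer operator to the other side, the summand is antisymmetric in [j] and [k]
    while [M] is symmetric, so that the sum equals its own negative. *)
Lemma intV_ix_Hop K v : Bnd n2.+3 K v -> intV (fun x => ix (Hop v x) (v x)) = 0.
Proof.
move=> vK.
have v1 : Bnd n2.+1 K v by exact: Bnd_leq (leq_trans (leqnSn _) (leqnSn _)) vK.
have vz k : Bnd n2.+1 (cabs (zcoef k) * K) (zhat hbar k v).
  by apply: Bnd_leq (Bnd_zhat k vK).
have vzz j k : Bnd n2 (cabs (zcoef j) * (cabs (zcoef k) * K)) (zhat hbar j (zhat hbar k v)).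
  exact: Bnd_zhat.
have vz2 k : Bnd n2 (cabs (zcoef k) * K) (zhat hbar k v) by exact: Bnd_leq (leqnSn _) (vz k).
have dzz j k := dom_ix (vzz j k) v1.
have -> : (fun x => ix (Hop v x) (v x)) = fun x => 2^-1 *
    \sum_j \sum_k M j k * ix (zhat hbar j (zhat hbar k v) x) (v x).
  apply/funext => x; rewrite /Hop /ix reM imM !creimE re_sum im_sum mul0r mul0r subr0 addr0.
  rewrite -!mulrA -mulrBr !mulr_suml -sumrB; congr (_ * _); apply: eq_bigr => j _.
  rewrite re_sum im_sum !mulr_suml -sumrB; apply: eq_bigr => k _.
  by rewrite reM imM !creimE; ring.
have d1 j k := domZ (M j k) (dzz j k).
have d2 j := intV_sum (index_enum 'I_(n + n)) (d1 j).
have [d3 d4] := intV_sum (index_enum 'I_(n + n)) (fun j => (d2 j).1).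
rewrite (intVZ _ d3) d4.
have -> : \sum_j intV (fun x => \sum_k M j k * ix (zhat hbar j (zhat hbar k v) x) (v x)) =
    \sum_j \sum_k M j k * intV (fun x => ix (zhat hbar k v x) (zhat hbar j v x)).
  apply: eq_bigr => j _; rewrite (d2 j).2; apply: eq_bigr => k _.
  by rewrite (intVZ _ (dzz j k)) (intV_zhat_sym j (vz k) v1).
set S := (\sum_j _); suff /eqP : S = - S.
  by rewrite -addr_eq0 -mulr2n mulrn_eq0 /= => /eqP ->; rewrite mulr0.
rewrite {1}/S exchange_big /S -sumrN; apply: eq_bigr => j _; rewrite -sumrN.
apply: eq_bigr => k _; rewrite -[in LHS]Msym mxE -mulrN; congr (_ * _).
rewrite -mulN1r -(intVZ _ (dom_ix (vz2 k) (vz j))); congr intV; apply/funext => x.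
by rewrite /ix; ring.
Qed.

End QuadraticHamiltonian.

Section SequenceTools.
Variable R : realType.

Lemma is_derive_cvg_seq (f : R -> R) (x l : R) (h : nat -> R) :
  is_derive x (1 : R) f l -> (forall k, h k != 0) -> h k @[k --> \oo] --> 0 ->
  (h k)^-1 * (f (x + h k) - f x) @[k --> \oo] --> l.
Proof.
move=> [d1 d2] h0 hl.
have L : h^-1 *: (f (h *: (1:R) + x) - f x) @[h --> 0^'] --> l.
  by rewrite -d2; exact: d1.
have L2 : (h k)^-1 *: (f (h k *: (1:R) + x) - f x) @[k --> \oo] --> l.
  apply: (@cvg_comp _ _ _ h _ _ (0^') _ _ L).
  move=> A [d /= d0 dA]; move/cvgr0Pnorm_lt: hl => /(_ _ d0)[N _ HN].
  by exists N => // k /= /HN hk; apply: dA => //=; rewrite sub0r normrN.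
apply: cvg_trans L2; apply: near_eq_cvg; near=> k.
by rewrite [_ *: 1]mulr1 (addrC x).
Unshelve. all: end_near. Qed.

Lemma intV_cvg_near n (C : R) (F : nat -> 'cV[R]_n -> R) f :
  (\forall k \near \oo, domV C (F k)) -> domV C f ->
  (forall y, F k y @[k --> \oo] --> f y) ->
  intV (F k) @[k --> \oo] --> intV f.
Proof.
move=> [N _ HN] Cf Ff; rewrite -(cvg_shiftn N).
apply: (intV_cvg (C := C)) => // [k|y]; first by apply: HN => /=; exact: leq_addl.
by have := Ff y; rewrite -(cvg_shiftn N).
Qed.

Local Notation re := (@complex.Re R).
Local Notation im := (@complex.Im R).

Lemma cvg_re_im (z : nat -> R[i]) (l : R[i]) : cabs (z k - l) @[k --> \oo] --> (0 : R) ->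
  re (z k) @[k --> \oo] --> re l /\ im (z k) @[k --> \oo] --> im l.
Proof.
move=> /cvgr0Pnorm_le H; split; apply/cvgrPdist_le => e /H; apply: filterS => k.
  rewrite ger0_norm ?cabs_ge0// distrC -reN -reD; exact/le_trans/cabs_le_re.
rewrite ger0_norm ?cabs_ge0// distrC -imN -imD; exact/le_trans/cabs_le_im.
Qed.

Lemma cvg_sqn (z : nat -> R[i]) (l : R[i]) : cabs (z k - l) @[k --> \oo] --> (0 : R) ->
  sqn (z k) @[k --> \oo] --> sqn l.
Proof. by move=> /cvg_re_im[h1 h2]; apply: cvgD; apply: cvgM. Qed.

Lemma cis_derive_cvg (f : R -> R[i]) r d (rk : nat -> R) : cis_derive f r d ->
  rk k @[k --> \oo] --> r -> cabs (f (rk k) - f r) @[k --> \oo] --> (0 : R).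
Proof.
move=> [f1 f2] rkr.
have cvg1 (e : R -> R) d' : is_derive r (1 : R) e d' ->
    `|e (rk k) - e r| @[k --> \oo] --> (0 : R).
  move=> [ed _]; have ec : {for r, continuous e}.
    by apply: differentiable_continuous; apply/derivable1_diffP.
  rewrite -(normr0 R) -(subrr (e r)); apply: cvg_norm; apply: cvgB; last exact: cvg_cst.
  by apply: (@cvg_comp _ _ _ rk e _ (nbhs r) _ rkr); exact: ec.
rewrite /cabs -(addr0 0); apply: cvgD.
  by have := cvg1 _ _ f1; apply: cvg_trans; apply: near_eq_cvg; near=> k; rewrite !creimE.
by have := cvg1 _ _ f2; apply: cvg_trans; apply: near_eq_cvg; near=> k; rewrite !creimE.
Unshelve. all: end_near. Qed.

End SequenceTools.

(** * Conservation of the squared norm *)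

Section Conservation.
Variables (R : realType) (n : nat) (hbar : R) (M : 'M[R]_(n + n)).
Hypotheses (hbar_gt0 : 0 < hbar) (Msym : M^T = M).
Local Notation C := R[i].
Notation V := 'cV[R]_n.
Local Notation re := (@complex.Re R).
Local Notation im := (@complex.Im R).
Implicit Types (v : R -> V -> C) (x y : V) (s t r : R).
Local Notation cn := (2 ^+ size (enum 'I_n) : R).
Local Notation n2 := (size (enum 'I_n)).*2.
Local Notation W := (weight (enum 'I_n)).

Definition ci : C := - 'i * (hbar^-1)%:C.

(* The first clause, a bound uniform in time, is what allows differentiating the
   squared norm under the integral sign. *)
Definition gsol s t v :=
  [/\ exists K, forall r, s <= r <= t -> Bnd n2.+3 K (v r),
      forall x r, s < r < t ->
        cis_derive (fun r => v r x) r (ci * Hop hbar M (v r) x)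
    & forall x r (rk : nat -> R), s <= r <= t -> (forall k, s <= rk k <= t) ->
        rk k @[k --> \oo] --> r ->
        cabs (v (rk k) x - v r x) @[k --> \oo] --> (0 : R)].

Lemma Bnd_W K (f : V -> C) x : Bnd n2.+3 K f -> cabs (f x) <= cn * K * W x.
Proof.
move=> fK; apply: Bnd_weight; apply: Bnd_leq fK.
exact: leq_trans (leqnSn _) (leq_trans (leqnSn _) (leqnSn _)).
Qed.

Let leqn3 : (n2 <= n2.+3)%N := leq_trans (leqnSn _) (leq_trans (leqnSn _) (leqnSn _)).

Lemma N2_cvg s t v r (rk : nat -> R) : gsol s t v -> s <= r <= t ->
  (forall k, s <= rk k <= t) -> rk k @[k --> \oo] --> r ->
  N2 (v (rk k)) @[k --> \oo] --> N2 (v r).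
Proof.
move=> [[K vK] _ vc] hr hrk rkr.
apply: (@intV_cvg _ _ (cn * K * K) (fun k x => sqn (v (rk k) x))).
- by move=> k; apply: dom_sqn; apply: Bnd_leq leqn3 (vK _ (hrk k)).
- by apply: dom_sqn; apply: Bnd_leq leqn3 (vK _ hr).
- by move=> x; apply: cvg_sqn; exact: vc.
Qed.

Lemma is_derive_sqn (f : R -> C) r d : cis_derive f r d ->
  is_derive r (1 : R) (fun r => sqn (f r)) (2 * ip d (f r)).
Proof.
move=> [f1 f2]; rewrite /sqn.
rewrite (_ : (fun r => _) = fun r => re (f r) * re (f r) + im (f r) * im (f r)).
  by apply: is_derive_eq; rewrite /ip /GRing.scale/=; ring.
by apply/funext => q; rewrite !expr2.
Qed.

Lemma is_derive_N2 s t v r : gsol s t v -> s < r < t ->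
  is_derive r (1 : R) (fun r => N2 (v r)) 0.
Proof.
move=> [[K vK] vd vc] /andP[sr rt].
have K0 : 0 <= K by apply: (@Bnd_ge0 _ _ _ _ (v r)); apply: vK; lra.
have [cH cH0 HH] := Bnd_Hop hbar M.
pose L := cabs ci * (cH * K).
have L0 : 0 <= L by rewrite /L !mulr_ge0// cabs_ge0.
have HL q x : s <= q <= t -> cabs (ci * Hop hbar M (v q) x) <= L.
  move=> hq; apply: le_trans (cabsM _ _) _; rewrite ler_wpM2l ?cabs_ge0//.
  by apply: (Bnd_cabs x (HH 0%N _ _ (Bnd_leq _ (vK _ hq)))).
apply: is_derive_seq => h h0 _ hl.
pose G k x := (h k)^-1 * (sqn (v (r + h k) x) - sqn (v r x)).
pose g x := 2 * ip (ci * Hop hbar M (v r) x) (v r x).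
have hr : s <= r <= t by rewrite !ltW.
have near_in : \forall k \near \oo, s < r + h k < t.
  pose d := Num.min (r - s) (t - r).
  have d0 : 0 < d by rewrite lt_min !subr_gt0 sr rt.
  move/cvgr0Pnorm_lt: hl => /(_ _ d0); apply: filterS => k.
  by rewrite /d lt_min ltr_norml ltr_norml => /andP[/andP[? ?] /andP[? ?]]; lra.
have sqd q x : s < q < t -> is_derive q (1 : R) (fun q => sqn (v q x)) (2 * ip (ci * Hop hbar M (v q) x) (v q x)).
  by move=> hq; apply: is_derive_sqn; exact: vd.
have gle q x : s <= q <= t -> `|2 * ip (ci * Hop hbar M (v q) x) (v q x)| <= 2 * (cn * K * L) * W x.
  move=> hq; rewrite normrM ger0_norm// -mulrA ler_wpM2l//.
  apply: le_trans (abs_ip _ _) _.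
  rewrite (_ : cn * K * L * W x = L * (cn * K * W x)); last by ring.
  apply: ler_pM; rewrite ?cabs_ge0//; [exact: HL|exact: Bnd_W (vK _ hq)].
(* The factor [ci], which is [1 / (i hbar)], turns the real product into the imaginary one, and
   [intV_ix_Hop] annihilates the latter. *)
have gE : g = fun x => 2 * hbar^-1 * ix (Hop hbar M (v r) x) (v r x).
  by apply/funext => x; rewrite /g /ip /ix /ci !reM !imM !creimE; ring.
have HopB := HH n2.+1 K (v r) (vK r hr).
have dix := dom_ix (Bnd_leq (leqnSn _) HopB) (vK r hr).
have dg : domV (2 * (cn * K * L)) g.
  split; last by move=> x; exact: gle.
  by rewrite gE; case: (domZ (2 * hbar^-1) dix).
have intg : intV g = 0.
  by rewrite gE (intVZ _ dix) (intV_ix_Hop hbar Msym (vK r hr)) mulr0.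
have domG k : s < r + h k < t -> domV (2 * (cn * K * L)) (G k).
  move=> hk; have hk' : s <= r + h k <= t by move: hk => /andP[? ?]; rewrite !ltW.
  split.
    apply: continuous_mul; first exact: continuous_cst.
    by apply: continuous_sub; apply: continuous_sqn => x; [exact: Bnd_diff (vK _ hk')|exact: Bnd_diff (vK _ hr)].
  move=> x; rewrite /G normrM normfV mulrC ler_pdivrMr ?normr_gt0//.
  have := @le_norm_diff R (fun q => sqn (v q x)) (fun q => 2 * ip (ci * Hop hbar M (v q) x) (v q x))
    (2 * (cn * K * L) * W x) r (r + h k).
  rewrite (_ : r + h k - r = h k); last by ring.
  have bt q : Num.min r (r + h k) <= q <= Num.max r (r + h k) -> s < q < t.
    by move: hk; rewrite ge_min le_max => /andP[? ?] /andP[/orP[?|?] /orP[?|?]]; lra.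
  apply; first by move=> q /bt; exact: sqd.
  by move=> q /bt /andP[? ?]; apply: gle; rewrite !ltW.
rewrite -intg.
have : intV (G k) @[k --> \oo] --> intV g.
  apply: (@intV_cvg_near _ _ (2 * (cn * K * L))) => //.
    by apply: filterS near_in => k; exact: domG.
  move=> x; have := sqd r x; rewrite sr rt => /(_ isT) H.
  exact: (is_derive_cvg_seq H).
apply: cvg_trans; apply: near_eq_cvg; apply: filterS near_in => k hk.
have hk' : s <= r + h k <= t by move: hk => /andP[? ?]; rewrite !ltW.
have d1 := dom_sqn (Bnd_leq leqn3 (vK _ hk')); have d2 := dom_sqn (Bnd_leq leqn3 (vK _ hr)).
rewrite /G (_ : (fun x => _) = fun x => (h k)^-1 * (sqn (v (r + h k) x) + -1 * sqn (v r x))); last first.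
  by apply/funext => x; rewrite mulN1r.
by rewrite (intVZ _ (domD d1 (domZ (-1) d2))) (intVD d1 (domZ (-1) d2)) (intVZ _ d2) mulN1r.
Qed.

(** [gsol] gives derivatives at interior times only. The ends are reached by its continuity clause,
    along sequences that approach them from inside. *)
Lemma N2_conserved s t v : gsol s t v -> s < t -> N2 (v s) = N2 (v t).
Proof.
move=> vG st.
have mid p q : s < p < t -> s < q < t -> N2 (v p) = N2 (v q).
  move=> /andP[? ?] /andP[? ?].
  apply/eqP; rewrite -subr_eq0 -normr_le0 -(mul0r `|p - q|).
  apply: (@le_norm_diff R (fun r => N2 (v r)) (fun=> 0)) => [r|r _]; last by rewrite normr0.
  rewrite ge_min le_max => /andP[/orP[?|?] /orP[?|?]]; apply: (is_derive_N2 vG); apply/andP; split; lra.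
pose m := (s + t) / 2.
have hm : s < m < t by rewrite /m; apply/andP; split; lra.
pose hh k : R := (t - s) / 2 * harmonic k.
have hh0 : hh k @[k --> \oo] --> (0 : R).
  rewrite -(mulr0 ((t - s) / 2)); apply: cvgM; first exact: cvg_cst.
  exact: cvg_harmonic.
have hhb k : 0 < hh k <= (t - s) / 2.
  have h1 : (0 : R) < harmonic k by exact: harmonic_gt0.
  have h2 : harmonic k <= (1 : R) by rewrite /harmonic/=; rewrite invf_le1 ?ltr0n// ler1n.
  have d0 : 0 < (t - s) / 2 by lra.
  by rewrite /hh mulr_gt0//= ler_piMr// ltW.
have lims : N2 (v (s + hh k)) @[k --> \oo] --> N2 (v s).
  apply: (N2_cvg vG); first by rewrite lexx ltW.
    by move=> k; have /andP[? ?] := hhb k; apply/andP; split; lra.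
  by rewrite -[X in _ --> X]addr0; apply: cvgD => //; exact: cvg_cst.
have limt : N2 (v (t - hh k)) @[k --> \oo] --> N2 (v t).
  apply: (N2_cvg vG); first by rewrite lexx ltW.
    by move=> k; have /andP[? ?] := hhb k; apply/andP; split; lra.
  by rewrite -[X in _ --> X]subr0; apply: cvgB => //; exact: cvg_cst.
have es : (fun k => N2 (v (s + hh k))) = fun=> N2 (v m).
  by apply/funext => k; apply: mid => //; have /andP[? ?] := hhb k; apply/andP; split; lra.
have et : (fun k => N2 (v (t - hh k))) = fun=> N2 (v m).
  by apply/funext => k; apply: mid => //; have /andP[? ?] := hhb k; apply/andP; split; lra.
rewrite es in lims; rewrite et in limt.
rewrite -(cvg_lim (@Rhausdorff R) lims) -(cvg_lim (@Rhausdorff R) limt) //.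
Qed.

End Conservation.

(** * Conjugation of the Hamiltonian by Weyl operators *)

Section HopRho.
Variables (R : realType) (n : nat) (hbar : R) (M : 'M[R]_(n + n)).
Hypotheses (hbar_gt0 : 0 < hbar) (Msym : M^T = M).
Local Notation C := R[i].
Notation V := 'cV[R]_n.
Local Notation re := (@complex.Re R).
Local Notation im := (@complex.Im R).
Implicit Types (f g : V -> C) (x y : V) (z : 'cV[R]_(n + n)) (j k : 'I_(n + n)) (K : R) (c : C).
Local Notation Hop := (Hop hbar M).
Local Notation zhat := (zhat hbar).

Definition weyl z f := rho hbar (usubmx z) (dsubmx z) f.

Lemma zhatD j f g : (forall x, cdifferentiable f x) -> (forall x, cdifferentiable g x) ->
  zhat j (fun x => f x + g x) = (fun x => zhat j f x + zhat j g x).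
Proof. by move=> df dg; rewrite !zhatE genD//; apply/funext => x; rewrite mulrDr. Qed.

Lemma zhatZ j c f : (forall x, cdifferentiable f x) ->
  zhat j (fun x => c * f x) = (fun x => c * zhat j f x).
Proof. by move=> df; rewrite !zhatE genZ//; apply/funext => x; rewrite mulrCA. Qed.

Lemma zcoef_shiftc j z :
  zcoef hbar j * shiftc hbar (usubmx z) (dsubmx z) (fintype.split j) = (z j 0)%:C.
Proof.
rewrite /zcoef; case: (fintype.splitP j) => k jk /=; rewrite mxE.
  by rewrite mul1r; congr (_ %:C); congr (z _ _); exact: val_inj.
rewrite (_ : rshift n k = j); last exact: val_inj.
rewrite mulNr mulrACA -expr2 sqr_i mulN1r opprK -rmorphM/=; congr (_ %:C).
by field; rewrite gt_eqF.
Qed.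

Lemma zhat_weyl j z f : (forall x, cdifferentiable f x) ->
  zhat j (weyl z f) = weyl z (fun x => zhat j f x + (z j 0)%:C * f x).
Proof.
move=> df; rewrite !zhatE /weyl gen_rho//; apply/funext => x.
by rewrite /rho -(zcoef_shiftc j z); ring.
Qed.

(** Conjugation replaces each canonical operator by itself plus the number [z j 0], and the Taylor
    expansion of a quadratic form at a shifted point is exact: quadratic, linear and constant part.
    The symmetry of [M] merges the two cross terms into the linear one. *)
Lemma Hop_weyl K z f x : Bnd 2 K f ->
  Hop (weyl z f) x = weyl z (fun y => Hop f y +
     (\sum_j ((M *m z) j 0)%:C * zhat j f y + (dot (M *m z) z / 2)%:C * f y)) x.
Proof.
move=> fK; have df y : cdifferentiable f y by exact: Bnd_diff fK.
have dz j y : cdifferentiable (zhat j f) y by exact: Bnd_diff (Bnd_zhat hbar j fK).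
have E j k : zhat j (zhat k (weyl z f)) x =
    weyl z (fun y => zhat j (zhat k f) y + (z k 0)%:C * zhat j f y +
      (z j 0)%:C * zhat k f y + (z j 0)%:C * (z k 0)%:C * f y) x.
  rewrite (zhat_weyl k z df) zhat_weyl; last first.
    by move=> y; apply: cdiffD => //; exact: cdiffZ.
  rewrite zhatD//; last by move=> y; exact: cdiffZ.
  by rewrite zhatZ// /weyl /rho; ring.
rewrite /Hop; under eq_bigr do under eq_bigr do rewrite E.
rewrite /weyl /rho /Hop; set p := phase _ _ x; set y := x - _.
have S1 : \sum_j ((M *m z) j 0)%:C * zhat j f y =
    \sum_j \sum_k (M j k)%:C * ((z k 0)%:C * zhat j f y).
  apply: eq_bigr => j _; rewrite mxE rmorph_sum mulr_suml; apply: eq_bigr => k _.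
  by rewrite rmorphM mulrA.
have S2 : \sum_j ((M *m z) j 0)%:C * zhat j f y =
    \sum_j \sum_k (M j k)%:C * ((z j 0)%:C * zhat k f y).
  rewrite S1 exchange_big/=; apply: eq_bigr => j _; apply: eq_bigr => k _.
  by rewrite -[in LHS]Msym mxE.
have S3 : (dot (M *m z) z)%:C * f y = 
    \sum_j \sum_k (M j k)%:C * ((z j 0)%:C * (z k 0)%:C * f y).
  rewrite /dot rmorph_sum mulr_suml; apply: eq_bigr => j _.
  rewrite mxE mulr_suml rmorph_sum mulr_suml; apply: eq_bigr => k _.
  by rewrite !rmorphM/=; ring.
have -> : (dot (M *m z) z / 2)%:C * f y = (2^-1)%:C * ((dot (M *m z) z)%:C * f y).
  by rewrite rmorphM/=; ring.
have -> : \sum_j ((M *m z) j 0)%:C * zhat j f y = (2^-1)%:C *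
    (\sum_j ((M *m z) j 0)%:C * zhat j f y + \sum_j ((M *m z) j 0)%:C * zhat j f y).
  move: (\sum_j _) => w; apply: cplx_eq; rewrite !creimE; lra.
rewrite {1}S1 S2 S3 -!mulrDr -!big_split/= mulrCA; congr (_ * _).
rewrite mulr_sumr; apply: eq_bigr => j _; rewrite -!big_split/= mulr_sumr.
by apply: eq_bigr => k _; ring.
Qed.

End HopRho.

Section GsolLinear.
Variables (R : realType) (n : nat) (hbar : R) (M : 'M[R]_(n + n)).
Local Notation C := R[i].
Local Notation V := 'cV[R]_n.
Implicit Types (f g : V -> C) (x y : V) (K L : R) (c : C) (s t r : R) (v w : R -> V -> C).
Local Notation Hop := (Hop hbar M).
Local Notation gsol := (gsol hbar M).
Local Notation n2 := (size (enum 'I_n)).*2.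

Lemma HopD K L f g x : Bnd 2 K f -> Bnd 2 L g ->
  Hop (fun x => f x + g x) x = Hop f x + Hop g x.
Proof.
move=> fK gL; have df y : cdifferentiable f y by exact: Bnd_diff fK.
have dg y : cdifferentiable g y by exact: Bnd_diff gL.
have dzf j y : cdifferentiable (zhat hbar j f) y by exact: Bnd_diff (Bnd_zhat hbar j fK).
have dzg j y : cdifferentiable (zhat hbar j g) y by exact: Bnd_diff (Bnd_zhat hbar j gL).
rewrite /Hop -mulrDr -big_split/=; congr (_ * _); apply: eq_bigr => j _.
rewrite -big_split/=; apply: eq_bigr => k _; rewrite -mulrDr; congr (_ * _).
by rewrite zhatD// zhatD.
Qed.

Lemma HopZ K c f x : Bnd 2 K f -> Hop (fun x => c * f x) x = c * Hop f x.
Proof.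
move=> fK; have df y : cdifferentiable f y by exact: Bnd_diff fK.
have dzf j y : cdifferentiable (zhat hbar j f) y by exact: Bnd_diff (Bnd_zhat hbar j fK).
rewrite /Hop mulrCA; congr (_ * _); rewrite mulr_sumr; apply: eq_bigr => j _.
rewrite mulr_sumr; apply: eq_bigr => k _; rewrite mulrCA; congr (_ * _).
by rewrite zhatZ// zhatZ.
Qed.

Lemma gsolD s t v w : gsol s t v -> gsol s t w -> gsol s t (fun r x => v r x + w r x).
Proof.
move=> [[K vK] vd vc] [[L wL] wd wc]; split.
- by exists (K + L) => r hr; apply: BndD; [exact: vK|exact: wL].
- move=> x r hr; have hr' : s <= r <= t by case/andP: hr => ? ?; rewrite !ltW.
  apply: cis_derive_eq (cis_deriveD (vd x r hr) (wd x r hr)) _.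
  have v2 : Bnd 2 K (v r) by apply: Bnd_leq (vK _ hr').
  have w2 : Bnd 2 L (w r) by apply: Bnd_leq (wL _ hr').
  by rewrite (HopD _ v2 w2) mulrDr.
- move=> x r rk hr hrk rkr.
  have H : cabs (v (rk k) x - v r x) + cabs (w (rk k) x - w r x) @[k --> \oo] --> (0 : R).
    by rewrite -(addr0 0); apply: cvgD; [exact: vc|exact: wc].
  apply: (squeeze_cvgr _ (cvg_cst (0 : R)) H); near=> k; rewrite cabs_ge0/=.
  by rewrite opprD addrACA cabsD.
Unshelve. all: end_near. Qed.

Lemma gsolZ s t c v : gsol s t v -> gsol s t (fun r x => c * v r x).
Proof.
move=> [[K vK] vd vc]; split.
- by exists (cabs c * K) => r hr; apply: BndZ; exact: vK.
- move=> x r hr; have hr' : s <= r <= t by case/andP: hr => ? ?; rewrite !ltW.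
  apply: cis_derive_eq (cis_deriveM (cis_derive_cst c r) (vd x r hr)) _.
  have v2 : Bnd 2 K (v r) by apply: Bnd_leq (vK _ hr').
  by rewrite mul0r add0r (HopZ _ _ v2) mulrCA.
- move=> x r rk hr hrk rkr.
  have H : cabs c * cabs (v (rk k) x - v r x) @[k --> \oo] --> (0 : R).
    by rewrite -(mulr0 (cabs c)); apply: cvgM; [exact: cvg_cst|exact: vc].
  apply: (squeeze_cvgr _ (cvg_cst (0 : R)) H); near=> k; rewrite cabs_ge0/=.
  by rewrite -mulrBr cabsM.
Unshelve. all: end_near. Qed.

End GsolLinear.

Section Lipschitz.
Variables (R : realType) (n : nat).
Local Notation C := R[i].
Local Notation V := 'cV[R]_n.
Implicit Types (f : V -> C) (x y : V) (K : R).

Lemma cabs_lipschitz K f x y : Bnd 1 K f ->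
  cabs (f y - f x) <= 2 * K * \sum_j `|y j 0 - x j 0|.
Proof.
move=> fK; have df z : cdifferentiable f z by exact: Bnd_diff fK.
have pK j z : cabs (cpartial j f z) <= K by exact: Bnd_cabs (Bnd_gen (inr j) fK).
rewrite /cabs !creimE (_ : 2 * K = K + K); last by ring.
rewrite mulrDl; apply: lerD.
  apply: (@lipschitz_partial _ _ (fun x => complex.Re (f x))) => [z|j z]; first by case: (df z).
  exact: le_trans (cabs_le_re _) (pK j z).
apply: (@lipschitz_partial _ _ (fun x => complex.Im (f x))) => [z|j z]; first by case: (df z).
exact: le_trans (cabs_le_im _) (pK j z).
Qed.

(** A quadratic bound near [r] is all that will be known of the remainder in [cis_derive_moving]. *)
Lemma cis_derive_quadratic (E : R -> C) (r d K : R) : 0 < d ->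
  (forall q, `|q - r| < d -> cabs (E q) <= K * (q - r) ^+ 2) -> cis_derive E r 0.
Proof.
move=> d0 EK.
have key (e : R -> R) : (forall q, `|e q| <= cabs (E q)) -> is_derive r (1 : R) e 0.
  move=> eE.
  have bd q : `|q - r| < d -> `|e q| <= K * (q - r) ^+ 2 by move=> /EK; exact: le_trans.
  have er : e r = 0.
    by apply/eqP; rewrite -normr_le0; have := bd r; rewrite subrr normr0 expr0n mulr0; apply.
  apply: is_derive_seq => v v0 _ vl; rewrite er.
  have H : K * `|v k| @[k --> \oo] --> (0 : R).
    rewrite -(mulr0 K) -(normr0 R) ; apply: cvgM; first exact: cvg_cst.
    exact: cvg_norm.
  apply/cvgr0Pnorm_le => eps eps0.
  move/cvgr0Pnorm_le: (H) => /(_ _ eps0); move/cvgr0Pnorm_lt: vl => /(_ _ d0).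
  apply: filterS2 => k vd Hk; rewrite subr0 normrM normfV.
  have vk : 0 < `|v k| by rewrite normr_gt0.
  rewrite mulrC ler_pdivrMr//.
  have := bd (r + v k); rewrite addrC addKr => /(_ vd) /le_trans; apply.
  rewrite -real_normK ?num_real// expr2 mulrA; apply: ler_wpM2r; first exact: ltW.
  exact: le_trans (ler_norm _) Hk.
by split; apply: key => q; [exact: cabs_le_re|exact: cabs_le_im].
Qed.

End Lipschitz.

Lemma cabs_shiftc (R : realType) (n : nat) (hbar Q : R) (z : 'cV[R]_(n + n)) a :
  0 < hbar -> 0 <= Q -> (forall i, `|z i 0| <= Q) ->
  cabs (shiftc hbar (usubmx z) (dsubmx z) a) <= Q + Q / hbar.
Proof.
move=> h0 Q0 zQ; case: a => j /=.
  rewrite cabsR mxE; apply: le_trans (zQ _) _; rewrite lerDl divr_ge0// ltW//.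
apply: le_trans (cabsM _ _) _; rewrite cabsR (_ : cabs 'i = 1); last first.
  by rewrite /cabs !creimE normr0 normr1 add0r.
rewrite mul1r mxE normrM (gtr0_norm (x := hbar^-1)) ?invr_gt0//.
apply: (@le_trans _ _ (Q / hbar)); last by rewrite lerDr.
by apply: ler_wpM2r; [rewrite invr_ge0 ltW|exact: zQ].
Qed.

(** * Translates of a solution along the classical flow *)

Section GsolFlow.
Variables (R : realType) (n : nat) (hbar : R) (M : 'M[R]_(n + n)).
Hypotheses (hbar_gt0 : 0 < hbar) (Msym : M^T = M).
Local Notation C := R[i].
Local Notation V := 'cV[R]_n.
Implicit Types (f g : V -> C) (x y : V) (K L Q : R) (c : C) (s t r q : R) (u v w : R -> V -> C).
Local Notation Hop := (Hop hbar M).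
Local Notation gsol := (gsol hbar M).
Local Notation ci := (ci hbar).
Local Notation n2 := (size (enum 'I_n)).*2.

Lemma Jmx_mul (w : 'cV[R]_(n + n)) : Jmx R n *m w = col_mx (dsubmx w) (- usubmx w).
Proof.
by rewrite -{1}[w]vsubmxK mul_block_col !mul0mx !mul1mx add0r addr0 mulNmx mul1mx.
Qed.

Variable z : R -> 'cV[R]_(n + n).
Hypothesis zd : forall r i, is_derive r (1 : R) (fun r => z r i 0) ((Jmx R n *m M *m z r) i 0).

Let normr_sub2l (a b c : R) : `|a - b - (a - c)| = `|b - c|.
Proof. by rewrite -normrN; congr `|_|; ring. Qed.

Lemma flow_bounded s t : s <= t ->
  exists2 Q, 0 <= Q & forall r i, s <= r <= t -> `|z r i 0| <= Q.
Proof.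
move=> st.
have H i : exists Qi, forall r, s <= r <= t -> `|z r i 0| <= Qi.
  have cz : {within `[s, t], continuous (fun r => `|z r i 0|)}.
    apply: continuous_subspaceT => r; apply: (@continuous_comp _ _ _ (fun r => z r i 0)).
      apply: differentiable_continuous; apply/derivable1_diffP.
      by have [d _] := zd r i; exact: d.
    exact: norm_continuous.
  have [c _ cP] := EVT_max st cz.
  by exists `|z c i 0| => r hr; apply: cP; rewrite in_itv.
have [Qf QfP] := choice H.
exists (\sum_i `|Qf i|); first exact: sumr_ge0.
move=> r i hr; rewrite (bigD1 i)//=.
apply: le_trans (QfP _ _ hr) _; apply: le_trans (ler_norm _) _.
by rewrite lerDl sumr_ge0.
Qed.

Lemma flow_lipschitz s t : s <= t ->
  exists2 L, 0 <= L & forall q r i, s <= q <= t -> s <= r <= t ->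
    `|z q i 0 - z r i 0| <= L * `|q - r|.
Proof.
move=> st; have [Q Q0 zQ] := flow_bounded st.
pose X := Jmx R n *m M.
have L0 i : 0 <= \sum_j `|X i j| * Q by apply: sumr_ge0 => j _; rewrite mulr_ge0.
exists (\sum_i \sum_j `|X i j| * Q); first exact: sumr_ge0.
move=> q r i hq hr.
apply: (@le_norm_diff _ (fun r => z r i 0) (fun r => (X *m z r) i 0)).
move=> p hp.
have {}hp : s <= p <= t.
  move: hq hr hp; rewrite ge_min le_max => /andP[? ?] /andP[? ?] /andP[/orP[?|?] /orP[?|?]]; apply/andP; split; lra.
rewrite (bigD1 i)//= mxE; apply: le_trans (ler_norm_sum _ _ _) _.
rewrite -[leLHS]addr0; apply: lerD; last by apply: sumr_ge0.
by apply: ler_sum => j _; rewrite normrM ler_wpM2l// zQ.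
Qed.

Local Notation y r := (usubmx (z r)).
Local Notation eta r := (dsubmx (z r)).

Let yd r i : is_derive r (1 : R) (fun r => y r i 0) (dsubmx (M *m z r) i 0).
Proof.
have := zd r (lshift n i); rewrite -mulmxA Jmx_mul col_mxEu.
by rewrite (_ : (fun r => _) = fun r => y r i 0)//; apply/funext => q; rewrite mxE.
Qed.

Let etad r i : is_derive r (1 : R) (fun r => eta r i 0) ((- usubmx (M *m z r)) i 0).
Proof.
have := zd r (rshift n i); rewrite -mulmxA Jmx_mul col_mxEd.
by rewrite (_ : (fun r => _) = fun r => eta r i 0)//; apply/funext => q; rewrite mxE.
Qed.

(* Spatial Lipschitz continuity of the time derivative of [u] replaces the joint
   differentiability of [u], which is not assumed. *)
Lemma cis_derive_moving s t u x r : gsol s t u -> s < r < t ->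
  cis_derive (fun q => u q (x - y q)) r
    (ci * Hop (u r) (x - y r) - \sum_i (dsubmx (M *m z r) i 0)%:C * cpartial i (u r) (x - y r)).
Proof.
move=> [[K uK] ud uc] hr; have /andP[sr rt] := hr; have st : s <= t by lra.
have hr' : s <= r <= t by rewrite !ltW.
have [L L0 zL] := flow_lipschitz st.
have [cH cH0 HH] := Bnd_Hop hbar M.
have K0 : 0 <= K by exact: Bnd_ge0 (uK r hr').
(* The mixed second difference: the change between times [r] and [q] of a difference of values of
   [u] at two points whose distance is of order [|q - r|]. Being small in both variables, it is
   quadratic in [q - r]. *)
pose E q := u q (x - y q) - u q (x - y r) - u r (x - y q) + u r (x - y r).
(* The outer 2 is that of [cis_derive_le], [2 * (cH * K)] is a spatial Lipschitz constant for
   [Hop (u p)], and [n * L] bounds the speed of the base point. *)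
pose D := 2 * (cabs ci * (2 * (cH * K) * (n%:R * L))).
have d1 : 0 < Num.min (r - s) (t - r) by rewrite lt_min !subr_gt0 sr rt.
have Ed : cis_derive E r 0.
  apply: (cis_derive_quadratic (K := D) d1) => q.
  rewrite lt_min !ltr_norml => /andP[/andP[? ?] /andP[? ?]].
  have hq : s <= q <= t by apply/andP; split; lra.
  rewrite /E (_ : _ + _ = (u q (x - y q) - u q (x - y r)) - (u r (x - y q) - u r (x - y r))); last by ring.
  have Sd : \sum_j `|(x - y q) j 0 - (x - y r) j 0| <= n%:R * L * `|q - r|.
    apply: (@le_trans _ _ (\sum_(j < n) L * `|q - r|)).
      apply: ler_sum => j _; rewrite !mxE normr_sub2l; exact: zL.
    by rewrite sumr_const card_ord -[leLHS]mulr_natl mulrA.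
  have bt p : Num.min r q <= p <= Num.max r q -> s < p < t.
    by rewrite ge_min le_max => /andP[/orP[?|?] /orP[?|?]]; apply/andP; split; lra.
  have := @cis_derive_le _ (fun p => u p (x - y q) + -1 * u p (x - y r))
    (fun p => ci * Hop (u p) (x - y q) + (0 * u p (x - y r) + -1 * (ci * Hop (u p) (x - y r))))
    (cabs ci * (2 * (cH * K) * (n%:R * L * `|q - r|))) r q.
  rewrite !mulN1r (_ : 2 * _ * `|q - r| = D * (q - r) ^+ 2); last first.
    by rewrite -[in RHS]real_normK ?num_real// /D; ring.
  apply=> p /bt hp.
    apply: cis_deriveD; first exact: ud.
    by apply: cis_deriveM; [exact: cis_derive_cst|exact: ud].
  rewrite mul0r add0r mulN1r -mulrBr; apply: le_trans (cabsM _ _) _.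
  rewrite ler_wpM2l ?cabs_ge0//.
  have hp' : s <= p <= t by case/andP: hp => ? ?; rewrite !ltW.
  have HB : Bnd 1 (cH * K) (Hop (u p)) by apply: HH; apply: Bnd_leq (uK _ hp').
  apply: le_trans (cabs_lipschitz _ _ HB) _; rewrite ler_wpM2l//.
  by rewrite !mulr_ge0.
have du p : cdifferentiable (u r) p by exact: Bnd_diff (uK r hr').
have t1 := ud (x - y r) r hr.
have t2 := @cis_derive_translate _ _ (u r) (fun r => y r) (dsubmx (M *m z r)) x r du (yd r).
have t3 := cis_derive_cst (- u r (x - y r)) r.
rewrite (_ : (fun q => _) = fun q => u q (x - y r) + u r (x - y q) + - u r (x - y r) + E q).
  by apply: cis_derive_eq (cis_deriveD (cis_deriveD (cis_deriveD t1 t2) t3) Ed) _; ring.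
by apply/funext => q; rewrite /E; ring.
Qed.

(** By Hamilton's equations, the transport term and the derivative of the phase of [rho] are exactly
    the linear part in [Hop_weyl], and half the symplectic product of [z] with its velocity accounts
    for the constant [dot (M *m z) z / 2]. *)
Lemma gsol_weyl s t u : s < t -> gsol s t u -> gsol s t (fun r => weyl hbar (z r) (u r)).
Proof.
move=> st uG; have [[K uK] ud uc] := uG.
have [Q Q0 zQ] := flow_bounded (ltW st); have [L L0 zL] := flow_lipschitz (ltW st).
have q0 : 0 <= Q + Q / hbar by rewrite addr_ge0// divr_ge0// ltW.
split.
- exists (2 * (1 + (Q + Q / hbar)) ^+ n2.+3 * K) => r hr; apply: Bnd_rho => //; last exact: uK.
  by move=> a; apply: (@cabs_shiftc _ _ _ _ (z r) a) => // i; exact: zQ.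
- move=> x r hr.
  have hr' : s <= r <= t by case/andP: hr => ? ?; rewrite !ltW.
  have u2 : Bnd 2 K (u r) by apply: Bnd_leq (uK _ hr').
  have dm := cis_derive_moving x uG hr.
  apply: cis_derive_eq (cis_derive_rho (hbar:=hbar) hbar_gt0 (yd r) (etad r) dm) _.
  rewrite (Hop_weyl hbar_gt0 Msym _ _ u2) /weyl /rho [RHS]mulrCA; congr (_ * _).
  cbv beta; set a := x - y r; set f := u r.
  rewrite [X in _ = _ * (_ + (X + _))]big_split_ord.
  have e1 : \sum_(i < n) ((M *m z r) (lshift n i) 0)%:C * zhat hbar (lshift n i) f a =
      - ((dot (- usubmx (M *m z r)) a)%:C * f a).
    rewrite /dot rmorph_sum mulr_suml -sumrN; apply: eq_bigr => i _.
    rewrite zhatE/= (_ : fintype.split (lshift n i) = inl i); last exact: (unsplitK (inl i)).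
    rewrite /zcoef (_ : fintype.split (lshift n i) = inl i); last exact: (unsplitK (inl i)).
    by rewrite /= !mxE rmorphM rmorphN/=; ring.
  have e2 : \sum_(i < n) ((M *m z r) (rshift n i) 0)%:C * zhat hbar (rshift n i) f a =
      - ('i * hbar%:C) * \sum_i (dsubmx (M *m z r) i 0)%:C * cpartial i f a.
    rewrite mulr_sumr; apply: eq_bigr => i _.
    rewrite zhatE/= (_ : fintype.split (rshift n i) = inr i); last exact: (unsplitK (inr i)).
    rewrite /zcoef (_ : fintype.split (rshift n i) = inr i); last exact: (unsplitK (inr i)).
    by rewrite /= !mxE mulrCA.
  rewrite e1 e2.
  have -> : dot (M *m z r) (z r) = dot (dsubmx (M *m z r)) (eta r) - dot (- usubmx (M *m z r)) (y r).
    rewrite /dot big_split_ord/= addrC; congr (_ + _); first by apply: eq_bigr => i _; rewrite !mxE.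
    by rewrite -sumrN; apply: eq_bigr => i _; rewrite !mxE; ring.
  have -> : dot (eta r) (dsubmx (M *m z r)) = dot (dsubmx (M *m z r)) (eta r).
    by apply: eq_bigr => i _; rewrite mulrC.
  set S := \sum_i _; set A := dot _ a; set B := dot _ (y r); set D := dot _ (eta r).
  rewrite [X in _ = _ * (_ + (X + _))]/=.
  have ci1 : ci * ('i * hbar%:C) = 1.
    by rewrite /ci; apply: cplx_eq; rewrite !creimE; field; rewrite gt_eqF.
  have ciR (b : R) : ci * b%:C = - ('i * (b / hbar)%:C).
    by rewrite /ci; apply: cplx_eq; rewrite !creimE; field; rewrite gt_eqF.
  rewrite [RHS](_ : _ = ci * Hop f a - ci * A%:C * f a - ci * ('i * hbar%:C) * S +
     ci * ((D - B) / 2)%:C * f a); last by ring.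
  rewrite ci1 !ciR; apply: cplx_eq; rewrite !creimE; field; rewrite gt_eqF//.
- move=> x r rk hr hrk rkr.
  have Sd k : \sum_j `|(x - y (rk k)) j 0 - (x - y r) j 0| <= n%:R * L * `|rk k - r|.
    apply: (@le_trans _ _ (\sum_(j < n) L * `|rk k - r|)).
      apply: ler_sum => j _; rewrite !mxE normr_sub2l; exact: zL.
    by rewrite sumr_const card_ord -[leLHS]mulr_natl mulrA.
  set c := u r (x - y r).
  have K0 : 0 <= K by exact: Bnd_ge0 (uK r hr).
  have l1 : `|rk k - r| @[k --> \oo] --> (0 : R).
    rewrite -(normr0 R) -(subrr r); apply: cvg_norm; apply: cvgB => //; exact: cvg_cst.
  have l2 := uc (x - y r) r rk hr hrk rkr.
  have P := cis_derive_rho (hbar:=hbar) (u := fun _ _ => c) hbar_gt0 (yd r) (etad r) (x := x) (cis_derive_cst c r).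
  have l3 : cabs (weyl hbar (z (rk k)) (fun=> c) x - weyl hbar (z r) (fun=> c) x) @[k --> \oo] --> (0 : R).
    exact: cis_derive_cvg P rkr.
  have H : 2 * (2 * K * (n%:R * L * `|rk k - r|) + cabs (u (rk k) (x - y r) - c)) +
     cabs (weyl hbar (z (rk k)) (fun=> c) x - weyl hbar (z r) (fun=> c) x) @[k --> \oo] --> (0 : R).
    rewrite (_ : 0 = 2 * (2 * K * (n%:R * L * 0) + 0) + 0 :> R); last by ring.
    apply: cvgD => //; apply: cvgM; first exact: cvg_cst.
    apply: cvgD => //; apply: cvgM; first exact: cvg_cst.
    by apply: cvgM => //; exact: cvg_cst.
  apply: (squeeze_cvgr _ (cvg_cst (0 : R)) H); near=> k; rewrite cabs_ge0/=.
  rewrite (_ : weyl hbar (z (rk k)) (u (rk k)) x - weyl hbar (z r) (u r) x =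
    phase (hbar^-1 *: eta (rk k)) (- (dot (eta (rk k)) (y (rk k)) / (2 * hbar))) x *
      ((u (rk k) (x - y (rk k)) - u (rk k) (x - y r)) + (u (rk k) (x - y r) - c)) +
    (weyl hbar (z (rk k)) (fun=> c) x - weyl hbar (z r) (fun=> c) x)); last first.
    by rewrite /weyl /rho /c; ring.
  apply: le_trans (cabsD _ _) _; rewrite lerD2r; apply: le_trans (cabsM _ _) _.
  apply: ler_pM; rewrite ?cabs_ge0 ?cabs_phase//.
  apply: le_trans (cabsD _ _) _; rewrite lerD2r.
  have u1 : Bnd 1 K (u (rk k)) by apply: Bnd_leq (uK _ (hrk k)).
  apply: le_trans (cabs_lipschitz _ _ u1) _; apply: ler_wpM2l (Sd k).
  by rewrite mulr_ge0.
Unshelve. all: end_near. Qed.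

End GsolFlow.

(** * Bounds on solutions, locally uniform in time *)

Section WeylDifferences.
Variables (R : realType) (n : nat) (hbar : R).
Hypothesis hbar_gt0 : 0 < hbar.
Local Notation C := R[i].
Local Notation V := 'cV[R]_n.
Local Notation P := 'cV[R]_(n + n).
Local Notation re := (@complex.Re R).
Local Notation im := (@complex.Im R).
Implicit Types (f g : V -> C) (x y : V) (K L Q h : R) (c : C) (z : P) (ps : seq (R * P)) (k m : nat).
Local Notation weyl := (weyl hbar).

Definition dq h z f : V -> C := fun x => (h^-1)%:C * (weyl (h *: z) f x - f x).

Lemma dqE h z f : dq h z f = delta hbar h (usubmx z, dsubmx z) f.
Proof.
rewrite /dq /delta /weyl/=; have -> : usubmx (h *: z) = h *: usubmx z by apply/colP => i; rewrite !mxE.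
by have -> : dsubmx (h *: z) = h *: dsubmx z by apply/colP => i; rewrite !mxE.
Qed.

Definition dqs ps f := foldr (fun p => dq p.1 p.2) f ps.

Lemma dqZ h z c f : dq h z (fun x => c * f x) = fun x => c * dq h z f x.
Proof. by apply/funext => x; rewrite /dq /weyl rhoZ; ring. Qed.

Lemma dqsZ ps c f : dqs ps (fun x => c * f x) = fun x => c * dqs ps f x.
Proof. by elim: ps => //= p ps ->; exact: dqZ. Qed.

(** The shifts are allowed to be as large as [Q], and not only unit vectors, because the flow will
    transport them. *)
Definition steps Q m ps : Prop := (size ps <= m)%N /\
  forall p : R * P, p \in ps -> 0 < p.1 <= 1 /\ forall i, `|p.2 i 0| <= Q.

Lemma Bnd_dqs Q k m : 0 <= Q -> exists2 B, 0 <= B & forall ps K f, steps Q m ps ->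
  Bnd (k + m) K f -> Bnd k (B * K) (dqs ps f).
Proof.
move=> Q0; have q0 : 0 <= Q + Q / hbar by rewrite addr_ge0// divr_ge0// ltW.
elim: m k => [|m IH] k.
  exists 1 => // ps K f [ps0 _]; move: ps0; rewrite leqn0 size_eq0 => /eqP -> /=.
  by rewrite addn0 mul1r.
have [B1 B10 H1] := IH k.+1; have [B2 B20 H2] := Bnd_delta n hbar_gt0 k q0.
(* The added 1 pays for the empty list, where no quotient is taken. *)
exists (B2 * B1 + 1); first by rewrite addr_ge0// mulr_ge0.
move=> [|p ps] K f [psm psP] fK; have K0 := Bnd_ge0 fK.
  by apply: Bnd_le (Bnd_leq (leq_addr _ _) fK); rewrite ler_peMl// lerDr mulr_ge0.
have [/andP[p1 p1'] p2] := psP p (mem_head _ _).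
rewrite /= dqE; apply: (@Bnd_le _ _ _ (B2 * (B1 * K))).
  by rewrite mulrA ler_wpM2r// lerDl.
apply: H2 => //; first by move=> a; exact: cabs_shiftc.
apply: H1; last by rewrite addSnnS.
by split=> // p' p'ps; apply: psP; rewrite inE p'ps orbT.
Qed.

Lemma dq_pointwise h z (G : nat -> V -> C) g :
  (forall x, cabs (G k x - g x) @[k --> \oo] --> (0 : R)) ->
  forall x, cabs (dq h z (G k) x - dq h z g x) @[k --> \oo] --> (0 : R).
Proof.
move=> Gg x; set y := x - usubmx (h *: z).
have H : cabs (h^-1)%:C * (2 * cabs (G k y - g y) + cabs (G k x - g x)) @[k --> \oo] --> (0 : R).
  rewrite (_ : 0 = cabs (h^-1)%:C * (2 * 0 + 0)); last by ring.
  apply: cvgM; first exact: cvg_cst.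
  by apply: cvgD => //; apply: cvgM => //; exact: cvg_cst.
apply: (squeeze_cvgr _ (cvg_cst (0 : R)) H); near=> k; rewrite cabs_ge0/=.
rewrite /dq -mulrBr; apply: le_trans (cabsM _ _) _; rewrite ler_wpM2l ?cabs_ge0//.
rewrite /weyl /rho -/y (_ : _ - _ = phase (hbar^-1 *: dsubmx (h *: z))
  (- (dot (dsubmx (h *: z)) (usubmx (h *: z)) / (2 * hbar))) x * (G k y - g y) - (G k x - g x)); last by ring.
apply: le_trans (cabsD _ _) _; rewrite cabsN lerD2r; apply: le_trans (cabsM _ _) _.
by rewrite ler_wpM2r ?cabs_ge0 ?cabs_phase.
Unshelve. all: end_near. Qed.

Lemma dqs_pointwise ps (G : nat -> V -> C) g :
  (forall x, cabs (G k x - g x) @[k --> \oo] --> (0 : R)) ->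
  forall x, cabs (dqs ps (G k) x - dqs ps g x) @[k --> \oo] --> (0 : R).
Proof.
move=> Gg; elim: ps => [|p ps IH] //= x.
exact: (dq_pointwise p.1 p.2 (G := fun k => dqs ps (G k)) IH).
Qed.

(** The roles are exchanged: a shift of the momentum generates multiplication by a coordinate, a
    shift of the position generates a derivative. [shift_coef] is the constant in front. *)
Definition unit_shift (a : 'I_n + 'I_n) : P :=
  match a with inl j => delta_mx (rshift n j) 0 | inr j => delta_mx (lshift n j) 0 end.

Definition shift_coef (a : 'I_n + 'I_n) : C :=
  match a with inl _ => 'i * (hbar^-1)%:C | inr j => -1 end.

Lemma dq_gen a f (h : nat -> R) : (forall x, cdifferentiable f x) ->
  (forall k, h k != 0) -> h k @[k --> \oo] --> (0 : R) ->
  forall x, cabs (dq (h k) (unit_shift a) f x - shift_coef a * gen a f x) @[k --> \oo] --> (0 : R).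
Proof.
move=> df h0 hl x; set z := unit_shift a; set y := usubmx z; set eta := dsubmx z.
have [D1 D2] := @cis_derive_rho _ _ _ hbar_gt0 (fun r => r *: y) (fun r => r *: eta) y eta
  (fun=> f) _ x 0 (fun i => is_derive_ray y i 0) (fun i => is_derive_ray eta i 0)
  (@cis_derive_translate _ _ f (fun r => r *: y) y x 0 df (fun i => is_derive_ray y i 0)).
set w := (X in re X) in D1; rewrite -/w in D2.
have wE : w = shift_coef a * gen a f x.
  rewrite /w !scale0r subr0 scaler0 !dot0l !dot0r mul0r subr0 mul0r addr0 oppr0.
  rewrite /phase dot0l addr0 cos0 sin0 -[Complex 1 0]/(1 : C) mul1r {w D1 D2}.
  rewrite /eta /y /z; case: a z y eta => j z y eta /=.
    rewrite big1 ?oppr0 ?add0r => [|i _]; last by rewrite !mxE eq_lrshift mul0r.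
    rewrite (_ : dot _ x = x j 0); last first.
      rewrite /dot (bigD1 j)//= big1 => [|i ij]; first by rewrite !mxE !eqxx mul1r addr0.
      by rewrite !mxE eq_rshift (negbTE ij) mul0r.
    by rewrite rmorphM/=; ring.
  rewrite (_ : dot _ x = 0); last first.
    by rewrite /dot big1// => i _; rewrite !mxE eq_rlshift mul0r.
  rewrite mul0r mulr0 mul0r addr0 mulN1r (bigD1 j)//= big1 => [|i ij].
    by rewrite !mxE !eqxx mul1r addr0.
  by rewrite !mxE eq_lshift (negbTE ij) mul0r.
have c1 := is_derive_cvg_seq D1 h0 hl.
have c2 := is_derive_cvg_seq D2 h0 hl.
rewrite -wE /cabs -(addr0 0).
have E k : dq (h k) z f x = ((h k)^-1)%:C * (rho hbar (h k *: y) (h k *: eta) f x - f x).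
  by rewrite dqE.
apply: cvgD; rewrite -(normr0 R).
  apply: cvg_norm; rewrite -(subrr (re w)).
  have -> : (fun k => re (dq (h k) z f x - w)) = fun k => ((h k)^-1 * (re (rho hbar ((0 + h k) *: y) ((0 + h k) *: eta) f x) - re (rho hbar (0 *: y) (0 *: eta) f x))) - re w.
    by apply/funext => k; rewrite E !scale0r rho00 add0r !creimE; ring.
  by apply: cvgB => //; exact: cvg_cst.
apply: cvg_norm; rewrite -(subrr (im w)).
have -> : (fun k => im (dq (h k) z f x - w)) = fun k => ((h k)^-1 * (im (rho hbar ((0 + h k) *: y) ((0 + h k) *: eta) f x) - im (rho hbar (0 *: y) (0 *: eta) f x))) - im w.
  by apply/funext => k; rewrite E !scale0r rho00 add0r !creimE; ring.
by apply: cvgB => //; exact: cvg_cst.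
Qed.

End WeylDifferences.

Section EnergyLimits.
Variables (R : realType) (n : nat) (hbar : R).
Hypothesis hbar_gt0 : 0 < hbar.
Local Notation C := R[i].
Local Notation V := 'cV[R]_n.
Local Notation P := 'cV[R]_(n + n).
Implicit Types (f g : V -> C) (x y : V) (B K L Q h : R) (c : C) (z : P) (ps : seq (R * P)) (k m : nat)
  (a : 'I_n + 'I_n) (ws : seq ('I_n + 'I_n)) (qs : seq (R * ('I_n + 'I_n))).
Local Notation dqs := (dqs hbar).
Local Notation n2 := (size (enum 'I_n)).*2.
Local Notation cn := (2 ^+ size (enum 'I_n) : R).

Lemma N2_ge0 f : schw f -> 0 <= N2 f.
Proof.
move=> /(_ n2) [K fK]; have d0 := domZ 0 (domV_weight R n).
rewrite -(mul0r (intV (weight (enum 'I_n)))) -(intVZ _ (domV_weight R n)).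
by apply: (le_intV d0 (dom_sqn fK)) => x; rewrite mul0r sqn_ge0.
Qed.

Lemma N2Z c f : schw f -> N2 (fun x => c * f x) = sqn c * N2 f.
Proof.
move=> /(_ n2) [K fK]; rewrite /N2 -(intVZ _ (dom_sqn fK)); congr intV.
by apply/funext => x; rewrite sqnM.
Qed.

Lemma EB_words k B f : (forall ws, (size ws <= k)%N -> N2 (foldr (@gen R n) f ws) <= B) ->
  EB k B f.
Proof.
elim: k f => [|k IH] f H; split=> //; try exact: (H [::]).
by move=> a; apply: IH => ws wsk; rewrite -foldr_rcons; apply: H; rewrite size_rcons.
Qed.

Lemma schw_words ws f : schw f -> schw (foldr (@gen R n) f ws).
Proof. by move=> fS; elim: ws => //= a ws IH; exact: schw_gen. Qed.

Definition unit_steps qs : seq (R * P) := [seq (q.1, unit_shift R q.2) | q <- qs].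

Lemma unit_shift_le a i : `|unit_shift R a i 0| <= 1.
Proof. by case: a => j; rewrite mxE; case: eqP => _; rewrite ?normr1 ?normr0 ?andbT. Qed.

Lemma steps_unit m qs : (size qs <= m)%N -> (forall q, q \in qs -> 0 < q.1 <= 1) ->
  steps 1 m (unit_steps qs).
Proof.
move=> qm qP; split=> [|p /mapP[q /qP qh ->]]; first by rewrite size_map.
by split=> // i; exact: unit_shift_le.
Qed.

Lemma schw_dqs ps f Q m : 0 <= Q -> steps Q m ps -> schw f -> schw (dqs ps f).
Proof.
move=> Q0 psP fS k; have [B _ H] := Bnd_dqs n hbar_gt0 k m Q0.
by have [K fK] := fS (k + m)%N; exists (B * K); apply: H psP fK.
Qed.

(* The limits of the difference quotients are taken from the innermost one
   outwards, so that each of them is a pointwise limit under one integral. *)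
Lemma N2_dqs_words B f m : schw f ->
  (forall qs, (size qs <= m)%N -> (forall q, q \in qs -> 0 < q.1 <= 1) ->
    N2 (dqs (unit_steps qs) f) <= B) ->
  forall ws qs, (size qs + size ws <= m)%N -> (forall q, q \in qs -> 0 < q.1 <= 1) ->
    N2 (dqs (unit_steps qs) (foldr (@gen R n) f ws)) <= (1 + hbar ^+ 2) ^+ size ws * B.
Proof.
move=> fS HB; elim=> [|a ws IH] qs.
  by rewrite addn0 expr0 mul1r; exact: HB.
rewrite /= => szm qsP; set g := foldr _ f ws; have gS : schw g by exact: schw_words.
pose c := shift_coef hbar a.
have dg x : cdifferentiable g x by exact: schw_diff.
have h0 k : (0 : R) < harmonic k by exact: harmonic_gt0.
have h1 k : harmonic k <= (1 : R) by rewrite /harmonic/=; rewrite invf_le1 ?ltr0n// ler1n.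
pose qk (k : nat) := rcons qs (harmonic k, a).
have qkP k q : q \in qk k -> 0 < q.1 <= 1.
  by rewrite mem_rcons inE => /orP[/eqP ->|/qsP//]; rewrite /= h0 h1.
have szk k : (size (qk k) + size ws <= m)%N by rewrite size_rcons addSnnS.
have Ik k := IH (qk k) (szk k) (@qkP k).
have szq k : (size (qk k) <= m)%N by apply: leq_trans (szk k); rewrite leq_addr.
have [K gK] := gS (n2 + m)%N.
have [D D0 HD] := Bnd_dqs n hbar_gt0 n2 m ler01.
have Gk k := HD _ _ _ (steps_unit (szq k) (@qkP k)) gK.
have cgS : schw (fun x => c * gen a g x) by apply: schwZ; exact: schw_gen.
have szq' : (size qs <= m)%N by apply: leq_trans szm; rewrite leq_addr.
have lS := schw_dqs ler01 (steps_unit szq' qsP) cgS.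
have [L lL] := lS n2.
pose K1 := `|D * K| + `|L|.
have pw x : cabs (dqs (unit_steps (qk k)) g x -
    dqs (unit_steps qs) (fun x => c * gen a g x) x) @[k --> \oo] --> (0 : R).
  have E k : dqs (unit_steps (qk k)) g = dqs (unit_steps qs) (dq hbar (harmonic k) (unit_shift R a) g).
    by rewrite /unit_steps map_rcons /dqs foldr_rcons.
  have := @dqs_pointwise R n hbar (unit_steps qs)
    (fun k => dq hbar (harmonic k) (unit_shift R a) g) (fun x => c * gen a g x).
  rewrite (_ : (fun k => cabs (dqs (unit_steps (qk k)) g x - _)) =
    (fun k => cabs (dqs (unit_steps qs) (dq hbar (harmonic k) (unit_shift R a) g) x -
      dqs (unit_steps qs) (fun x => c * gen a g x) x))); last by apply/funext => k; rewrite E.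
  apply=> y; apply: dq_gen => // [k|]; first by rewrite gt_eqF.
  exact: cvg_harmonic.
have lim : N2 (dqs (unit_steps (qk k)) g) @[k --> \oo] -->
    N2 (dqs (unit_steps qs) (fun x => c * gen a g x)).
  apply: (@intV_cvg _ _ (cn * K1 * K1) (fun k x => sqn (dqs (unit_steps (qk k)) g x))).
  - move=> k; apply: dom_sqn; apply: Bnd_le (Gk k).
    by apply: le_trans (ler_norm _) _; rewrite lerDl.
  - by apply: dom_sqn; apply: Bnd_le lL; apply: le_trans (ler_norm _) _; rewrite lerDr.
  - by move=> x; apply: cvg_sqn; exact: pw.
have le1 : N2 (dqs (unit_steps qs) (fun x => c * gen a g x)) <= (1 + hbar ^+ 2) ^+ size ws * B.
  rewrite -(cvg_lim (@Rhausdorff R) lim); apply: limr_le; first by apply/cvg_ex; eexists; exact: lim.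
  by near=> k; exact: Ik.
have fS' := schw_dqs ler01 (steps_unit szq' qsP) (schw_gen a gS).
move: le1; rewrite dqsZ N2Z// => le1.
(* [sqn c] is [hbar ^- 2] or 1 according to the kind of generator; the factor [1 + hbar ^+ 2] undoes
   both. *)
have c1 : 1 <= (1 + hbar ^+ 2) * sqn c.
  rewrite /c; case: (a) => j /=; rewrite /sqn !creimE.
    rewrite (_ : _ ^+ 2 + _ ^+ 2 = hbar^-1 ^+ 2); last by ring.
    rewrite exprVn mulrDl mul1r mulfV ?lerDr ?invr_ge0 ?sqr_ge0//.
    by rewrite expf_eq0/= gt_eqF.
  rewrite (_ : _ ^+ 2 + _ ^+ 2 = 1); last by ring.
  by rewrite mulr1 lerDl sqr_ge0.
have N0 := N2_ge0 fS'.
apply: (@le_trans _ _ ((1 + hbar ^+ 2) * sqn c * N2 (dqs (unit_steps qs) (gen a g)))).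
  by rewrite ler_peMl.
rewrite [in leRHS]exprS -!mulrA ler_wpM2l// addr_ge0 ?sqr_ge0//.
Unshelve. all: end_near. Qed.

(** From quotients to words by [N2_dqs_words], from words to pointwise bounds by Sobolev, which uses
    up [3 n] of the orders. *)
Lemma Bnd_of_dqs k B f : schw f ->
  (forall qs, (size qs <= k + 3 * size (enum 'I_n))%N -> (forall q, q \in qs -> 0 < q.1 <= 1) ->
    N2 (dqs (unit_steps qs) f) <= B) ->
  Bnd k (intV (weight (enum 'I_n)) + 2 * (4 ^+ size (enum 'I_n) *
    ((1 + hbar ^+ 2) ^+ (k + 3 * size (enum 'I_n)) * B))) f.
Proof.
move=> fS HB; apply: EB_Bnd => //; apply: EB_words => ws wsm.
have := N2_dqs_words fS HB (ws := ws) (qs := [::]); rewrite add0n => /(_ wsm) H.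
apply: le_trans (H _) _ => //.
have B0 : 0 <= B.
  by apply: le_trans (HB [::] _ _) => //; exact: N2_ge0.
by rewrite ler_wpM2r// ler_weXn2l// lerDl sqr_ge0.
Qed.

End EnergyLimits.

Section LocalBound.
Variables (R : realType) (n : nat) (hbar : R) (M : 'M[R]_(n + n)).
Hypotheses (hbar_gt0 : 0 < hbar) (Msym : M^T = M).
Local Notation C := R[i].
Local Notation V := 'cV[R]_n.
Local Notation P := 'cV[R]_(n + n).
Local Notation re := (@complex.Re R).
Local Notation im := (@complex.Im R).
Implicit Types (f g : V -> C) (x y : V) (K L Q h : R) (c : C) (z : P) (s t r : R) (ps : seq (R * P)).
Local Notation Hop := (Hop hbar M).
Local Notation gsol := (gsol hbar M).
Local Notation ci := (ci hbar).
Local Notation dqs := (dqs hbar).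
Local Notation n2 := (size (enum 'I_n)).*2.
Local Notation cn := (2 ^+ size (enum 'I_n) : R).
Local Notation X := (Jmx R n *m M).
Local Notation W := (weight (enum 'I_n)).

Definition flow s r : 'M[R]_(n + n) := expmx ((r - s) *: X).

Lemma flow0 s : flow s s = 1%:M.
Proof. by rewrite /flow subrr expmx0. Qed.

Lemma is_derive_flow s z r i :
  is_derive r (1 : R) (fun r => (flow s r *m z) i 0) ((X *m (flow s r *m z)) i 0).
Proof.
have E q : (flow s q *m z) i 0 = \sum_j flow s q i j * z j 0 by rewrite mxE.
rewrite (_ : (fun r => _) = \sum_j (fun q => flow s q i j * z j 0)); last first.
  by apply/funext => q; rewrite fct_sumE E.
rewrite mulmxA mxE; apply: is_derive_sum => j.
have d1 : is_derive r (1 : R) (fun q => q - s) 1.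
  by apply: is_derive_eq; rewrite subr0.
have d2 := @is_derive1_comp R _ (fun q => q - s) r _ _ (is_derive_expmx X (r - s) i j) d1.
rewrite /flow (_ : (fun q => _) = (fun q => z j 0 * ((fun r => expmx (r *: X) i j) \o (fun q => q - s)) q)); last first.
  by apply/funext => q; rewrite mulrC.
by apply: is_derive_eq; rewrite /GRing.scale/= mulr1 mulrC.
Qed.

Lemma gsol_dq s t h u (z : R -> P) : s < t ->
  (forall r i, is_derive r (1 : R) (fun r => z r i 0) ((X *m z r) i 0)) ->
  gsol s t u -> gsol s t (fun r => dq hbar h (z r) (u r)).
Proof.
move=> st zd uG.
have hzd r i : is_derive r (1 : R) (fun r => (h *: z r) i 0) ((X *m (h *: z r)) i 0).
  rewrite -scalemxAr mxE (_ : (fun r => _) = fun r => h * z r i 0); last first.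
    by apply/funext => q; rewrite mxE.
  by have := zd r i => zri; apply: is_derive_eq.
have G := gsolZ (h^-1)%:C (gsolD (gsol_weyl hbar_gt0 Msym hzd st uG) (gsolZ (-1) uG)).
rewrite (_ : (fun r => _) = fun r x => (h^-1)%:C * (weyl hbar (h *: z r) (u r) x + -1 * u r x)) //.
by apply/funext => r; apply/funext => x; rewrite mulN1r.
Qed.

(** With its shifts carried along the flow, an iterated quotient of a solution is again a solution.
    Its norm at one time is therefore its norm at any other, which is how regularity travels in
    time. *)
Definition transport s r ps := [seq (p.1, flow s r *m p.2) | p <- ps].

Lemma transport0 s ps : transport s s ps = ps.
Proof. by elim: ps => //= -[h z] ps ->; rewrite flow0 mul1mx. Qed.

Lemma gsol_dqs s t r0 ps u : s < t -> gsol s t u ->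
  gsol s t (fun r => dqs (transport r0 r ps) (u r)).
Proof.
move=> st uG; elim: ps => //= p ps IH.
exact: (gsol_dq p.1 st (is_derive_flow r0 p.2) IH).
Qed.

Lemma N2_dqs_transport s t ps u : s < t \/ t < s -> gsol (Num.min s t) (Num.max s t) u ->
  N2 (dqs ps (u s)) = N2 (dqs (transport s t ps) (u t)).
Proof.
move=> [st|ts].
  rewrite (min_idPl (ltW st)) (max_idPr (ltW st)) => uG.
  by have := N2_conserved Msym (gsol_dqs s ps st uG) st; rewrite transport0.
rewrite (min_idPr (ltW ts)) (max_idPl (ltW ts)) => uG.
by have := N2_conserved Msym (gsol_dqs s ps ts uG) ts; rewrite transport0.
Qed.

Variable u : R -> V -> C.
Hypothesis u_schw : forall t, schw (u t).
Hypothesis u_derive : forall x t, cis_derive (fun r => u r x) t (ci * Hop (u t) x).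

Lemma cvg_solution x r (rk : nat -> R) : rk k @[k --> \oo] --> r ->
  cabs (u (rk k) x - u r x) @[k --> \oo] --> (0 : R).
Proof.
by move=> rkr; exact: (cis_derive_cvg (u_derive x r) rkr).
Qed.

Lemma gsol_solution s t K : (forall r, s <= r <= t -> Bnd n2.+3 K (u r)) -> gsol s t u.
Proof.
by move=> uK; split; [exists K|move=> x r _; exact: u_derive|move=> x r rk _ _; exact: cvg_solution].
Qed.

Local Notation KK := (n2.+3 + 3 * size (enum 'I_n))%N.

(** The condition is pointwise because the values of a solution are known to be continuous in time
    while [N2] is not; a non-strict pointwise bound defines a closed set. Integrated, it bounds [N2]
    by [N] times the integral of the weight. [KK] is the number of orders wanted plus those lost in
    the Sobolev inequality. *)
Let E0 Q (N : nat) : set R := [set t | forall ps x, steps Q KK ps ->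
  sqn (dqs ps (u t) x) <= N%:R * W x].

Let E0_closed Q N : closed (E0 Q N).
Proof.
move=> t Et ps x psP.
have cts : continuous (fun r => sqn (dqs ps (u r) x)).
  move=> r; apply/cvg_nbhs_seq => rk rkr.
  apply: cvg_sqn; apply: dqs_pointwise => y; exact: cvg_solution.
have cl : closed [set r | sqn (dqs ps (u r) x) <= N%:R * W x].
  have := @closed_comp _ _ (fun r => sqn (dqs ps (u r) x)) [set b | b <= N%:R * W x].
  by apply=> [r _|]; [exact: cts|exact: closed_le].
apply: cl; apply: closureS Et => r Er; exact: Er.
Qed.

Let E0_cover Q t : 0 <= Q -> exists N, E0 Q N t.
Proof.
move=> Q0; have [B B0 HB] := Bnd_dqs n hbar_gt0 n2 KK Q0.
have [K uK] := u_schw t (n2 + KK)%N.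
have [N HN] : exists N : nat, (cn * (B * K)) ^+ 2 <= N%:R.
  by exists (Num.trunc ((cn * (B * K)) ^+ 2)).+1; apply/ltW/truncnS_gt.
exists N => ps x psP; have H := Bnd_weight x (HB _ _ _ psP uK).
apply: le_trans (sqn_le_cabs _) _.
have W0 := weight_gt0 (enum 'I_n) x; have W1 := weight_le1 (enum 'I_n) x.
have c0 := cabs_ge0 (dqs ps (u t) x).
apply: (@le_trans _ _ ((cn * (B * K)) ^+ 2 * W x ^+ 2)).
  by rewrite -exprMn lerXn2r// nnegrE// (le_trans c0).
have H2 : W x ^+ 2 <= W x by rewrite expr2 ler_piMl// ltW.
by apply: le_trans (ler_wpM2l (sqr_ge0 _) H2) _; rewrite ler_wpM2r// ltW.
Qed.

(** Propagation: quotients at time [s] have the norms of the transported ones at time [t], which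
    membership in [E0 Q N] controls. The bound between the two times only makes the conservation law
    applicable and does not enter the constant. *)
Lemma solution_bounded a b : a <= b -> exists K, forall t, a <= t <= b -> Bnd n2.+3 K (u t).
Proof.
(* This bounds the flow over times up to 1, the range required by propagation. *)
have [Q0 HQ0] := expmx_bounded X.
pose Q := Num.max 0 Q0.
have Q_ge0 : 0 <= Q by rewrite le_max lexx.
apply: (@locally_bounded_of_propagation _ (fun K t => Bnd n2.+3 K (u t)) (E0 Q)).
- by move=> K L t KL; exact: Bnd_le.
- by move=> t; exact: u_schw.
- by move=> N; exact: E0_closed.
- by move=> t; exact: E0_cover.
move=> N; eexists => s t st1 Et [K HK].
apply: (Bnd_of_dqs hbar_gt0 (B := N%:R * intV W)) => // qs qsm qsP.
have moved p : p \in transport s t (unit_steps qs) -> 0 < p.1 <= 1 /\ forall i, `|p.2 i 0| <= Q.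
  move=> /mapP[p' /mapP[q qqs ->] ->] /=; split; first exact: qsP.
  move=> i; rewrite mxE.
  (* The unit shift is a basis vector, so its transport is a column of the flow. *)
  have [j0 j0E] : exists j0, unit_shift R q.2 = delta_mx j0 0 by case: (q.2) => j; eexists.
  rewrite (bigD1 j0)//= big1 => [|j jj0]; last by rewrite j0E mxE (negbTE jj0) mulr0.
  rewrite j0E mxE !eqxx mulr1 addr0 le_max; apply/orP; right; apply: HQ0.
  by rewrite distrC.
have mst : steps Q KK (transport s t (unit_steps qs)) by split; [rewrite /transport (size_map _ (unit_steps qs)) (size_map _ qs)|exact: moved].
have -> : N2 (dqs (unit_steps qs) (u s)) = N2 (dqs (transport s t (unit_steps qs)) (u t)).
  have [->|st] := eqVneq s t; first by rewrite transport0.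
  apply: N2_dqs_transport; last exact: gsol_solution HK.
  by apply/orP; rewrite -neq_lt.
have [B _ HB] := Bnd_dqs n hbar_gt0 n2 KK Q_ge0.
have [L uL] := u_schw t (n2 + KK)%N.
rewrite /N2 -(intVZ _ (domV_weight R n)).
apply: (le_intV (dom_sqn (HB _ _ _ mst uL)) (domZ _ (domV_weight R n))) => x.
exact: Et.
Qed.

Lemma gsol_all s t : s <= t -> gsol s t u.
Proof. by move=> /solution_bounded[K HK]; exact: gsol_solution HK. Qed.

End LocalBound.

(** * The uncertainty principle *)

Section GaussianDensity.
Variables (R : realType) (n : nat).
Local Notation V := 'cV[R]_n.
Local Notation W := (weight (enum 'I_n)).
Implicit Types (x y : V) (c : R).

Lemma dot_ge0 x : 0 <= dot x x.
Proof. by apply: sumr_ge0 => i _; rewrite -expr2 sqr_ge0. Qed.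

Lemma continuous_dot (a b : V -> V) : (forall i, continuous (fun x => a x i 0)) ->
  (forall i, continuous (fun x => b x i 0)) -> continuous (fun x => dot (a x) (b x)).
Proof.
move=> ca cb; rewrite /dot; elim: (index_enum _) => [|i r IH].
  by under eq_fun do rewrite big_nil; exact: continuous_cst.
under eq_fun do rewrite big_cons.
by apply: continuous_add => //; exact: continuous_mul.
Qed.

Lemma continuous_coord i : continuous (fun x : V => x i 0).
Proof. by move=> x; apply: differentiable_continuous; exact: differentiable_coord. Qed.

Lemma gauss_le_weightV c : 0 < c -> exists2 D, 0 <= D & forall x, expR (- (c * dot x x)) <= D * W x.
Proof.
move=> c0; have [D HD] := gauss_le_weight 0 c0.
have HD1 s : expR (- (c * s ^+ 2)) <= D * cauchy_weight s by have := HD s; rewrite expr0 mul1r.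
have D0 : 0 <= D.
  by have := HD1 0; rewrite expr0n mulr0 oppr0 expR0 /cauchy_weight expr0n addr0 invr1 mulr1; lra.
exists (D ^+ size (enum 'I_n)); first exact: exprn_ge0.
move=> x; rewrite /dot /weight -[index_enum _]enumT.
elim: (enum 'I_n) => [|i r IH]; first by rewrite !big_nil mulr0 oppr0 expR0 expr0 mul1r.
rewrite !big_cons mulrDr opprD expRD /= exprS mulrACA.
by apply: ler_pM; rewrite ?expR_ge0// -expr2.
Qed.

Lemma even_series_le (r : R) N : \sum_(0 <= k < N) r ^+ k.*2 / k.*2`!%:R <= expR `|r|.
Proof.
apply: le_trans (series_exp_le N.*2 (normr_ge0 r)).
elim: N => [|N IH]; first by rewrite !big_nil.
rewrite big_nat_recr//= doubleS big_nat_recr//= big_nat_recr//=.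
rewrite -addrA; apply: lerD => //; apply: ler_wpDr.
  by rewrite divr_ge0 ?exprn_ge0.
by rewrite -mul2n !exprM real_normK ?num_real.
Qed.

Variables (p : V -> R) (v : V) (D c theta q : R).
Hypotheses (cp : continuous p) (p_ge0 : forall x, 0 <= p x)
  (c_gt0 : 0 < c) (theta_gt0 : 0 < theta) (q_gt0 : 0 < q) (q_lt1 : q < 1).
Hypothesis p_le : forall x, p x <= D * expR (- (c * dot x x)).
Hypothesis v_le : forall x, dot v x ^+ 2 <= theta * dot x x.

(** From [|s r| <= a s^2 + r^2 / (4 a)] with [r = dot v x]: for this [a] the last term is at most
    [c q |x|^2], and the fraction [1 - q] of the Gaussian is left for integrability. *)
Let a := theta / (4 * c * q).
Let a_gt0 : 0 < a. Proof. by rewrite divr_gt0 ?mulr_gt0. Qed.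

Let D_ge0 : 0 <= D.
Proof. by rewrite -(pmulr_lge0 _ (expR_gt0 (- (c * dot (0 : V) 0)))) (le_trans (p_ge0 0)). Qed.

Let cv : continuous (dot v).
Proof.
by apply: continuous_dot => i; [exact: continuous_cst|exact: continuous_coord].
Qed.

Let dom_density : exists2 B, 0 <= B & forall s (g : V -> R), continuous g ->
  (forall x, `|g x| <= expR `|s * dot v x|) ->
  domV (B * expR (a * s ^+ 2)) (fun x => p x * g x).
Proof.
have c1 : 0 < c * (1 - q) by rewrite mulr_gt0// subr_gt0.
have [E E0 HE] := gauss_le_weightV c1.
exists (D * E); first by rewrite mulr_ge0.
move=> s g cg gle; split; first exact: continuous_mul.
move=> x; rewrite normrM (ger0_norm (p_ge0 x)).
have H : `|s * dot v x| <= a * s ^+ 2 + c * q * dot x x.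
  have a4 : 0 < 4 * a by rewrite mulr_gt0.
  set r := dot v x; have h1 : r ^+ 2 / (4 * a) <= c * q * dot x x.
    rewrite ler_pdivrMr//; apply: le_trans (v_le x) _.
    by rewrite /a le_eqVlt; apply/orP; left; apply/eqP; field; rewrite !gt_eqF.
  apply: (@le_trans _ _ (a * s ^+ 2 + r ^+ 2 / (4 * a))); last by rewrite lerD2l.
  rewrite -(ler_pM2r a4) (_ : (_ + _) * (4 * a) = 4 * a ^+ 2 * s ^+ 2 + r ^+ 2); last first.
    by field; rewrite gt_eqF.
  rewrite normrM.
  have := sqr_ge0 (2 * a * `|s| - `|r|).
  by rewrite -[s ^+ 2]real_normK ?num_real// -[r ^+ 2]real_normK ?num_real//; nra.
apply: (@le_trans _ _ (D * expR (- (c * dot x x)) * expR (a * s ^+ 2 + c * q * dot x x))).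
  apply: ler_pM; [exact: p_ge0|exact: normr_ge0|exact: p_le|].
  by apply: le_trans (gle x) _; rewrite ler_expR.
rewrite -[leLHS]mulrA -expRD (_ : - (c * dot x x) + _ = a * s ^+ 2 + - (c * (1 - q) * dot x x)); last by ring.
rewrite expRD (_ : D * E * _ * _ = D * (expR (a * s ^+ 2) * (E * W x))); last by ring.
by rewrite ler_wpM2l// ler_wpM2l ?expR_ge0.
Qed.

(** The [m k] of [hardy_real] are the even moments of [dot v x] divided by [(2 k)!]. They are
    nonnegative because [p] is, and their alternating series sums to the integral against the
    cosine. *)
Lemma density_eq0 (C b : R) : a < b ->
  (forall s, `|intV (fun x => p x * cos (s * dot v x))| <= C * expR (- (b * s ^+ 2))) ->
  intV p = 0.
Proof.
move=> ab Hf; have [B B0 HB] := dom_density.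
pose om k s x : R := (s * dot v x) ^+ k.*2 / k.*2`!%:R.
have om0 k s x : 0 <= om k s x by rewrite divr_ge0// -mul2n exprM exprn_ge0// sqr_ge0.
have com k s : continuous (om k s).
  have cX m : continuous (fun x => (s * dot v x) ^+ m).
    elim: m => [|m IH]; first by under eq_fun do rewrite expr0; exact: continuous_cst.
    under eq_fun do rewrite exprS.
    by apply: continuous_mul => //; apply: continuous_mul => //; exact: continuous_cst.
  by apply: continuous_mul => //; exact: continuous_cst.
have omle k s x : om k s x <= expR `|s * dot v x|.
  apply: le_trans (even_series_le (s * dot v x) k.+1).
  by rewrite big_nat_recr//= ler_wpDl// sumr_ge0// => i _; exact: om0.
have domm k s : domV (B * expR (a * s ^+ 2)) (fun x => p x * om k s x).
  by apply: HB => [|x]; [exact: com|rewrite ger0_norm ?om0//; exact: omle].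
pose m k := intV (fun x => p x * om k 1 x).
have omS k s x : om k s x = om k 1 x * s ^+ k.*2.
  by rewrite /om mul1r exprMn; ring.
have mS k s (e : R) : e * m k * s ^+ k.*2 = intV (fun x => (e * s ^+ k.*2) * (p x * om k 1 x)).
  by rewrite (intVZ _ (domm k 1)) /m; ring.
(* Used with [e = 1] for the growth of the moments and with alternating signs for the Taylor series
   of the cosine. *)
have sumE s (e : nat -> R) N : (forall k, `|e k| <= 1) ->
  exists2 F : V -> R, continuous F & [/\ forall x, `|F x| <= expR `|s * dot v x|,
    forall x, F x = \sum_(0 <= k < N) e k * om k s x &
    \sum_(0 <= k < N) e k * m k * s ^+ k.*2 = intV (fun x => p x * F x)].
  move=> e1; exists (fun x => \sum_(0 <= k < N) e k * om k s x).
    elim: (index_iota 0 N) => [|k r IH]; first by under eq_fun do rewrite big_nil; exact: continuous_cst.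
    under eq_fun do rewrite big_cons; apply: continuous_add => //.
    by apply: continuous_mul => //; exact: continuous_cst.
  split=> // [x|].
    apply: le_trans (ler_norm_sum _ _ _) _; apply: le_trans (even_series_le _ N).
    by apply: ler_sum => k _; rewrite normrM (ger0_norm (om0 _ _ _)) ler_piMl// om0.
  have [_ H] := @intV_sum R n nat (index_iota 0 N) _ (fun k x => (e k * s ^+ k.*2) * (p x * om k 1 x))
    (fun k => domZ (e k * s ^+ k.*2) (domm k 1)).
  under eq_bigr do rewrite mS; rewrite -H; congr intV; apply/funext => x.
  by rewrite mulr_sumr; apply: eq_bigr => k _; rewrite (omS k s); ring.
have Wint : (0 : R) <= intV W.
  have d0 := domV_weight R n.
  have := le_intV (domZ 0 d0) d0 (fun x => _); rewrite (intVZ _ d0) mul0r; apply => x.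
  by rewrite mul0r ltW// weight_gt0.
have C0 : 0 <= C by have := Hf 0; rewrite expr0n mulr0 oppr0 expR0 mulr1; exact: le_trans.
pose f s := intV (fun x => p x * cos (s * dot v x)).
have ccos s : continuous (fun x => cos (s * dot v x)).
  move=> x; apply: (@continuous_comp _ _ _ (fun x => s * dot v x) cos); last exact: continuous_cos.
  by apply: continuous_mul; [exact: continuous_cst|exact: cv].
have cosle s x : `|cos (s * dot v x)| <= expR `|s * dot v x|.
  apply: (@le_trans _ _ 1); first by rewrite ler_norml cos_geN1 cos_le1.
  by rewrite -expR0 ler_expR.
have domc s := HB s _ (ccos s) (cosle s).
have cf : continuous f.
  move=> s; apply/cvg_nbhs_seq => sk sks.
  (* Continuity needs a domination uniform in the frequency: [|cos| <= 1] is what [dom_density] asks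
     at [s = 0]. *)
  have domk r : domV (B * expR (a * 0 ^+ 2)) (fun x => p x * cos (r * dot v x)).
    by apply: HB => // x; rewrite mul0r normr0 expR0 ler_norml cos_geN1 cos_le1.
  apply: (intV_cvg (fun k => domk (sk k)) (domk s)).
  move=> x; apply: cvgM; first exact: cvg_cst.
  apply: (@cvg_comp _ _ _ (fun k => sk k * dot v x) cos _ (nbhs (s * dot v x))).
    by apply: cvgM => //; exact: cvg_cst.
  exact: continuous_cos.
have m0E : m 0%N = intV p.
  by congr intV; apply/funext => x; rewrite /om expr0 fact0 invr1 !mulr1.
rewrite -m0E.
apply: (@hardy_real R f m (C + B * intV W) a b cf a_gt0 ab).
- move=> s; apply: le_trans (Hf s) _; rewrite ler_wpM2r ?expR_ge0// lerDl mulr_ge0//.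
- move=> k; apply: le_trans (_ : 0 <= intV (fun x => 0 * (p x * om k 1 x))) _.
    by rewrite (intVZ _ (domm k 1)) mul0r.
  by apply: (le_intV (domZ 0 (domm k 1)) (domm k 1)) => x; rewrite mul0r mulr_ge0.
- move=> s N; have [F cF [Fle FE HF]] := sumE s (fun=> 1) N (fun=> ltac:(by rewrite normr1)).
  rewrite (_ : \sum_(0 <= k < N) m k * _ = \sum_(0 <= k < N) 1 * m k * s ^+ k.*2); last first.
    by apply: eq_bigr => k _; rewrite mul1r.
  rewrite HF; apply: le_trans (le_intV_weight (HB s F cF Fle)) _.
  rewrite mulrAC ler_wpM2r ?expR_ge0// lerDr//.
- move=> s.
  have e1 k : `|(-1) ^+ k : R| <= 1 by rewrite normrX normrN1 expr1n.
  have /choice[F HF] : forall N, exists F : V -> R, [/\ continuous F, forall x, `|F x| <= expR `|s * dot v x|,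
    forall x, F x = \sum_(0 <= k < N) (-1) ^+ k * om k s x &
    \sum_(0 <= k < N) (-1) ^+ k * m k * s ^+ k.*2 = intV (fun x => p x * F x)].
    by move=> N; have [F ? [? ? ?]] := sumE s (fun k => (-1) ^+ k) N e1; exists F.
  rewrite (_ : (fun N => _) = fun N => intV (fun x => p x * F N x)); last first.
    by apply/funext => N; case: (HF N).
  apply: (@intV_cvg _ _ (B * expR (a * s ^+ 2)) (fun N x => p x * F N x)) => [N||x].
  + by case: (HF N) => ? ? _ _; exact: HB.
  + exact: domc.
  apply: cvgM; first exact: cvg_cst.
  rewrite (_ : (fun N => F N x) = series (cos_coeff' (s * dot v x))); first exact: cvg_cos_coeff'.
  apply/funext => N; case: (HF N) => _ _ -> _; apply: eq_bigr => k _.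
  by rewrite /om /cos_coeff' mulrA.
Qed.

End GaussianDensity.

Section QuadraticForms.
Variables (R : realType) (m : nat).
Implicit Types (A : 'M[R]_m) (x y : 'cV[R]_m).

Lemma dotDl x y z : dot (x + y) z = dot x z + dot y z.
Proof. by rewrite /dot -big_split/=; apply: eq_bigr => i _; rewrite mxE mulrDl. Qed.

Lemma dotDr x y z : dot z (x + y) = dot z x + dot z y.
Proof. by rewrite /dot -big_split/=; apply: eq_bigr => i _; rewrite mxE mulrDr. Qed.

Lemma dotC x y : dot x y = dot y x.
Proof. by apply: eq_bigr => i _; rewrite mulrC. Qed.

Lemma dotNl x y : dot (- x) y = - dot x y.
Proof. by rewrite -scaleN1r dotZl mulN1r. Qed.

Lemma dotNr x y : dot y (- x) = - dot y x.
Proof. by rewrite dotC dotNl dotC. Qed.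

Lemma sym_quadratic_inj A B : A^T = A -> B^T = B ->
  (forall x, dot (A *m x) x = dot (B *m x) x) -> A = B.
Proof.
move=> As Bs H; apply/matrixP => i j.
have E (Z : 'M[R]_m) : dot (Z *m (delta_mx i 0 + delta_mx j 0)) (delta_mx i 0 + delta_mx j 0) =
    Z i i + Z i j + Z j i + Z j j.
  by rewrite mulmxDr dotDl !dotDr !dot_delta -!colE !mxE; ring.
have E1 (Z : 'M[R]_m) k : dot (Z *m delta_mx k 0) (delta_mx k 0) = Z k k.
  by rewrite dot_delta -colE mxE.
have := H (delta_mx i 0 + delta_mx j 0); rewrite !E.
have := H (delta_mx i 0); have := H (delta_mx j 0); rewrite !E1.
have : A j i = A i j by rewrite -[in LHS]As mxE.
have : B j i = B i j by rewrite -[in LHS]Bs mxE.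
lra.
Qed.

(** The square of [x - (v.x) v] is nonnegative, and for [|v| <= 1] it is at most
    [|x|^2 - (v.x)^2]. *)
Lemma dot_sqr_le (v x : 'cV[R]_m) : dot v v <= 1 -> dot v x ^+ 2 <= dot x x.
Proof.
move=> v1; have := dot_ge0 (x + - (dot v x *: v)).
rewrite dotDl !dotDr !dotNl !dotNr !dotZl !dotZr (dotC x v).
have := sqr_ge0 (dot v x); rewrite !expr2; nra.
Qed.

Lemma enorm_sqr x : enorm x ^+ 2 = dot x x.
Proof. by rewrite /enorm sqr_sqrtr// dot_ge0. Qed.

End QuadraticForms.

Section Bridge.
Variables (R : realType) (n : nat) (hbar : R).
Hypothesis hbar_gt0 : 0 < hbar.
Local Notation C := R[i].
Local Notation V := 'cV[R]_n.
Local Notation J := (Jmx R n).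

Lemma JmxK : J *m J = - 1%:M.
Proof.
rewrite /Jmx mulmx_block !mul0mx !mulmx0 !mulmx1 !mul1mx !addr0 !add0r.
by rewrite scalar_mx_block opp_block_mx oppr0.
Qed.

(** The relation defining [in_sp] says that [- J X] is symmetric. A symmetric matrix is determined
    by its quadratic form, so this is the matrix used in the quantization, and [J J = - 1] recovers
    [X]. *)
Lemma weyl_hamiltonian (X : 'M[R]_(n + n)) Hhat : in_sp X ->
  weyl_quantization hbar (hamiltonian X) Hhat ->
  exists M : 'M[R]_(n + n), [/\ M^T = M, X = J *m M & forall f x, Hhat f x = Hop hbar M f x].
Proof.
move=> Xsp [M [Msym HM HhatE]]; exists M; split=> //.
have JT : J^T = - J by rewrite /Jmx tr_block_mx !trmx0 linearN/= !trmx1 opp_block_mx oppr0 opprK.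
have XJ : X *m J = - (J *m X^T) by apply/eqP; rewrite -addr_eq0; apply/eqP.
have JXsym : (- (J *m X))^T = - (J *m X).
  rewrite linearN/= trmx_mul JT mulmxN opprK.
  have <- : J *m (X *m J) *m J = - (J *m X).
    by rewrite mulmxA -(mulmxA (J *m X)) JmxK mulmxN mulmx1.
  by rewrite XJ mulmxN mulmxA JmxK !mulNmx mul1mx opprK.
have -> : M = - (J *m X).
  apply: sym_quadratic_inj => // z; have := HM z; rewrite /hamiltonian mulNmx dotNl.
  by move=> H; lra.
by rewrite mulmxN mulmxA JmxK mulNmx mul1mx opprK.
Qed.

Lemma solution_cis_derive M Hhat (u : V -> R -> C) :
  (forall f x, Hhat f x = Hop hbar M f x) -> schrodinger_solution hbar Hhat u ->
  forall x t, cis_derive (fun r => u x r) t (ci hbar * Hop hbar M (u ^~ t) x).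
Proof.
move=> HhatE [_ us] x t; have [[d1 d2] E] := us x t.
have -> : ci hbar * Hop hbar M (u ^~ t) x = cderive (u x) t.
  rewrite -HhatE -E mulrA (_ : ci hbar * ('i * hbar%:C) = 1) ?mul1r//.
  by rewrite /ci; apply: cplx_eq; rewrite !creimE; field; rewrite gt_eqF.
by split; rewrite /cderive/= derive1E; exact: derivableP.
Qed.

End Bridge.

(** * Correlation of a solution with its Weyl translates *)

Section Uncertainty.
Variables (R : realType) (n : nat) (hbar : R) (M : 'M[R]_(n + n)).
Hypotheses (hbar_gt0 : 0 < hbar) (Msym : M^T = M).
Local Notation C := R[i].
Local Notation V := 'cV[R]_n.
Local Notation P := 'cV[R]_(n + n).
Local Notation re := (@complex.Re R).
Local Notation im := (@complex.Im R).
Implicit Types (f g : V -> C) (x y v : V) (s t r : R).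
Local Notation W := (weight (enum 'I_n)).
Local Notation cn := (2 ^+ size (enum 'I_n) : R).
Local Notation n2 := (size (enum 'I_n)).*2.
Local Notation weyl := (weyl hbar).

Variable u : R -> V -> C.
Hypothesis u_schw : forall t, schw (u t).
Hypothesis u_derive : forall x t, cis_derive (fun r => u r x) t (ci hbar * Hop hbar M (u t) x).

Let uG s t : s < t -> gsol hbar M s t u.
Proof. by move=> st; apply: gsol_all => //; exact: ltW. Qed.

Lemma N2_constant (v : R -> V -> C) : (forall s t, s < t -> gsol hbar M s t v) ->
  forall s t, N2 (v s) = N2 (v t).
Proof.
move=> vG s t; have [st|ts|->//] := ltgtP s t.
  exact: N2_conserved (vG _ _ st) st.
by rewrite (N2_conserved Msym (vG _ _ ts) ts).
Qed.

Lemma schw_weyl z f : schw f -> schw (weyl z f).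
Proof.
move=> fS k; have [K fK] := fS k.
pose Q := \sum_i `|z i 0|.
have zQ i : `|z i 0| <= Q by rewrite /Q (bigD1 i)//= lerDl sumr_ge0.
have Q0 : 0 <= Q by exact: sumr_ge0.
have q0 : 0 <= Q + Q / hbar by rewrite addr_ge0// divr_ge0// ltW.
exists (2 * (1 + (Q + Q / hbar)) ^+ k * K); apply: Bnd_rho => // a.
exact: cabs_shiftc.
Qed.

Lemma intV_ip f g : schw f -> schw g ->
  intV (fun x => ip (f x) (g x)) = (N2 f + N2 g - N2 (fun x => f x + -1 * g x)) / 2.
Proof.
move=> fS gS; have [K fK] := fS n2; have [L gL] := gS n2.
have d := dom_ip fK gL; have df := dom_sqn fK; have dg := dom_sqn gL.
suff -> : N2 (fun x => f x + -1 * g x) = N2 f + (N2 g + -2 * intV (fun x => ip (f x) (g x))) by lra.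
rewrite /N2 -(intVZ _ d) -(intVD dg (domZ (-2) d)) -(intVD df (domD dg (domZ (-2) d))).
by congr intV; apply/funext => x; rewrite /ip /sqn !creimE; ring.
Qed.

Lemma correlation_conserved z s t :
  intV (fun x => ip (weyl z (u s) x) (u s x)) =
  intV (fun x => ip (weyl (flow M s t *m z) (u t) x) (u t x)).
Proof.
have wG a b : a < b -> gsol hbar M a b (fun r => weyl (flow M s r *m z) (u r)).
  by move=> ab; apply: (gsol_weyl hbar_gt0 Msym _ ab (uG ab)) => r i; exact: is_derive_flow.
have dG a b : a < b -> gsol hbar M a b (fun r x => weyl (flow M s r *m z) (u r) x + -1 * u r x).
  by move=> ab; apply: gsolD; [exact: wG|apply: gsolZ; exact: uG].
rewrite !intV_ip; try exact: schw_weyl; try exact: u_schw.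
by rewrite -(N2_constant wG s t) -(N2_constant uG s t) -(N2_constant dG s t) flow0 mul1mx.
Qed.

Variables (T alpha beta K : R) (v : V).
Hypotheses (alpha_gt0 : 0 < alpha) (beta_gt0 : 0 < beta) (K_gt0 : 0 < K).
Hypothesis u_0 : forall x, `|u 0 x| <= (K * expR (- (alpha * dot x x)))%:C.
Hypothesis u_T : forall x, `|u T x| <= (K * expR (- (beta * dot x x)))%:C.
Hypothesis v_le1 : dot v v <= 1.
Local Notation B := (ursubmx (flow M 0 T)).
Hypothesis large : 1 < 4 * hbar ^+ 2 * (alpha * beta) * dot (B *m v) (B *m v).

Let N := dot (B *m v) (B *m v).
Let Lam := 4 * hbar ^+ 2 * (alpha * beta) * N.
(* Any [q < 1] with [1 < Lam * q ^+ 2] would do. *)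
Let q := (Lam + 1) / (2 * Lam).
Let Lam_gt0 : 0 < Lam. Proof. exact: lt_trans large. Qed.
Let Lam2_gt0 : 0 < 2 * Lam. Proof. by apply: mulr_gt0 => //; exact: Lam_gt0. Qed.
Let q_gt0 : 0 < q. Proof. exact: divr_gt0 (addr_gt0 Lam_gt0 ltr01) Lam2_gt0. Qed.
Let q_lt1 : q < 1.
Proof.
rewrite /q ltr_pdivrMr; last exact: Lam2_gt0.
by rewrite mul1r [ltRHS]mulrDl mul1r ltrD2l; exact: large.
Qed.

(** The fraction [q] of the best rate [beta * N / 2]; the rest of the Gaussian stays available as an
    integrable factor in [x]. *)
Let b := beta * q * N / 2.
(** A pure momentum shift: nothing is translated at time 0, and only the density and a cosine remain
    in [correlation_0]. *)
Let kick s : P := col_mx 0 (s *: v).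

Let cabs_T x : cabs (u T x) <= 2 * K * expR (- (beta * dot x x)).
Proof.
have E0 : 0 <= K * expR (- (beta * dot x x)) by rewrite mulr_ge0 ?expR_ge0// ltW.
have E2 := mulr_ge0 (ler0n R 2) E0.
rewrite -[leRHS]mulrA -(@ler_pXn2r _ 2 isT) ?nnegrE ?cabs_ge0//.
apply: le_trans (cabs_le_sqn _) _; have := sqn_normr (u_T x).
by move: (sqn _) (K * _) E0 {E2} => S E E0 h; nra.
Qed.

Let correlation_0 s : intV (fun x => ip (weyl (kick s) (u 0) x) (u 0 x)) =
  intV (fun x => sqn (u 0 x) * cos (s * dot (hbar^-1 *: v) x)).
Proof.
congr intV; apply/funext => x.
rewrite /weyl /kick /rho col_mxKu col_mxKd subr0 /phase dot0r mul0r oppr0 addr0.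
have -> : hbar^-1 *: (s *: v) = s *: (hbar^-1 *: v) by rewrite !scalerA mulrC.
by rewrite dotZl /ip /sqn !creimE; ring.
Qed.

Let correlation_T : exists2 A, 0 <= A & forall s,
  `|intV (fun x => ip (weyl (flow M 0 T *m kick s) (u T) x) (u T x))| <= A * expR (- (b * s ^+ 2)).
Proof.
have c1 : 0 < beta * (1 - q) by rewrite mulr_gt0// subr_gt0.
have [E E0 HE] := gauss_le_weightV n c1.
(* A factor [2 * K] from each of the two copies of [u T], and 2 from the phase. *)
pose D := 8 * K ^+ 2 * E.
have K8 : 0 <= 8 * K ^+ 2 := mulr_ge0 (ler0n R 8) (sqr_ge0 K).
have D0 : 0 <= D := mulr_ge0 K8 E0.
exists `|D * intV W|; first exact: normr_ge0.
move=> s.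
have [L uL] := u_schw T n2; have [L' wL'] := schw_weyl (flow M 0 T *m kick s) (u_schw T) n2.
have [cf _] := dom_ip wL' uL.
pose y := usubmx (flow M 0 T *m kick s).
have yE : y = s *: (B *m v).
  rewrite /y /kick -[flow M 0 T]submxK mul_block_col col_mxKu block_mxKur mulmx0 add0r.
  by rewrite scalemxAr.
have dB : domV (D * expR (- (b * s ^+ 2))) (fun x => ip (weyl (flow M 0 T *m kick s) (u T) x) (u T x)).
  split=> // x; apply: le_trans (abs_ip _ _) _.
  have h1 : cabs (weyl (flow M 0 T *m kick s) (u T) x) <=
      2 * (2 * K * expR (- (beta * dot (x - y) (x - y)))).
    apply: le_trans (cabsM _ _) _; apply: ler_pM; rewrite ?cabs_ge0 ?cabs_phase//.
  apply: le_trans (ler_pM (cabs_ge0 _) (cabs_ge0 _) h1 (cabs_T x)) _.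
  rewrite [leLHS](_ : _ = 8 * K ^+ 2 *
    (expR (- (beta * dot (x - y) (x - y))) * expR (- (beta * dot x x)))); last by ring.
  rewrite -expRD.
  (* The part [beta * q] uses [|x - y|^2 + |x|^2 - |y|^2 / 2 = |2 x - y|^2 / 2], the part
     [beta * (1 - q)] only [|x - y|^2 >= 0]. *)
  have h2 : - (beta * dot (x - y) (x - y)) - beta * dot x x <=
      - (b * s ^+ 2) + - (beta * (1 - q) * dot x x).
    have yy : dot y y = s ^+ 2 * N by rewrite yE dotZl dotZr mulrA -expr2.
    have p1 : dot (x - y) (x - y) = dot x x - 2 * dot x y + dot y y.
      by rewrite dotDl !dotDr !dotNl !dotNr (dotC y x); ring.
    have p2 : dot (x + (x - y)) (x + (x - y)) = 4 * dot x x - 4 * dot x y + dot y y.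
      by rewrite !dotDl !dotDr !dotNl !dotNr (dotC y x); ring.
    have := dot_ge0 (x + (x - y)); have := dot_ge0 (x - y).
    have -> : b * s ^+ 2 = beta * q * (dot y y / 2) by rewrite yy /b; ring.
    have bq0 : 0 <= beta * q := ltW (mulr_gt0 beta_gt0 q_gt0).
    move: (ltW c1); rewrite p1 p2 (_ : beta * (1 - q) = beta - beta * q); last by ring.
    move: (beta * q) (dot x x) (dot x y) (dot y y) bq0 => r xx xy yy' r0 r1 h3 h4.
    have := mulr_ge0 r0 h4; have := mulr_ge0 r1 h3; lra.
  apply: (@le_trans _ _ (8 * K ^+ 2 * expR (- (b * s ^+ 2) + - (beta * (1 - q) * dot x x)))).
    by rewrite ler_wpM2l// ler_expR.
  rewrite expRD [leRHS](_ : _ = 8 * K ^+ 2 * (expR (- (b * s ^+ 2)) * (E * W x))); last first.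
    by rewrite /D; ring.
  by rewrite ler_wpM2l// ler_wpM2l ?expR_ge0.
have dB' := domZ (-1) dB.
have i1 := le_intV_weight dB; have i2 := le_intV_weight dB'.
rewrite (intVZ _ dB) normrN1 mul1r in i2.
apply: (@le_trans _ _ (D * intV W * expR (- (b * s ^+ 2)))); last first.
  by rewrite ler_wpM2r ?expR_ge0// ler_norm.
by rewrite mulrAC ler_norml; apply/andP; split; lra.
Qed.

Lemma solution_eq0 x t : u t x = 0.
Proof.
have [A A0 HA] := correlation_T.
have N0 : N2 (u 0) = 0.
  (* The density has rate [2 * alpha], and [v / hbar] has squared length at most [hbar ^- 2]. *)
  apply: (@density_eq0 R n (fun x => sqn (u 0 x)) (hbar^-1 *: v) (K ^+ 2) (2 * alpha) (hbar^-1 ^+ 2) q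
    _ _ _ _ _ _ _ _ A b) => //.
  - by apply: continuous_sqn => y; exact: schw_diff.
  - by move=> y; exact: sqn_ge0.
  - by rewrite mulr_gt0.
  - by rewrite exprn_gt0// invr_gt0.
  - move=> y; apply: le_trans (sqn_normr (u_0 y)) _.
    rewrite exprMn -[expR _ ^+ 2]expRM_natl ler_wpM2l ?sqr_ge0// ler_expR.
    by rewrite le_eqVlt; apply/orP; left; apply/eqP; ring.
  - by move=> y; rewrite dotZl exprMn ler_wpM2l ?sqr_ge0// dot_sqr_le.
  - have h2 : 0 < hbar ^+ 2 by rewrite exprn_gt0.
    (* After clearing denominators, [a < b] is [Lam * q ^+ 2 > 1]. With the chosen [q] the left side
       is [(Lam + 1)^2 / (4 Lam)], above 1 by the inequality of the means. *)
    have key (L : R) : 1 < L -> 1 < L * ((L + 1) / (2 * L)) ^+ 2.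
      move=> L1; have L0 : 0 < L by lra.
      rewrite (_ : L * _ = (L + 1) ^+ 2 / (4 * L)); last by field; rewrite gt_eqF.
      by rewrite ltr_pdivlMr ?mulr_gt0//; nra.
    have aq : 0 < 4 * (2 * alpha) * q by apply: mulr_gt0 => //; rewrite !mulr_gt0.
    rewrite ltr_pdivrMr// exprVn -[ltLHS]mul1r ltr_pdivrMr//.
    rewrite (_ : b * _ * _ = Lam * q ^+ 2); first exact: key large.
    by rewrite /b /Lam; field.
  - by move=> s; rewrite -correlation_0 (correlation_conserved _ 0 T).
have [L uL] := u_schw t n2.
have N1 : N2 (u t) = 0 by rewrite (N2_constant uG t 0).
by apply: sqn_eq0; apply: (intV_eq0 (dom_sqn uL) _ N1) => y; exact: sqn_ge0.
Qed.

End Uncertainty.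

(** Strictness leaves room below the supremum, so some vector of the unit ball already passes the
    threshold. *)
Lemma opnorm_attained (R : realType) (m n : nat) (A : 'M[R]_(m, n)) (c : R) : 0 <= c ->
  c < opnorm A ^+ 2 -> exists v : 'cV[R]_n, dot v v <= 1 /\ c < dot (A *m v) (A *m v).
Proof.
move=> c0 cA; pose S := [set enorm (A *m x) | x in [set x : 'cV[R]_n | enorm x <= 1]].
have S0 : S 0.
  exists 0; last by rewrite mulmx0 /enorm /dot big1 ?sqrtr0// => i _; rewrite mxE mul0r.
  by rewrite /= /enorm /dot big1 ?sqrtr0// => i _; rewrite mxE mul0r.
have A0 : 0 <= opnorm A.
  (* Without a supremum, [sup] takes the default value 0, and the inequality holds as well. *)
  rewrite /opnorm -/S; have [sS|/sup_out ->//] := pselect (has_sup S).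
  exact: ub_le_sup sS.2 _ S0.
have cs : Num.sqrt c < sup S.
  by rewrite -(sqr_sqrtr c0) ltr_pXn2r ?nnegrE ?sqrtr_ge0 in cA.
have [|_ [v /= v1 <-] cv] := sup_gt _ cs; first by exists 0.
exists v; rewrite -!enorm_sqr; split.
  by rewrite expr_le1 ?sqrtr_ge0.
by rewrite -(sqr_sqrtr c0) ltr_pXn2r ?nnegrE ?sqrtr_ge0.
Qed.

Unset Implicit Arguments.
Set Strict Implicit.
Set Printing Implicit Defensive.

Theorem theorem3p1 (R : realType) (n : nat) (n_ge1 : (1 <= n)%N)
  (hbar : R) (hbar_gt0 : 0 < hbar)
  (X : 'M[R]_(n + n)) (X_sp : in_sp X)
  (Hhat : ('cV[R]_n -> R[i]) -> 'cV[R]_n -> R[i])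
  (HhatE : weyl_quantization hbar (hamiltonian X) Hhat)
  (u : 'cV[R]_n -> R -> R[i])
  (u_sol : schrodinger_solution hbar Hhat u)
  (T alpha beta K : R)
  (alpha_gt0 : 0 < alpha) (beta_gt0 : 0 < beta) (K_gt0 : 0 < K)
  (u_0 : forall x, `|u x 0| <= (K * expR (- (alpha * enorm x ^+ 2)))%:C)
  (u_T : forall x, `|u x T| <= (K * expR (- (beta * enorm x ^+ 2)))%:C)
  (exp_free : \det (ursubmx (expmx (T *: X))) != 0)
  (large : 1 < (2 * hbar) ^+ 2 * opnorm (ursubmx (expmx (T *: X))) ^+ 2
               * (alpha * beta)) :
  forall x t, u x t = 0.
Proof.
move=> x t.
have [M [Msym XE HE]] := weyl_hamiltonian X_sp HhatE.
have FE : expmx (T *: X) = flow M 0 T by rewrite /flow subr0 XE.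
have k0 : 0 < 4 * hbar ^+ 2 * (alpha * beta) by rewrite !mulr_gt0// exprn_gt0.
(* The threshold is chosen so that [large] says that the squared operator norm exceeds it. *)
have [||v [v1 vB]] := @opnorm_attained R n n (ursubmx (flow M 0 T)) (4 * hbar ^+ 2 * (alpha * beta))^-1.
- by rewrite invr_ge0 ltW.
- rewrite -[ltLHS]mul1r ltr_pdivrMr// -FE.
  by move: large; congr (_ < _); ring.
apply: (@solution_eq0 R n hbar M hbar_gt0 Msym (fun t x => u x t) _ _ T alpha beta K v) => //.
- by move=> r; apply: schwartz_schw; exact: u_sol.1.
- exact: solution_cis_derive HE u_sol.
- by move=> y; rewrite -enorm_sqr.
- by move=> y; rewrite -enorm_sqr.
- by rewrite mulrC -ltr_pdivrMr// mul1r.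
Qed.
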